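(* Let $(A,\mathfrak m)$ be a complete regular local ring. Let $\mathcal K^2_f(\operatorname{proj} A)$ be the full triangulated subcategory of $\mathcal K^2(\operatorname{proj} A)$ consisting of $2$-periodic complexes of finitely generated free $A$-modules all of whose cohomology modules have finite length. Then $\mathcal K^2_f(\operatorname{proj} A)$ has Auslander-Reiten (AR) triangles.
   Context: A $2$-periodic complex is a cochain complex $X$ with $X^{n+2}=X^n$ and $\partial_{n+2}=\partial_n$ for all $n\in\mathbb Z$. A $2$-periodic map is a chain map $f$ with $f_{n+2}=f_n$. Two $2$-periodic maps $f,g\colon X\to Y$ are $2$-homotopic if there are maps $s_n\colon X^n\to Y^{n-1}$ with $s_{n+2}=s_n$ for all $n$ and $f-g=\partial_Y s+s\partial_X$. $\mathcal K^2(\operatorname{proj} A)$ has as objects the $2$-periodic complexes of finitely generated free $A$-modules and as morphisms the $2$-homotopy classes of $2$-periodic maps. Shift: $X[1]^n=X^{n+1}$, $\partial_{X[1],n}=-\partial_{X,n+1}$. Cone of $f\colon X\to Y$: $\operatorname{cone}(f)^n=X^{n+1}\oplus Y^n$ with $\partial_n(x,y)=(-\partial_{X,n+1}(x),\partial_{Y,n}(y)-f_{n+1}(x))$. $\mathcal K^2(\operatorname{proj} A)$ is triangulated, the exact triangles being those isomorphic to $X\xrightarrow{f}Y\xrightarrow{u}\operatorname{cone}(f)\xrightarrow{v}X[1]$, where $u_n(y)=(0,y)$, $v_n(x,y)=-x$. AR-triangles: let $\mathcal C$ be a Krull-Schmidt triangulated category with shift $\Sigma$ (the category $\mathcal K^2_f(\operatorname{proj}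 A)$ is Krull-Schmidt when $A$ is Noetherian Henselian local, in particular when $A$ is complete). A triangle $N\xrightarrow{f}E\xrightarrow{g}M\xrightarrow{h}\Sigma N$ is a right AR-triangle ending at $M$ if: $M,N$ are indecomposable; $h\neq 0$; and for every indecomposable $D$ and every non-isomorphism $t\colon D\to M$ one has $h\circ t=0$. A triangle $\Sigma^{-1}M\xrightarrow{w}N\xrightarrow{f}E\xrightarrow{g}M$ is a left AR-triangle starting at $N$ if: $M,N$ are indecomposable; $w\neq0$; and for every indecomposable $D$ and every non-isomorphism $t\colon N\to D$ one has $t\circ w=0$. $\mathcal C$ has AR-triangles if for every indecomposable $M\in\mathcal C$ there exist a right AR-triangle ending at $M$ and a left AR-triangle starting at $M$. *)

(* Defs.v *)
From HB Require Import structures.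
From mathcomp Require Import all_boot all_order all_algebra.
From mathcomp Require Import boolp.

Set Implicit Arguments.
Unset Strict Implicit.
Unset Printing Implicit Defensive.

Import GRing.Theory Quotient.

Local Open Scope ring_scope.
Local Open Scope quotient_scope.

Section Rings.
Variable A : comNzRingType.
Implicit Types (m I P : {pred A}) (s : seq A).

(* [idealr_closed I]: I is a proper ideal. *)
Definition maximal_ideal m : Prop :=
  idealr_closed m /\
  forall I, idealr_closed I -> {subset m <= I} -> {subset I <= m}.

Definition local_ring m : Prop :=
  maximal_ideal m /\ forall I, maximal_ideal I -> I =i m.

Definition generates s I : Prop :=
  forall x, x \in I <-> exists c : nat -> A, x = \sum_(i < size s) c i * s`_i.

(* The unit ideal, excluded by [idealr_closed], is generated by 1. *)
Definition noetherian : Prop :=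
  forall I, idealr_closed I -> exists s, generates s I.

Definition prime_ideal P : Prop := idealr_closed P /\ prime_idealr_closed P.

Definition prime_chain (n : nat) (C : nat -> {pred A}) : Prop :=
  (forall i, (i <= n)%N -> prime_ideal (C i)) /\
  (forall i, (i < n)%N ->
     {subset C i <= C i.+1} /\ ~ {subset C i.+1 <= C i}).

Definition krull_dim (d : nat) : Prop :=
  (exists C, prime_chain d C) /\
  (forall n C, prime_chain n C -> (n <= d)%N).

Definition regular_local_ring m : Prop :=
  [/\ noetherian, local_ring m &
      exists d s, [/\ krull_dim d, size s = d & generates s m]].

Fixpoint ideal_pow m (n : nat) (x : A) : Prop :=
  if n is n'.+1 then
    exists (k : nat) (u v : nat -> A),
      (forall i, (i < k)%N -> u i \in m /\ ideal_pow m n' (v i)) /\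
      x = \sum_(i < k) u i * v i
  else True.

(* A -> lim_n A/m^n is injective and surjective; an element of the limit is
   given by representatives [a n] that agree modulo successive powers. *)
Definition adically_complete m : Prop :=
  (forall x, (forall n, ideal_pow m n x) -> x = 0) /\
  (forall a : nat -> A, (forall n, ideal_pow m n (a n.+1 - a n)) ->
     exists x, forall n, ideal_pow m n (x - a n)).

End Rings.

Section QuotientModule.
Variables (A : nzRingType) (V : lmodType A) (N : zmodClosed V).
Hypothesis NZ : GRing.scaler_closed N.

(* [{quot N}] is the quotient abelian group; the unused argument records that
   N is a submodule. *)
Definition lmod_quot of GRing.scaler_closed N : Type := {quot N}.
Local Notation Q := (lmod_quot NZ).
HB.instance Definition _ := GRing.Zmodule.copy Q {quot N}.

Definition lmod_quot_scale (a : A) (x : Q) : Q :=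
  \pi_({quot N}) (a *: repr (x : {quot N})).

Lemma lmod_quot_scaleE (a : A) (x : V) :
  lmod_quot_scale a (\pi_({quot N}) x) = \pi_({quot N}) (a *: x).
Proof.
apply/eqP; rewrite /lmod_quot_scale -[_ == _]idealrBE -scalerBr NZ //.
by rewrite idealrBE reprK.
Qed.

Lemma lmod_quot_ind (P : Q -> Prop) :
  (forall x : V, P (\pi_({quot N}) x)) -> forall x, P x.
Proof. by move=> HP; apply: (@quotW V {quot N}). Qed.

Lemma lmod_quot_pi_add (x y : V) :
  \pi_({quot N}) (x + y) =
  (\pi_({quot N}) x : Q) + (\pi_({quot N}) y : Q) :> Q.
Proof. exact: (raddfD \pi_({quot N})). Qed.

Lemma lmod_quot_scaleA (a b : A) (x : Q) :
  lmod_quot_scale a (lmod_quot_scale b x) = lmod_quot_scale (a * b) x.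
Proof. by elim/lmod_quot_ind: x => x; rewrite !lmod_quot_scaleE scalerA. Qed.

Lemma lmod_quot_scale1 : left_id 1 lmod_quot_scale.
Proof. by elim/lmod_quot_ind => x; rewrite lmod_quot_scaleE scale1r. Qed.

Lemma lmod_quot_scaleDr : right_distributive lmod_quot_scale +%R.
Proof.
move=> a; elim/lmod_quot_ind => x; elim/lmod_quot_ind => y.
by rewrite -lmod_quot_pi_add !lmod_quot_scaleE scalerDr lmod_quot_pi_add.
Qed.

Lemma lmod_quot_scaleDl (x : Q) : {morph lmod_quot_scale^~ x : a b / a + b}.
Proof.
move=> a b; elim/lmod_quot_ind: x => x.
by rewrite !lmod_quot_scaleE scalerDl lmod_quot_pi_add.
Qed.

HB.instance Definition _ := GRing.Zmodule_isLmodule.Build A Q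
  lmod_quot_scaleA lmod_quot_scale1 lmod_quot_scaleDr lmod_quot_scaleDl.

End QuotientModule.

Section Cohomology.
Variables (A : nzRingType) (U V W : lmodType A).
Variables (d : {linear U -> V}) (e : {linear V -> W}).

Definition cocycle_pred : {pred V} := [pred x | e x == 0].

Fact cocycle_submod : submod_closed cocycle_pred.
Proof.
split=> [|a x y]; rewrite !inE ?linear0 // => /eqP ex /eqP ey.
by rewrite linearP ex ey scaler0 addr0.
Qed.
HB.instance Definition _ :=
  GRing.isSubmodClosed.Build A V cocycle_pred cocycle_submod.

Record cocycle : Type := Cocycle {
  cocycle_val :> V;
  cocycleP : cocycle_val \in cocycle_pred
}.
HB.instance Definition _ := [isSub for cocycle_val].
HB.instance Definition _ := [Choice of cocycle by <:].
HB.instance Definition _ := [SubChoice_isSubLmodule of cocycle by <:].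

Definition coboundary_pred : {pred cocycle} :=
  [pred x | `[< exists u, \val x = d u >]].

Fact coboundary_submod : submod_closed coboundary_pred.
Proof.
split=> [|a x y]; rewrite !inE.
  by apply/asboolP; exists 0; rewrite !linear0.
move=> /asboolP[u xu] /asboolP[v yv]; apply/asboolP; exists (a *: u + v).
by rewrite !linearP -xu -yv.
Qed.
HB.instance Definition _ :=
  GRing.isSubmodClosed.Build A cocycle coboundary_pred coboundary_submod.

(* ker e / im d, for e \o d = 0. *)
Definition cohomology : lmodType A := lmod_quot coboundary_submod.

End Cohomology.

Definition finite_length (A : nzRingType) (V : lmodType A) : Prop :=
  exists (n : nat) (S : nat -> {pred V}),
    [/\ forall i, (i <= n)%N -> submod_closed (S i),
        S 0%N =i pred1 0,
        S n =i predT,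
        forall i, (i < n)%N ->
          {subset S i <= S i.+1} /\ ~ {subset S i.+1 <= S i}
      & forall (i : nat) (T : {pred V}), (i < n)%N -> submod_closed T ->
          {subset S i <= T} -> {subset T <= S i.+1} ->
          T =i S i \/ T =i S i.+1].

Section Complexes.
Variable A : comNzRingType.

(* A 2-periodic complex is determined by its degrees 0 and 1; a [vectType A]
   is a finitely generated free A-module. *)
Record cplx : Type := Cplx {
  cx0 : vectType A;
  cx1 : vectType A;
  dif0 : {linear cx0 -> cx1};
  dif1 : {linear cx1 -> cx0};
  dif10 : forall x, dif1 (dif0 x) = 0;
  dif01 : forall x, dif0 (dif1 x) = 0
}.

Record cmap (X Y : cplx) : Type := CMap {
  map0 : {linear cx0 X -> cx0 Y};
  map1 : {linear cx1 X -> cx1 Y};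
  cmap0P : forall x, map1 (dif0 X x) = dif0 Y (map0 x);
  cmap1P : forall x, map0 (dif1 X x) = dif1 Y (map1 x)
}.

(* The degree -1 part of Y is [cx1 Y]. *)
Definition homotopic (X Y : cplx) (f g : cmap X Y) : Prop :=
  exists (s0 : {linear cx0 X -> cx1 Y}) (s1 : {linear cx1 X -> cx0 Y}),
    (forall x, map0 f x - map0 g x = dif1 Y (s0 x) + s1 (dif0 X x)) /\
    (forall x, map1 f x - map1 g x = dif0 Y (s1 x) + s0 (dif1 X x)).

Program Definition cmap_id (X : cplx) : cmap X X :=
  @CMap X X idfun idfun _ _.

Program Definition cmap_comp (X Y Z : cplx) (g : cmap Y Z) (f : cmap X Y) :
  cmap X Z := @CMap X Z (map0 g \o map0 f) (map1 g \o map1 f) _ _.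
Next Obligation. by rewrite !cmap0P. Qed.
Next Obligation. by rewrite !cmap1P. Qed.

Program Definition cmap_zero (X Y : cplx) : cmap X Y :=
  @CMap X Y \0 \0 _ _.
Next Obligation. by rewrite linear0. Qed.
Next Obligation. by rewrite linear0. Qed.

(* Isomorphisms, zero objects and triangles are those of the homotopy
   category: equality of morphisms is [homotopic]. *)
Definition is_iso (X Y : cplx) (f : cmap X Y) : Prop :=
  exists g : cmap Y X,
    homotopic (cmap_comp g f) (cmap_id X) /\
    homotopic (cmap_comp f g) (cmap_id Y).

Definition isomorphic (X Y : cplx) : Prop := exists f : cmap X Y, is_iso f.

Definition is_zero (X : cplx) : Prop := homotopic (cmap_id X) (cmap_zero X X).

Section DirectSum.
Variables X Y : cplx.

Definition dsum_dif0 (p : cx0 X * cx0 Y) : cx1 X * cx1 Y :=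
  (dif0 X p.1, dif0 Y p.2).
Definition dsum_dif1 (p : cx1 X * cx1 Y) : cx0 X * cx0 Y :=
  (dif1 X p.1, dif1 Y p.2).

Fact dsum_dif0_linear : linear dsum_dif0.
Proof. by move=> a p q; rewrite /dsum_dif0 /= !linearP. Qed.
Fact dsum_dif1_linear : linear dsum_dif1.
Proof. by move=> a p q; rewrite /dsum_dif1 /= !linearP. Qed.
HB.instance Definition _ :=
  GRing.isLinear.Build A _ _ _ dsum_dif0 dsum_dif0_linear.
HB.instance Definition _ :=
  GRing.isLinear.Build A _ _ _ dsum_dif1 dsum_dif1_linear.

Fact dsum_dif10 p : dsum_dif1 (dsum_dif0 p) = 0.
Proof. by rewrite /dsum_dif1 /= !dif10. Qed.
Fact dsum_dif01 p : dsum_dif0 (dsum_dif1 p) = 0.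
Proof. by rewrite /dsum_dif0 /= !dif01. Qed.

Definition dsum : cplx :=
  @Cplx (cx0 X * cx0 Y)%type (cx1 X * cx1 Y)%type dsum_dif0 dsum_dif1
        dsum_dif10 dsum_dif01.

End DirectSum.

Section Shift.

Program Definition cshift (X : cplx) : cplx :=
  @Cplx (cx1 X) (cx0 X) (\- dif1 X) (\- dif0 X) _ _.
Next Obligation. by rewrite linearN dif01 !oppr0. Qed.
Next Obligation. by rewrite linearN dif10 !oppr0. Qed.

Program Definition cshift_map (X Y : cplx) (f : cmap X Y) :
  cmap (cshift X) (cshift Y) :=
  @CMap (cshift X) (cshift Y) (map1 f) (map0 f) _ _.
Next Obligation. by rewrite linearN cmap1P. Qed.
Next Obligation. by rewrite linearN cmap0P. Qed.

(* X[-1] has X^(n-1) = X^(n+1) in degree n, with differential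
   -d_(n-1) = -d_(n+1). *)
Definition cunshift (X : cplx) : cplx := cshift X.

(* X[-1][1] is X; its differentials are - - d, which is not convertible to d. *)
Program Definition cunshiftK (X : cplx) : cmap X (cshift (cunshift X)) :=
  @CMap X (cshift (cunshift X)) idfun idfun _ _.
Next Obligation. by rewrite opprK. Qed.
Next Obligation. by rewrite opprK. Qed.

End Shift.

Section Cone.
Variables (X Y : cplx) (f : cmap X Y).

Definition cone_dif0 (p : cx1 X * cx0 Y) : cx0 X * cx1 Y :=
  (- dif1 X p.1, dif0 Y p.2 - map1 f p.1).
Definition cone_dif1 (p : cx0 X * cx1 Y) : cx1 X * cx0 Y :=
  (- dif0 X p.1, dif1 Y p.2 - map0 f p.1).

Fact cone_dif0_linear : linear cone_dif0.
Proof.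
move=> a p q; rewrite /cone_dif0 /= !linearP /=; congr pair.
by rewrite /= scalerDr addrACA.
Qed.
Fact cone_dif1_linear : linear cone_dif1.
Proof.
move=> a p q; rewrite /cone_dif1 /= !linearP /=; congr pair.
by rewrite /= scalerDr addrACA.
Qed.
HB.instance Definition _ :=
  GRing.isLinear.Build A _ _ _ cone_dif0 cone_dif0_linear.
HB.instance Definition _ :=
  GRing.isLinear.Build A _ _ _ cone_dif1 cone_dif1_linear.

Fact cone_dif10 p : cone_dif1 (cone_dif0 p) = 0.
Proof.
rewrite /cone_dif1 /= !linearN linearB /= dif01 dif10 cmap1P sub0r.
by rewrite subrr !oppr0.
Qed.
Fact cone_dif01 p : cone_dif0 (cone_dif1 p) = 0.
Proof.
rewrite /cone_dif0 /= !linearN linearB /= dif01 dif10 cmap0P sub0r.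
by rewrite subrr !oppr0.
Qed.

Definition cone : cplx :=
  @Cplx (cx1 X * cx0 Y)%type (cx0 X * cx1 Y)%type cone_dif0 cone_dif1
        cone_dif10 cone_dif01.

Definition cone_in0 (y : cx0 Y) : cx1 X * cx0 Y := (0, y).
Definition cone_in1 (y : cx1 Y) : cx0 X * cx1 Y := (0, y).
Fact cone_in0_linear : linear cone_in0.
Proof. by move=> a x y; congr pair => /=; rewrite ?scaler0 ?addr0. Qed.
Fact cone_in1_linear : linear cone_in1.
Proof. by move=> a x y; congr pair => /=; rewrite ?scaler0 ?addr0. Qed.
HB.instance Definition _ :=
  GRing.isLinear.Build A _ _ _ cone_in0 cone_in0_linear.
HB.instance Definition _ :=
  GRing.isLinear.Build A _ _ _ cone_in1 cone_in1_linear.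

Program Definition cone_in : cmap Y cone :=
  @CMap Y cone cone_in0 cone_in1 _ _.
Next Obligation.
by rewrite /cone_in1 /cone_dif0 /= !linear0 ?oppr0 ?subr0 ?addr0.
Qed.
Next Obligation.
by rewrite /cone_in0 /cone_dif1 /= !linear0 ?oppr0 ?subr0 ?addr0.
Qed.

Program Definition cone_out : cmap cone (cshift X) :=
  @CMap cone (cshift X) (\- fst) (\- fst) _ _.
Next Obligation. by congr (- _); rewrite linearN. Qed.
Next Obligation. by congr (- _); rewrite linearN. Qed.

End Cone.

Definition exact_triangle (N E M : cplx)
    (f : cmap N E) (g : cmap E M) (h : cmap M (cshift N)) : Prop :=
  exists (X Y : cplx) (phi : cmap X Y)
         (a : cmap N X) (b : cmap E Y) (c : cmap M (cone phi)),
    [/\ is_iso a, is_iso b & is_iso c] /\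
    [/\ homotopic (cmap_comp b f) (cmap_comp phi a),
        homotopic (cmap_comp c g) (cmap_comp (cone_in phi) b)
      & homotopic (cmap_comp (cshift_map a) h) (cmap_comp (cone_out phi) c)].

Definition in_Kf (X : cplx) : Prop :=
  finite_length (cohomology (dif1 X) (dif0 X)) /\
  finite_length (cohomology (dif0 X) (dif1 X)).

Definition indecomposable (M : cplx) : Prop :=
  [/\ in_Kf M, ~ is_zero M &
      forall X Y, in_Kf X -> in_Kf Y -> isomorphic M (dsum X Y) ->
        is_zero X \/ is_zero Y].

Definition right_AR_triangle (N E M : cplx)
    (f : cmap N E) (g : cmap E M) (h : cmap M (cshift N)) : Prop :=
  [/\ in_Kf E, exact_triangle f g h, indecomposable M /\ indecomposable N,
      ~ homotopic h (cmap_zero _ _) &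
      forall (D : cplx) (t : cmap D M), indecomposable D -> ~ is_iso t ->
        homotopic (cmap_comp h t) (cmap_zero _ _)].

Definition left_AR_triangle (N E M : cplx)
    (w : cmap (cunshift M) N) (f : cmap N E) (g : cmap E M) : Prop :=
  [/\ in_Kf E, exact_triangle w f (cmap_comp (cunshiftK M) g),
      indecomposable M /\ indecomposable N,
      ~ homotopic w (cmap_zero _ _) &
      forall (D : cplx) (t : cmap N D), indecomposable D -> ~ is_iso t ->
        homotopic (cmap_comp t w) (cmap_zero _ _)].

Definition has_AR_triangles : Prop :=
  forall M : cplx, indecomposable M ->
    (exists (N E : cplx) (f : cmap N E) (g : cmap E M) (h : cmap M (cshift N)),
       right_AR_triangle f g h) /\
    (exists (L E : cplx) (w : cmap (cunshift L) M) (f : cmap M E)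
            (g : cmap E L),
       left_AR_triangle w f g).

End Complexes.

(* Main.v *)
(* The shift by d = dim A is a Serre functor of K^2_f(proj A): composition
   Hom(Y, Z) x Hom(Z, Y[d]) -> Hom(Y, Y[d]) is non-degenerate on both sides.
   Indeed, let y_i be powers of a regular system of parameters that annihilate Y
   and Z up to homotopy.  Since the y_i act by 0 on cohomology, d connecting
   homomorphisms identify homotopy classes Y -> Z[d] with certain cocycles of
   the Hom complex modulo (y_1, ..., y_d), and the trace pairing of that complex
   is perfect because A/(y_1, ..., y_d) is self-injective.

   By Fitting's lemma over the complete ring A, and because idempotent matrices
   over a local ring split, an indecomposable M has a local endomorphism ring.
   The duality pairing and the descending chain condition give a nonzero h in
   the socle of Hom(M, M[d]).  Let t : D -> M be a non-isomorphism with h t <> 0,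
   D indecomposable.  By duality h t s <> 0 for some s : M -> D, so t s is not in
   the radical of End(M), so it is invertible, and t is a retraction from an
   indecomposable object, hence an isomorphism: a contradiction.  So h is the
   connecting morphism of an AR-triangle; [d] is the identity or [1], according
   to the parity of d. *)
From HB Require Import structures.
Require Import Defs.
From mathcomp Require Import all_boot all_order all_algebra.
From mathcomp Require Import boolp.
From mathcomp Require Import ring zify.

Set Implicit Arguments.
Unset Strict Implicit.
Unset Printing Implicit Defensive.

Import GRing.Theory VectorInternalTheory.
Local Open Scope ring_scope.

(** * Noetherian modules *)

(** That y kills the cohomology does not by itself contract multiplication by y: a periodic complex
    is unbounded, so no induction over degrees can start. Regularity of A bridges the gap through
    finite free resolutions: comparing the complex with a resolution of the cokernel of one
    differential splits a differential up to a power of y, and a contraction follows. Regularity is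
    given by a dimension count only. Krull's principal ideal theorem turns it into regularity of the
    generators of m in every order; both the resolutions and the colon ideals of powers rest on
    this. Quotients and localisations are replaced by congruences between representatives. A complex
    is one square matrix with a parity projection, so Hom(Y, Z) and Hom(Y, Z[1]) share one matrix
    space and a single duality statement serves both parities of d. The trace must be the
    supertrace, which vanishes on boundaries. *)

Section Submodules.
Variable A : comNzRingType.

Definition submod (V : lmodType A) (S : V -> Prop) : Prop :=
  S 0 /\ forall a u v, S u -> S v -> S (a *: u + v).

Definition spanned (V : lmodType A) (S : V -> Prop) : Prop :=
  exists (n : nat) (g : nat -> V), (forall i, (i < n)%N -> S (g i)) /\
    forall x, S x -> exists c : nat -> A, x = \sum_(i < n) c i *: g i.

Definition noeth (V : lmodType A) : Prop :=
  forall S : V -> Prop, submod S -> spanned S.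

Section Closure.
Variables (V : lmodType A) (S : V -> Prop) (hS : submod S).

Lemma submod0 : S 0. Proof. exact: hS.1. Qed.
Lemma submodD u v : S u -> S v -> S (u + v).
Proof. by move=> su sv; have := hS.2 1 u v su sv; rewrite scale1r. Qed.
Lemma submodZ a u : S u -> S (a *: u).
Proof. by move=> su; have := hS.2 a u 0 su submod0; rewrite addr0. Qed.
Lemma submodN u : S u -> S (- u).
Proof. by move=> su; rewrite -scaleN1r; apply: submodZ. Qed.
Lemma submodB u v : S u -> S v -> S (u - v).
Proof. by move=> su sv; apply: submodD => //; apply: submodN. Qed.
Lemma submod_sum (I : Type) (r : seq I) (P : pred I) (F : I -> V) :
  (forall i, P i -> S (F i)) -> S (\sum_(i <- r | P i) F i).
Proof. by move=> h; apply: big_ind => //; [exact: submod0 | exact: submodD]. Qed.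
End Closure.

(** Otherwise choice produces a strictly increasing chain of submodules violating [P]; its union is
    finitely generated, hence reached at a finite stage. *)
Lemma noeth_ind (V : lmodType A) (P : (V -> Prop) -> Prop) : noeth V ->
  (forall S, submod S ->
     (forall T : V -> Prop, submod T -> (forall x, S x -> T x) ->
        (exists2 x, T x & ~ S x) -> P T) -> P S) ->
  forall S, submod S -> P S.
Proof.
move=> nV IH S hS; apply: contrapT => nPS.
pose good (T : {T : V -> Prop | submod T}) := ~ P (sval T).
have step (T : {T : V -> Prop | submod T}) : exists T' : {T : V -> Prop | submod T},
    good T -> [/\ good T', (forall x, sval T x -> sval T' x)
               & exists2 x, sval T' x & ~ sval T x].
  case: (pselect (good T)) => [gT|ngT]; last by exists T.
  case: T gT => T hT; rewrite /good /= => gT.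
  apply: contrapT => /forallNP no; apply: gT; apply: IH => // T' hT' sub str.
  by apply: contrapT => nT'; apply: (no (exist _ T' hT')).
have [nx nxP] := choice step.
pose C k := iter k nx (exist _ S hS).
have gC k : good (C k) by elim: k => [//|k ihk]; have [] := nxP _ ihk.
have mono k x : sval (C k) x -> sval (C k.+1) x by have [_ h _] := nxP _ (gC k); exact: h.
have monoD k l x : sval (C k) x -> sval (C (l + k)%N) x.
  by elim: l => // l ihl /ihl; apply: mono.
pose U x := exists k, sval (C k) x.
have hU : submod U.
  split; first by exists 0%N; apply: (proj1 hS).
  move=> a u v [k uk] [l vl]; exists (k + l)%N.
  apply: (proj2 (svalP (C (k + l)%N))); last exact: monoD.
  by rewrite addnC; apply: monoD.
have [n [g [gU gen]]] := nV U hU.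
have [K gK] : exists K, forall i, (i < n)%N -> sval (C K) (g i).
  elim: n g gU {gen} => [|n ihn] g gU; first by exists 0%N.
  have [K hK] := ihn g (fun i h => gU i (ltnW h)).
  have [l hl] := gU n (ltnSn n); exists (K + l)%N => i.
  rewrite ltnS leq_eqVlt => /orP[/eqP->|/hK iK]; first exact: monoD.
  by rewrite addnC; apply: monoD.
have [_ _ [x xK nxK]] := nxP _ (gC K); apply: nxK.
have [|c ->] := gen x; first by exists K.+1.
apply: (submod_sum (svalP (C K))) => i _.
by apply: (submodZ (svalP (C K))); apply: gK.
Qed.

Lemma noeth_acc (V : lmodType A) (S : nat -> V -> Prop) : noeth V ->
  (forall n, submod (S n)) -> (forall n x, S n x -> S n.+1 x) ->
  exists N, forall n x, S n x -> S N x.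
Proof.
move=> nV hS mono.
have monoD k l x : S k x -> S (l + k)%N x.
  by elim: l => // l ihl /ihl; apply: mono.
pose U x := exists k, S k x.
have hU : submod U.
  split; first by exists 0%N; apply: (proj1 (hS _)).
  move=> a u v [k uk] [l vl]; exists (k + l)%N.
  apply: (proj2 (hS _)); last exact: monoD.
  by rewrite addnC; apply: monoD.
have [n [g [gU gen]]] := nV U hU.
have [K gK] : exists K, forall i, (i < n)%N -> S K (g i).
  elim: n g gU {gen} => [|n ihn] g gU; first by exists 0%N.
  have [K hK] := ihn g (fun i h => gU i (ltnW h)).
  have [l hl] := gU n (ltnSn n); exists (K + l)%N => i.
  rewrite ltnS leq_eqVlt => /orP[/eqP->|/hK iK]; first exact: monoD.
  by rewrite addnC; apply: monoD.
exists K => m x xm; have [|c ->] := gen x; first by exists m.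
by apply: (submod_sum (hS K)) => i _; apply: (submodZ (hS K)); apply: gK.
Qed.

(** [g] is only a set-theoretic section; generators of the preimage of [S] map to generators of
    [S]. *)
Lemma noeth_image (V W : lmodType A) (f : {linear V -> W}) (g : W -> V) :
  cancel g f -> noeth V -> noeth W.
Proof.
move=> fK nV S hS; have [|n [h [hSn gen]]] := nV (fun x => S (f x)).
  by split=> [|a u v su sv]; rewrite ?linear0 ?linearP; [apply: hS.1 | apply: hS.2].
exists n, (f \o h); split=> // y sy; have [|c e] := gen (g y); first by rewrite fK.
by exists c; rewrite -(fK y) e linear_sum; apply: eq_bigr => i _; rewrite linearZ.
Qed.

Lemma noeth_prod (V W : lmodType A) : noeth V -> noeth W ->
  noeth (V * W)%type.
Proof.
move=> nV nW S hS.
have [|n [g [gS gen]]] := nV (fun v => exists w, S (v, w)).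
  split=> [|a u v [w uw] [w' vw]]; first by exists 0; apply: hS.1.
  by exists (a *: w + w'); have := hS.2 a _ _ uw vw.
have [i|w_ w_P] := @choice _ _ (fun i w => (i < n)%N -> S (g i, w)).
  by case: (boolP (i < n)%N) => [/gS[w h]|_]; [exists w | exists 0].
have [|n' [g' [gS' gen']]] := nW (fun w => S (0, w)).
  split=> [|a u v uS vS]; first exact: hS.1.
  rewrite [(0, _)](_ : _ = a *: (0, u) + (0, v)); first exact: hS.2.
  by congr pair => /=; rewrite scaler0 addr0.
exists (n + n')%N, (fun i => if (i < n)%N then (g i, w_ i) else (0, g' (i - n)%N)).
split=> [i ilt|[v w] vw].
  case: ifP => [/w_P//|/negbT]; rewrite -leqNgt => nle; apply: gS'.
  by rewrite ltn_subLR.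
have [|c ec] := gen v; first by exists w.
have [|c' ec'] := gen' (w - \sum_(i < n) c i *: w_ i).
  have S1 : S (\sum_(i < n) c i *: (g i, w_ i)).
    by apply: (submod_sum hS) => i _; apply: (submodZ hS); apply: w_P.
  have -> : (0, w - \sum_(i < n) c i *: w_ i) =
     (v, w) - \sum_(i < n) c i *: (g i, w_ i).
    apply: injective_projections; rewrite raddfB /= raddf_sum /=.
      by rewrite ec subrr.
    by rewrite sumrN [in RHS]raddf_sum.
  exact: (submodB hS).
exists (fun i => if (i < n)%N then c i else c' (i - n)%N).
rewrite big_split_ord /=.
under eq_bigr => i _ do rewrite ltn_ord.
under [X in _ + X]eq_bigr => i _ do rewrite ltnNge leq_addr /= addKn.
apply: injective_projections => /=; rewrite !raddf_sum /=.
  by rewrite -ec [X in _ + X]big1 ?addr0 // => i _; rewrite scaler0.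
by rewrite -ec' addrC subrK.
Qed.

Lemma noeth_row n : noeth A^o -> noeth 'rV[A]_n.
Proof.
move=> nA; elim: n => [|n ihn].
  move=> S hS; exists 0%N, (fun=> 0); split=> // x _; exists (fun=> 0).
  by rewrite big_ord0; apply/rowP; case.
pose f (p : A^o * 'rV[A]_n) : 'rV[A]_(1 + n) := row_mx p.1%:M p.2.
have lf : linear f.
  move=> a [x v] [y w]; rewrite /f /= scale_row_mx add_row_mx.
  by rewrite raddfD /= scale_scalar_mx.
pose F : {linear _ -> _} := HB.pack f (GRing.isLinear.Build _ _ _ _ f lf).
apply: (@noeth_image _ _ F (fun v => (lsubmx v 0 0 : A^o, rsubmx v))).
  by move=> v; rewrite /F /= /f /= -mx11_scalar hsubmxK.
by apply: noeth_prod.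
Qed.

End Submodules.

(** * Ideals and Krull's principal ideal theorem *)

Section Ideals.
Variable A : comNzRingType.
Implicit Types (I J p q : A -> Prop).

Definition ideal I : Prop := submod (V := A^o) I.

Definition subs (T : Type) (S S' : T -> Prop) : Prop := forall x, S x -> S' x.

Definition primeI p : Prop :=
  [/\ ideal p, ~ p 1 & forall a b, p (a * b) -> p a \/ p b].

Section Closure.
Variables (I : A -> Prop) (hI : ideal I).
Lemma ideal0 : I 0. Proof. exact: hI.1. Qed.
Lemma idealD a b : I a -> I b -> I (a + b). Proof. exact: (submodD hI). Qed.
Lemma idealB a b : I a -> I b -> I (a - b). Proof. exact: (submodB hI). Qed.
Lemma idealN a : I a -> I (- a). Proof. exact: (submodN hI). Qed.
Lemma idealMl a b : I b -> I (a * b). Proof. exact: (submodZ hI). Qed.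
Lemma idealMr a b : I a -> I (a * b).
Proof. by rewrite mulrC; apply: idealMl. Qed.
Lemma ideal_sum (T : Type) (r : seq T) (P : pred T) (F : T -> A) :
  (forall i, P i -> I (F i)) -> I (\sum_(i <- r | P i) F i).
Proof. exact: (submod_sum hI). Qed.
Lemma ideal1 a : I 1 -> I a. Proof. by move=> h; rewrite -[a]mulr1; apply: idealMl. Qed.
End Closure.

Lemma idealI (I : A -> Prop) : I 0 -> (forall a b, I a -> I b -> I (a + b)) ->
  (forall a b, I b -> I (a * b)) -> ideal I.
Proof. by move=> I0 ID IM; split=> // a u v iu iv; apply: ID => //; apply: IM. Qed.

Definition addI I (x : A) : A -> Prop := fun a => exists i c, I i /\ a = i + c * x.

Lemma addI_ideal I x : ideal I -> ideal (addI I x).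
Proof.
move=> hI; apply: idealI.
- by exists 0, 0; rewrite mul0r addr0; split=> //; apply: ideal0.
- move=> a b [i [c [ii ->]]] [j [e [ij ->]]]; exists (i + j), (c + e).
  by split; [apply: idealD | ring].
- move=> a b [i [c [ii ->]]]; exists (a * i), (a * c).
  by split; [apply: idealMl | ring].
Qed.

Lemma addI_sub I x : subs I (addI I x).
Proof. by move=> a ia; exists a, 0; rewrite mul0r addr0. Qed.

Lemma addI_mem I x : ideal I -> addI I x x.
Proof. by move=> hI; exists 0, 1; rewrite mul1r add0r; split=> //; apply: ideal0. Qed.

Lemma addI_min I x (K : A -> Prop) : ideal K -> subs I K -> K x -> subs (addI I x) K.
Proof. by move=> hK IK Kx _ [i [c [/IK ii ->]]]; apply: idealD => //; apply: idealMl. Qed.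

(** For [p] prime, these submodules are the preimages of their localisations at [p]; statements
    about the local ring at [p] are phrased through them. *)
Definition saturated p (V : lmodType A) (D : V -> Prop) : Prop :=
  forall s a, ~ p s -> D (s *: a) -> D a.

Lemma primeMn p s t : primeI p -> ~ p s -> ~ p t -> ~ p (s * t).
Proof. by case=> _ _ h ns nt /h[]. Qed.

Lemma prime_exp p s n : primeI p -> p (s ^+ n) -> p s.
Proof.
case=> _ n1 h; elim: n => [|n ihn]; first by rewrite expr0.
by rewrite exprS => /h[].
Qed.

(** This says that the local ring at a prime [p] minimal over [I] is Artinian modulo [I]. If [I] is
    not prime, take a b in [I] with a and b outside. The chains D_n + (a), saturated, and (D_n : a)
    lie over larger ideals, and D_n is stable once both of them are. *)
Lemma sat_dcc p I : noeth A^o -> primeI p -> ideal I ->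
  (forall q, primeI q -> subs I q -> subs q p -> subs p q) ->
  forall D : nat -> A -> Prop,
  (forall n, ideal (D n)) -> (forall n, saturated (V := A^o) p (D n)) ->
  (forall n, subs I (D n)) -> (forall n, subs (D n.+1) (D n)) ->
  exists N, forall n, (N <= n)%N -> subs (D N) (D n).
Proof.
move=> nA hp hI; move: I hI; have [pI p1 pM] := hp.
apply: (@noeth_ind _ A^o
  (fun I => (forall q, primeI q -> subs I q -> subs q p -> subs p q) ->
    forall D : nat -> A -> Prop, (forall n, ideal (D n)) ->
    (forall n, saturated (V := A^o) p (D n)) ->
    (forall n, subs I (D n)) -> (forall n, subs (D n.+1) (D n)) ->
    exists N, forall n, (N <= n)%N -> subs (D N) (D n)) nA)
  => I hI IH Ip D hD satD ID decD.
(* A saturated ideal not contained in [p] is the unit ideal. *)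
case: (pselect (exists n, subs (D n) p)) => [[k Dkp]|noD]; last first.
  exists 0%N => n _ x _; apply: (ideal1 (hD n)); apply: contrapT => nD.
  apply: noD; exists n => s Ds; apply: contrapT => ps; apply: nD.
  by apply: (satD n s) => //; rewrite /GRing.scale /= mulr1.
have IsubP : subs I p by move=> x /(ID k)/Dkp.
case: (pselect (primeI I)) => [prI|nprime].
  by exists k => n _ x /Dkp /(Ip I prI) h; apply: (ID n); apply: h.
have [a [b [Iab [nIa nIb]]]] : exists a b, I (a * b) /\ ~ I a /\ ~ I b.
  apply: contrapT => no; apply: nprime; split=> // [/IsubP//|a b Iab].
  by case: (pselect (I a)) => [|na]; [left | right; apply: contrapT => nb; apply: no; exists a, b].
have hyp T : subs I T -> forall q, primeI q -> subs T q -> subs q p -> subs p q.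
  by move=> IT q prq Tq; apply: Ip => // x /IT/Tq.
pose D1' n x := exists s, ~ p s /\ addI (D n) a (s * x).
pose D2' n x := D n (x * a).
have hD1' n : ideal (D1' n).
  have h := addI_ideal a (hD n).
  apply: idealI.
  - by exists 1; split=> //; rewrite mulr0; apply: ideal0.
  - move=> u v [s [ps us]] [t [pt vt]]; exists (s * t); split; first exact: primeMn.
    rewrite (_ : _ * _ = t * (s * u) + s * (t * v)); last by ring.
    by apply: idealD => //; apply: idealMl.
  - move=> c u [s [ps us]]; exists s; split=> //.
    by rewrite mulrCA; apply: idealMl.
have hcol J : ideal J -> ideal (fun x => J (x * a)).
  move=> hJ; apply: idealI => [|u v|c u]; rewrite ?mul0r; first exact: ideal0.
    by rewrite mulrDl; apply: idealD.
  by rewrite -mulrA; apply: idealMl.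
have addle J K : ideal K -> subs J K -> subs (addI J a) (addI K a).
  move=> hK JK; apply: addI_min; first exact: addI_ideal.
    by move=> y /JK; apply: addI_sub.
  exact: addI_mem.
have mono k' l : (k' <= l)%N -> subs (D l) (D k').
  move=> /subnK <-; elim: (l - k')%N => // j ihj x; rewrite addSn => /decD; exact: ihj.
have [||||||N1 h1] := IH (addI I a) (addI_ideal a hI) _ _ _ D1' hD1'.
- exact: addI_sub.
- by exists a => //; apply: addI_mem.
- by apply: hyp; apply: addI_sub.
- move=> n s x ps [t [pt tx]]; exists (t * s); split; first exact: primeMn.
  by rewrite -mulrA.
- move=> n x h; exists 1; split=> //; rewrite mul1r.
  by move: x h; apply: addle.
- by move=> n x [s [ps h]]; exists s; split=> //; move: h; apply: addle.
have [||||||N2 h2] := IH _ (hcol _ hI) _ _ _ D2' (fun n => hcol _ (hD n)).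
- by move=> x; apply: idealMr.
- by exists b => //; rewrite mulrC.
- by apply: hyp => x; apply: idealMr.
- move=> n s x ps; rewrite /D2' /GRing.scale /= -mulrA; exact: satD.
- by move=> n x; apply: ID.
- by move=> n x; apply: decD.
exists (maxn N1 N2) => n; rewrite geq_max => /andP[n1 n2] x Dx.
(* Modular law: s x = d + c a with d in [D n]; then c lies in ([D N2] : a), hence in ([D n] : a). *)
have [|s [ps [d [c [Dd e]]]]] := h1 n n1 x.
  by exists 1; split=> //; rewrite mul1r; apply: addI_sub; apply: (mono _ _ _ _ Dx); apply: leq_maxl.
apply: (satD n s) => //; rewrite /GRing.scale /= e.
apply: idealD => //; apply: (h2 n n2); apply: (mono _ _ (leq_maxr N1 N2)).
rewrite (_ : c * a = s * x - d); last by rewrite e addrC addKr.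
by apply: idealB => //; [apply: idealMl | apply: (mono _ _ _ _ Dd); rewrite geq_max n1].
Qed.

Lemma det_congr I n (M M' : 'M[A]_n) : ideal I ->
  (forall i j, I (M i j - M' i j)) -> I (\det M - \det M').
Proof.
move=> hI h; rewrite /determinant -sumrB; apply: ideal_sum => // s _.
rewrite -mulrBr; apply: idealMl => //.
apply: (big_ind2 (fun a b => I (a - b))) => [|a b c d ab cd|i _ //].
  by rewrite subrr; apply: ideal0.
rewrite (_ : _ - _ = a * (c - d) + d * (a - b)); last by ring.
by apply: idealD => //; apply: idealMl.
Qed.

(* Localised at [p], this is Nakayama's lemma for the ideal generated by x. *)
Lemma nakayama (V : lmodType A) p x (K T : V -> Prop) :
  primeI p -> p x -> submod K -> spanned K -> submod T -> saturated p T ->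
  (forall v, K v -> exists s t c, [/\ ~ p s, T t, K c & s *: v = t + x *: c]) ->
  subs K T.
Proof.
move=> hp px hK [n [g [gK gen]]] hT satT h.
have hp' : ideal p by case: hp.
have [i|s hs] := @choice 'I_n _ (fun i s => exists t c, [/\ ~ p s, T t, K c & s *: g i = t + x *: c]).
  exact: h (gK i (ltn_ord i)).
have [i|t ht] := @choice 'I_n _ (fun i t => exists c, [/\ ~ p (s i), T t, K c & s i *: g i = t + x *: c]).
  exact: hs.
have [i|C hC] := @choice 'I_n _ (fun i (C : nat -> A) => [/\ ~ p (s i), T (t i) & s i *: g i = t i + x *: \sum_(j < n) C j *: g j]).
  by have [c [ps Tt /gen[C ->] e]] := ht i; exists C.
(* Determinant trick: [M] sends the generators into [T], and modulo [p] it is the diagonal matrix of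
   the [s i], so its determinant is outside [p]. *)
pose M := \matrix_(i < n, j < n) ((i == j)%:R * s i - x * C i j).
have Mg i : \sum_j M i j *: g j = t i.
  under eq_bigr => j _ do rewrite mxE scalerBl.
  rewrite sumrB (bigD1 i) //= eqxx mul1r big1 => [|j /negPf ji]; last first.
    by rewrite eq_sym ji mul0r scale0r.
  rewrite addr0; have [_ _ ->] := hC i.
  by rewrite scaler_sumr; under [X in _ - X]eq_bigr => j _ do rewrite -scalerA; rewrite addrK.
have Mdet (k : 'I_n) : T (\det M *: g k).
  rewrite (_ : _ *: _ = \sum_i (\adj M) k i *: t i).
    by apply: (submod_sum hT) => i _; apply: (submodZ hT); have [] := hC i.
  under eq_bigr => i _ do rewrite -Mg scaler_sumr.
  rewrite exchange_big /=.
  under eq_bigr => j _ do (under eq_bigr => i _ do rewrite scalerA; rewrite -scaler_suml).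
  have e j : \sum_i (\adj M) k i * M i j = (\det M)%:M k j.
    by rewrite -mul_adj_mx [RHS]mxE.
  under eq_bigr => j _ do rewrite e.
  rewrite (bigD1 k) //= !mxE eqxx big1 ?addr0 // => j /negPf jk.
  by rewrite mxE eq_sym jk scale0r.
have ndet : ~ p (\det M).
  move=> pM; have : p (\det (diag_mx (\row_i s i))).
    rewrite -[\det _](subrK (\det M)); apply: idealD => //.
    apply: det_congr => // i j; rewrite !mxE.
    rewrite (_ : _ - _ = x * C i j); first exact: idealMr.
    by case: eqP => _; rewrite ?mul1r ?mul0r ?mulr1n ?mulr0n; ring.
  rewrite det_diag.
  have [_ p1 pMl] := hp; apply/(@big_ind _ (fun a => ~ p a)) => //.
    by move=> a b na nb; apply: primeMn.
  by move=> i _; rewrite mxE; have [] := hC i.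
move=> v /gen[c ->]; apply: (submod_sum hT) => i _; apply: (submodZ hT).
exact: satT ndet (Mdet i).
Qed.


(* Krull's principal ideal theorem, in the form used to shift chains of primes:
   if no q exists, p2 is minimal over p0 + (x), and one compares the
   saturations J n of (y^n) + p0, for y in p1 and not in p0. *)
Lemma krull_pit p0 p1 p2 x : noeth A^o -> primeI p0 -> primeI p1 -> primeI p2 ->
  subs p0 p1 -> ~ subs p1 p0 -> subs p1 p2 -> ~ subs p2 p1 -> p2 x ->
  exists q, [/\ primeI q, subs p0 q, ~ subs q p0, subs q p2 & ~ subs p2 q] /\ q x.
Proof.
move=> nA h0 h1 h2 s01 n10 s12 n21 p2x.
have [I0 _ M0] := h0; have [I1 _ M1] := h1; have [I2 u2 M2] := h2.
case: (pselect (p1 x)) => [p1x|np1x]; first by exists p1.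
apply: contrapT => noq.
have [y p1y np0y] : exists2 y, p1 y & ~ p0 y.
  by apply: contrapT => no; apply: n10 => y p1y; apply: contrapT => ny; apply: no; exists y.
(* Saturating also at powers of x makes x regular modulo [J n], which is what Nakayama needs below
   to compare [J N] with [J N.+1]. *)
pose J n a := exists (k : nat) s b, ~ p2 s /\ p0 (s * x ^+ k * a - b * y ^+ n).
have hJ n : ideal (J n).
  apply: idealI.
  - by exists 0%N, 1, 0; split=> //; rewrite mulr0 mul0r subrr; apply: ideal0.
  - move=> a a' [k [s [b [ns e]]]] [k' [s' [b' [ns' e']]]].
    exists (k + k')%N, (s * s'), (s' * x ^+ k' * b + s * x ^+ k * b').
    split; first exact: primeMn.
    rewrite (_ : _ - _ = s' * x ^+ k' * (s * x ^+ k * a - b * y ^+ n) +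
       s * x ^+ k * (s' * x ^+ k' * a' - b' * y ^+ n)); last by rewrite exprD; ring.
    by apply: idealD => //; apply: idealMl.
  - move=> c a [k [s [b [ns e]]]]; exists k, s, (c * b); split=> //.
    rewrite (_ : _ - _ = c * (s * x ^+ k * a - b * y ^+ n)); last by ring.
    exact: idealMl.
have satJ n : saturated (V := A^o) p2 (J n).
  move=> s a ns [k [s' [b [ns' e]]]]; exists k, (s' * s), b; split; first exact: primeMn.
  move: e; rewrite /GRing.scale /= (_ : s' * x ^+ k * (s * a) = s' * s * x ^+ k * a) //.
  by ring.
have decJ n : subs (J n.+1) (J n).
  move=> a [k [s [b [ns e]]]]; exists k, s, (b * y); split=> //.
  by rewrite -[b * y * _]mulrA -exprS.
have xJ n a : J n (x * a) -> J n a.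
  move=> [k [s [b [ns e]]]]; exists k.+1, s, b; split=> //.
  by rewrite exprSr mulrA -[_ * x * a]mulrA.
pose D n a := exists s, ~ p2 s /\ addI (J n) x (s * a).
have hD n : ideal (D n).
  have h := addI_ideal x (hJ n).
  apply: idealI.
  - by exists 1; split=> //; rewrite mulr0; apply: ideal0.
  - move=> u v [s [ps us]] [t [pt vt]]; exists (s * t); split; first exact: primeMn.
    rewrite (_ : _ * _ = t * (s * u) + s * (t * v)); last by ring.
    by apply: idealD => //; apply: idealMl.
  - move=> c u [s [ps us]]; exists s; split=> //.
    by rewrite mulrCA; apply: idealMl.
have JD n : subs (J n) (D n).
  by move=> a ja; exists 1; split=> //; rewrite mul1r; apply: addI_sub.
have p0J n : subs p0 (J n).
  move=> a pa; exists 0%N, 1, 0; split=> //.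
  by rewrite expr0 !mul1r mul0r subr0.
have [||||N hN] := @sat_dcc p2 (addI p0 x) nA h2 (addI_ideal x I0) _ D hD.
- move=> q hq s0q sq2; apply: contrapT => nsub; apply: noq; exists q.
  have qx : q x by apply: s0q; apply: addI_mem.
  split=> //; split=> //; first by move=> a pa; apply: s0q; apply: addI_sub.
  by move=> sq0; apply: np1x; apply: s01; apply: sq0.
- move=> n s a ps [t [pt ta]]; exists (t * s); split; first exact: primeMn.
  by rewrite -mulrA.
- move=> n; apply: addI_min => //; first by move=> a /(p0J n)/JD.
  by exists 1; split=> //; rewrite mul1r; apply: addI_mem.
- move=> n a [s [ps h]]; exists s; split=> //; move: h; apply: addI_min.
  + exact: addI_ideal.
  + by move=> z /decJ; apply: addI_sub.
  + exact: addI_mem.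
have sub : subs (J N) (J N.+1).
  apply: (@nakayama A^o p2 x (J N) (J N.+1) h2 p2x (hJ N) (nA _ (hJ N)) (hJ N.+1) (satJ _)).
  move=> a ja; have [s [ps [b [c [jb e]]]]] := hN _ (leqnSn N) a (JD _ _ ja).
  have jc : J N (c * x).
    rewrite (_ : c * x = s * a - b); last by rewrite e addrC addKr.
    by apply: idealB => //; [apply: idealMl | apply: decJ].
  exists s, b, c; split=> //; first by apply: xJ; rewrite mulrC.
  by rewrite /GRing.scale /= e [c * x]mulrC.
have [k [s [b [ps e]]]] : J N.+1 (y ^+ N).
  by apply: sub; exists 0%N, 1, 1; rewrite expr0 !mul1r subrr; split=> //; apply: ideal0.
(* As y is outside [p0], the factor y^N cancels; then s x^k lies in the prime [p1], which contains
   neither s nor x. *)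
have : p0 (y ^+ N * (s * x ^+ k - b * y)).
  by rewrite (_ : _ * _ = s * x ^+ k * y ^+ N - b * y ^+ N.+1) // exprS; ring.
case/M0 => [/(prime_exp h0)//|/s01 h].
have : p1 (s * x ^+ k).
  by rewrite -[_ * _](subrK (b * y)); apply: idealD => //; apply: idealMl.
by case/M1 => [/s12//|/(prime_exp h1)].
Qed.

End Ideals.

(** * Regular systems of parameters *)

Section Regular.
Variable A : comNzRingType.
Implicit Types (I J p q : A -> Prop).

Definition localI (m : A -> Prop) : Prop :=
  [/\ ideal m, ~ m 1 & forall a, ~ m a -> exists b, a * b = 1].

Lemma localI_prime m : localI m -> primeI m.
Proof.
case=> hm m1 mu; split=> // a b mab; case: (pselect (m a)) => [|na]; first by left.
right; have [c e] := mu a na.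
by rewrite (_ : b = c * (a * b)); [apply: idealMl | rewrite mulrA [c * a]mulrC e mul1r].
Qed.

Lemma localI_sat m (V : lmodType A) (T : V -> Prop) : localI m -> submod T ->
  saturated m T.
Proof.
move=> [_ _ mu] hT s a ns Tsa; have [c e] := mu s ns.
by rewrite -[a]scale1r -e mulrC -scalerA; apply: submodZ.
Qed.

Lemma localI_max m I : localI m -> ideal I -> ~ I 1 -> subs I m.
Proof.
move=> [_ _ mu] hI n1 a Ia; apply: contrapT => /mu[b e]; apply: n1.
by rewrite -e; apply: idealMr.
Qed.

Lemma noetherian_noeth : noetherian A -> noeth A^o.
Proof.
move=> nA S hS; case: (pselect (S 1)) => S1.
  exists 1%N, (fun=> 1); split=> // x _; exists (fun=> x).
  by rewrite big_ord1 /GRing.scale /= mulr1.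
have [|s gen] := nA [pred x | `[< S x >]].
  split; first by rewrite inE; apply/asboolP; apply: hS.1.
    by rewrite inE; apply/asboolP.
  by move=> a u v; rewrite !inE => /asboolP su /asboolP sv; apply/asboolP; apply: hS.2.
exists (size s), (nth 0 s); split=> [i ilt|x Sx].
  have : s`_i \in [pred x | `[< S x >]].
    apply/gen; exists (fun j => (j == i)%:R).
    rewrite (bigD1 (Ordinal ilt)) //= eqxx mul1r big1 ?addr0 // => j.
    by rewrite -val_eqE /= => /negPf ->; rewrite mul0r.
  by rewrite inE => /asboolP.
have /gen[c ->] : x \in [pred x | `[< S x >]] by rewrite inE; apply/asboolP.
by exists c.
Qed.

(** Uniqueness of the maximal ideal becomes invertibility outside it: by Noetherian induction every
    ideal without 1 lies in a maximal one, and this is applied to principal ideals. *)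
Lemma local_ring_localI (m : {pred A}) : noetherian A -> local_ring m ->
  localI (fun a => a \in m).
Proof.
move=> /noetherian_noeth nA [[mI mmax] muniq].
have [m0 m1 mP] := mI.
have key : forall S : A -> Prop, submod (V := A^o) S -> ~ S 1 -> forall x, S x -> x \in m.
  apply: (@noeth_ind _ A^o (fun S => ~ S 1 -> forall x, S x -> x \in m) nA) => S hS IH n1.
  case: (pselect (exists T : A -> Prop, [/\ submod (V := A^o) T, subs S T, ~ T 1 &
     exists2 x, T x & ~ S x])) => [[T [hT ST nT1 str]] x Sx|no x Sx].
    by apply: (IH T) => //; apply: ST.
  have SI : idealr_closed [pred x | `[< S x >]].
    split; first by rewrite inE; apply/asboolP; apply: hS.1.
      by rewrite inE; apply/asboolP.
    by move=> a u v; rewrite !inE => /asboolP su /asboolP sv; apply/asboolP; apply: hS.2.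
  have /muniq <- : maximal_ideal [pred x | `[< S x >]].
    split=> // J [J0 J1 JP] SJ y yJ; rewrite inE; apply/asboolP; apply: contrapT => nSy.
    apply: no; exists (fun x => x \in J); split.
    - by split=> // a u v; apply: JP.
    - by move=> z Sz; apply: SJ; rewrite inE; apply/asboolP.
    - exact/negP.
    - by exists y.
  by rewrite inE; apply/asboolP.
split; first by split=> // a u v; apply: mP.
  exact/negP.
move=> a na; apply: contrapT => nb; apply: na.
apply: (key (fun x => exists b, x = a * b)); last by exists 1; rewrite mulr1.
  split=> [|c u v [b ->] [b' ->]]; first by exists 0; rewrite mulr0.
  by exists (c * b + b'); rewrite /GRing.scale /=; ring.
by move=> [b e]; apply: nb; exists b.
Qed.

Definition chainI n (C : nat -> A -> Prop) : Prop :=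
  (forall i, (i <= n)%N -> primeI (C i)) /\
  (forall i, (i < n)%N -> subs (C i) (C i.+1) /\ ~ subs (C i.+1) (C i)).

Lemma prime_chain_chainI n (C : nat -> {pred A}) : prime_chain n C ->
  chainI n (fun i a => a \in C i).
Proof.
move=> [h1 h2]; split=> i hi; last first.
  by have [s ns] := h2 i hi; split.
have [[c0 c1 cP] cM] := h1 i hi; split; first by split=> // a u v; apply: cP.
  exact/negP.
by move=> a b /cM/orP.
Qed.

(** Krull's theorem on the top three primes puts x one step lower; induction carries it to the
    bottom at the cost of one step of the chain. The last clause lets the old top prime be put back
    above the shifted chain. *)
Lemma chain_shift n C x : noeth A^o -> chainI n.+1 C -> C n.+1 x ->
  exists C', [/\ chainI n C', C' 0%N x, subs (C 0%N) (C' 0%N) /\ ~ subs (C' 0%N) (C 0%N)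
    & subs (C' n) (C n.+1)].
Proof.
move=> nA; elim: n C => [|n ihn] C [hC incC] Cx.
  exists (fun=> C 1%N); split=> //; [split=> // i _; exact: hC | exact: incC].
have [s1 n1] := incC n (leqnSn _); have [s2 n2] := incC n.+1 (leqnn _).
have hle i : (i <= n.+2)%N -> primeI (C i) by exact: hC.
have [q [[hq s01 n10 s12 n21] qx]] := krull_pit nA (hle n (leq_trans (leqnSn _) (leqnSn _)))
  (hle n.+1 (leqnSn _)) (hle n.+2 (leqnn _)) s1 n1 s2 n2 Cx.
have [||C' [[hC' incC'] C'x sub C'q]] := ihn (fun i => if (i <= n)%N then C i else q).
- split=> i hi; first by case: ifP => // /leqW/leqW; apply: hC.
  rewrite ltnS in hi; rewrite hi.
  move: hi; rewrite leq_eqVlt => /orP[/eqP->|hi]; first by rewrite ltnn.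
  by rewrite hi; apply: incC; rewrite ltnS; apply: leqW; apply: ltnW.
- by rewrite ltnn.
exists (fun i => if (i <= n)%N then C' i else C n.+2); split=> //.
- split=> i hi; first by case: ifP => [/hC'//|_]; apply: hle.
  rewrite ltnS in hi; rewrite hi.
  move: hi; rewrite leq_eqVlt => /orP[/eqP->|hi]; last by rewrite hi; apply: incC'.
  rewrite ltnn; rewrite ltnn in C'q; split; first by move=> y /C'q/s12.
  by move=> h; apply: n21 => y /h/C'q.
- by rewrite ltnn.
Qed.

Fixpoint idl I (s : seq A) : A -> Prop :=
  if s is x :: s' then idl (addI I x) s' else I.

Lemma idl_ideal I s : ideal I -> ideal (idl I s).
Proof. by elim: s I => //= x s ih I hI; apply/ih/addI_ideal. Qed.

Lemma idl_sub I s : ideal I -> subs I (idl I s).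
Proof.
elim: s I => [|x s ih] I hI a Ia //=; apply: ih; first exact: addI_ideal.
exact: addI_sub.
Qed.

Lemma idl_mem I s x : ideal I -> x \in s -> idl I s x.
Proof.
elim: s I => [|y s ih] I hI //=; rewrite inE => /orP[/eqP->|xs].
  by apply: idl_sub; [apply: addI_ideal | apply: addI_mem].
by apply: ih => //; apply: addI_ideal.
Qed.

Lemma idl_min I s (K : A -> Prop) : ideal I -> ideal K -> subs I K ->
  (forall x, x \in s -> K x) -> subs (idl I s) K.
Proof.
move=> hI hK; elim: s I hI => [|y s ih] I hI IK sK //=.
apply: ih; first exact: addI_ideal.
  by apply: addI_min => //; apply: sK; rewrite inE eqxx.
by move=> x xs; apply: sK; rewrite inE xs orbT.
Qed.

Section Sequence.
Variables (m : A -> Prop) (nA : noeth A^o) (hm : localI m).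

Lemma prime_sub p : primeI p -> subs p m.
Proof. by case=> hp p1 _; apply: (localI_max hm). Qed.

Lemma chain_shift_max n C x : m x -> chainI n.+1 C -> exists C',
  [/\ chainI n C', C' 0%N x & subs (C 0%N) (C' 0%N) /\ ~ subs (C' 0%N) (C 0%N)].
Proof.
move=> mx [hC1 hC2].
have hC' : chainI n.+1 (fun i => if (i <= n)%N then C i else m).
  split=> i hi; first by case: ifP => // _; [apply: hC1 | exact: localI_prime].
  rewrite ltnS in hi; rewrite hi; have [s1 n1] := hC2 i hi.
  move: hi; rewrite leq_eqVlt => /orP[/eqP e|->//].
  rewrite e ltnn; rewrite e in s1 n1; split; first exact/prime_sub/hC1.
  by move=> h; apply: n1 => y /(prime_sub (hC1 n.+1 (leqnn _)))/h.
have [|C' [h1 h2 h3 _]] := chain_shift (x := x) nA hC'; first by rewrite ltnn.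
by exists C'.
Qed.

(** Krull's height theorem modulo [I], with its equality case. A shifted chain of full length starts
    at I + (x) itself, since otherwise I + (x), prime by induction, would prolong it. Elements of
    [C 0] are then i + c x with c again in [C 0], as x is outside, and Nakayama gives that [C 0] is
    [I]. *)
Lemma chain_bound s I : ideal I -> idl I s =1 m ->
  (forall n C, chainI n C -> subs I (C 0%N) -> (n <= size s)%N) /\
  (forall C, chainI (size s) C -> subs I (C 0%N) -> primeI I).
Proof.
elim: s I => [|x s ih] I hI Im.
  have {}Im : I = m by apply: funext.
  split=> [[|n] C hC IC|C _ _]; rewrite ?Im //; last exact: localI_prime.
  case: hC (hC) => hC1 hC2 hC; case: (hC2 0%N) => // _; case.
  move=> a /(prime_sub (hC1 1%N isT)); rewrite -Im; exact: IC.
have hI' := addI_ideal x hI; have [iha ihb] := ih _ hI' Im.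
have mx : m x by rewrite -Im; apply: idl_mem; rewrite // inE eqxx.
have shift n C : chainI n.+1 C -> subs I (C 0%N) -> exists C',
    [/\ chainI n C', subs (addI I x) (C' 0%N) & subs (C 0%N) (C' 0%N) /\ ~ subs (C' 0%N) (C 0%N)].
  move=> hC IC; have [C' [hC' C'x [s0 n0]]] := chain_shift_max mx hC.
  exists C'; split=> //; apply: addI_min => //; last by move=> y /IC/s0.
  by have [] := hC'.1 0%N isT.
split=> [[|n] C hC IC|C hC IC] //=.
  by have [C' [hC' IC' _]] := shift n C hC IC; exact: iha hC' IC'.
have [C' [hC' IC' [s0 n0]]] := shift _ C hC IC.
have pI' := ihb _ hC' IC'.
have C'I : subs (C' 0%N) (addI I x).
  apply: contrapT => ns.
  suff /iha : chainI (size s).+1 (fun i => if i is i'.+1 then C' i' else addI I x).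
    by move=> /(_ (fun a h => h)); rewrite ltnn.
  by split=> [[|i]|[|i]] hi //; [apply: hC'.1 | apply: hC'.2].
have pC := hC.1 0%N isT; have [hC0 _ CM] := pC.
have nx : ~ C 0%N x.
  by move=> Cx; apply: n0 => a /C'I; apply: addI_min.
have sub : subs (C 0%N) I.
  apply: (@nakayama A A^o m x (C 0%N) I (localI_prime hm) mx hC0 (nA hC0) hI (localI_sat hm hI)).
  move=> a Ca; have [i [c [Ii e]]] := C'I _ (s0 _ Ca).
  have Cc : C 0%N c.
    have : C 0%N (c * x) by rewrite (_ : _ * _ = a - i); [apply: idealB => //; exact: IC | rewrite e addrC addKr].
    by case/CM.
  by exists 1, i, c; split=> //; [case: hm | rewrite /GRing.scale /= mul1r e mulrC].
by rewrite (_ : I = C 0%N) //; apply: funext => a; apply: propext; split; [apply: IC | apply: sub].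
Qed.

(** If x were in [I], the unshifted chain would lie above I + (x) and exceed the bound for the
    shorter list. *)
Lemma chain_cons I x s : ideal I -> idl I (x :: s) =1 m ->
  (exists2 C, chainI (size s).+1 C & subs I (C 0%N)) ->
  (exists2 C, chainI (size s) C & subs (addI I x) (C 0%N)) /\ ~ I x.
Proof.
move=> hI Im [C hC IC].
have [C' [hC' s' _]] : exists C', [/\ chainI (size s) C', subs (addI I x) (C' 0%N) & True].
  have mx : m x by rewrite -Im; apply: idl_mem; rewrite // inE eqxx.
  have [C' [h1 h2 [h3 _]]] := chain_shift_max mx hC.
  exists C'; split=> //; apply: addI_min => //; last by move=> y /IC/h3.
  by have [] := h1.1 0%N isT.
split; first by exists C'.
move=> Ix; have [h _] := chain_bound (addI_ideal x hI) Im.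
suff /h : chainI (size s).+1 C.
  rewrite ltnn => h0; suff: false by []. apply: h0 => a; apply: addI_min => //; last exact: IC.
  by have [] := hC.1 0%N isT.
exact: hC.
Qed.

(* A regular local ring: m is generated by as many elements as there are steps
   in a chain of primes.  Every initial part of the generators spans a prime
   ideal that does not contain the next one. *)
Lemma idl_prime I ys s : ideal I -> idl I (ys ++ s) =1 m ->
  (exists2 C, chainI (size (ys ++ s)) C & subs I (C 0%N)) ->
  primeI (idl I ys) /\ (forall z s', s = z :: s' -> ~ idl I ys z).
Proof.
elim: ys I => [|y ys ih] I hI Im; last first.
  by case/(chain_cons hI Im) => Ch _; apply: ih => //; apply: addI_ideal.
case=> C hC IC; split; first exact: (chain_bound hI Im).2 hC IC.
move=> z s' e; rewrite /= in Im hC; subst s.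
by have [|_] := chain_cons hI Im; first by exists C.
Qed.

End Sequence.
End Regular.

(** * Ideals of powers of a regular system *)

Section Powers.
Variables (A : comNzRingType) (d : nat) (x : 'I_d -> A).
Implicit Types (P Q : pred 'I_d) (a b : 'I_d -> nat) (q : seq 'I_d).

Definition powI P b : A -> Prop :=
  fun u => exists c : 'I_d -> A, u = \sum_(i | P i) c i * x i ^+ b i.

Lemma powI_ideal P b : ideal (powI P b).
Proof.
apply: idealI.
- by exists (fun=> 0); rewrite big1 // => i _; rewrite mul0r.
- move=> _ _ [c ->] [e ->]; exists (fun i => c i + e i); rewrite -big_split /=.
  by apply: eq_bigr => i _; rewrite mulrDl.
- move=> u _ [c ->]; exists (fun i => u * c i); rewrite mulr_sumr.
  by apply: eq_bigr => i _; rewrite mulrA.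
Qed.
Hint Resolve powI_ideal : core.

Lemma powI_mem P b i : P i -> powI P b (x i ^+ b i).
Proof.
move=> Pi; exists (fun j => (j == i)%:R); rewrite (bigD1 i) //= eqxx mul1r big1 ?addr0 //.
by move=> j /andP[_ /negPf->]; rewrite mul0r.
Qed.

Lemma powI_min P b (K : A -> Prop) : ideal K -> (forall i, P i -> K (x i ^+ b i)) ->
  subs (powI P b) K.
Proof.
move=> hK h u [c ->]; apply: ideal_sum => // i Pi; apply: idealMl => //; exact: h.
Qed.

Lemma powI_sub P Q b b' : (forall i, P i -> Q i /\ (b' i <= b i)%N) ->
  subs (powI P b) (powI Q b').
Proof.
move=> h; apply: powI_min => // i /h[Qi bi].
by rewrite -(subnK bi) exprD; apply: idealMl => //; apply: powI_mem.
Qed.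

Lemma powI_split P b i u : P i -> powI P b u ->
  exists w c, powI (fun j => P j && (j != i)) b w /\ u = w + c * x i ^+ b i.
Proof.
move=> Pi [c ->]; rewrite (bigD1 i) //= addrC.
by exists (\sum_(j | P j && (j != i)) c j * x j ^+ b j), (c i); split=> //; exists c.
Qed.

Definition upd b i k : 'I_d -> nat := fun j => if j == i then k else b j.

(** Quantifying over all subsets asks for regularity in every order: the passage to powers cancels
    both the new x_j and one of the x_i in [P]. *)
Definition regular_system : Prop := forall P j, ~~ P j -> forall u,
  powI P (fun=> 1%N) (x j * u) -> powI P (fun=> 1%N) u.

Hypothesis xreg : regular_system.

(** Induction on the total exponent. Lowering b_i by one gives u = w + v x_i^(b_i - 1); cancelling
    x_i^(b_i - 1) modulo the other powers puts x_j v, hence v, in the ideal with exponent 1 at i. *)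
Lemma powI_reg P b j u : ~~ P j -> powI P b (x j * u) -> powI P b u.
Proof.
have [n] := ubnP (\sum_(i | P i) b i); elim: n => // n ih in P b j u *.
rewrite ltnS => lebn Pj xu.
case: (pselect (exists2 i, P i & b i = 0%N)) => [[i Pi bi]|b0].
  by rewrite -[u]mulr1; apply: idealMl => //; rewrite -(expr0 (x i)) -bi; apply: powI_mem.
case: (pselect (exists2 i, P i & (1 < b i)%N)) => [[i Pi bi]|b1]; last first.
  have e i : P i -> b i = 1%N.
    move=> Pi; case e: (b i) => [|[|k]] //; first by case: b0; exists i.
    by case: b1; exists i => //; rewrite e.
  have sub1 : subs (powI P b) (powI P (fun=> 1%N)) by apply: powI_sub => k Pk; rewrite e.
  have sub2 : subs (powI P (fun=> 1%N)) (powI P b) by apply: powI_sub => k Pk; rewrite e.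
  by apply/sub2/(xreg Pj)/sub1.
pose P' l := P l && (l != i); have P'i : ~~ P' i by rewrite /P' eqxx andbF.
have ji : j != i by apply: contraNneq Pj => ->.
have P'j : ~~ P' j by rewrite /P' (negPf Pj).
have ltP' : (\sum_(l | P' l) b l < n)%N.
  by move: lebn; rewrite (bigD1 i) //=; apply: leq_trans; rewrite -[X in (X < _)%N]add0n ltn_add2r; lia.
have ltU k : (k < b i)%N -> (\sum_(l | P l) upd b i k l < n)%N.
  move=> ki; move: lebn; rewrite (bigD1 i) //= => /(leq_trans _); apply.
  rewrite (bigD1 i) //= {1}/upd eqxx.
  rewrite (eq_bigr b) => [|l /andP[_ /negPf li]]; last by rewrite /upd li.
  by rewrite ltn_add2r.
have P'upd k : subs (powI P' (upd b i k)) (powI P' b).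
  by apply: powI_sub => l /andP[Pl /negPf li]; rewrite /P' Pl /upd li.
have P'updV k : subs (powI P' b) (powI P' (upd b i k)).
  by apply: powI_sub => l /andP[Pl /negPf li]; rewrite /P' Pl /upd li.
have P'P c : subs (powI P' c) (powI P c) by apply: powI_sub => l /andP[].
have [||w [v [wP eu]]] := powI_split (b := upd b i (b i).-1) Pi (ih P _ j u _ Pj _).
- by apply: ltU; lia.
- move: xu; apply: powI_sub => l Pl; split=> //; rewrite /upd; case: eqP => [->|//].
  exact: leq_pred.
rewrite /upd eqxx in eu; have {}wP := P'upd _ _ wP.
have bi' : b i = (b i).-1.+1 by lia.
have [w' [t [wP' et]]] := powI_split Pi xu.
have h1 : powI P' b (x i ^+ (b i).-1 * (x j * v - x i * t)).
  rewrite (_ : _ * _ = w' - x j * w); first by apply: idealB => //; apply: idealMl.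
  move: et; rewrite eu bi' /= exprS => et.
  by rewrite (_ : w' = x j * (w + v * x i ^+ (b i).-1) - t * (x i * x i ^+ (b i).-1));
    [ring | rewrite et addrK].
have h2 : powI P' b (x j * v - x i * t).
  by elim: (_.-1) h1 => [|k ihk]; rewrite ?mul1r // exprS -mulrA => /(ih P' b i _ ltP' P'i).
have h3 : powI P (upd b i 1%N) v.
  apply: (ih P _ j) => //; first exact: ltU.
  rewrite -[x j * v](subrK (x i * t)); apply: idealD => //; last first.
    apply: idealMr => //; rewrite (_ : x i = x i ^+ upd b i 1%N i).
      exact: powI_mem.
    by rewrite /upd eqxx expr1.
  exact/P'P/P'updV.
have [w2 [e [w2P ev]]] := powI_split Pi h3; rewrite /upd eqxx expr1 in ev.
rewrite eu ev (_ : _ + _ = (w + w2 * x i ^+ (b i).-1) + e * x i ^+ b i).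
  apply: idealD => //; last by apply: idealMl => //; apply: powI_mem.
  by apply: P'P; apply: idealD => //; apply: idealMr => //; apply: P'upd w2P.
by rewrite [in RHS]bi' exprS; ring.
Qed.

Lemma powI_regX P b j n u : ~~ P j -> powI P b (x j ^+ n * u) -> powI P b u.
Proof.
by move=> Pj; elim: n => [|k ihk]; rewrite ?mul1r // exprS -mulrA => /(powI_reg Pj).
Qed.

Lemma powI_colon P b i c u : P i -> (c <= b i)%N -> powI P b (x i ^+ c * u) ->
  powI P (upd b i (b i - c)) u.
Proof.
move=> Pi cb /(powI_split Pi)[w [e [wP eu]]].
have P'i : ~~ (P i && (i != i)) by rewrite eqxx andbF.
have /(powI_regX P'i) h : powI (fun j => P j && (j != i)) b (x i ^+ c * (u - e * x i ^+ (b i - c))).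
  rewrite (_ : _ * _ = x i ^+ c * u - e * x i ^+ b i); first by rewrite eu addrK.
  by rewrite -[in RHS](subnKC cb) exprD; ring.
rewrite -[u](subrK (e * x i ^+ (b i - c))); apply: idealD => //.
  move: h; apply: powI_sub => l /andP[Pl /negPf li]; split=> //.
  by rewrite /upd li.
apply: idealMl => //.
by have := @powI_mem P (upd b i (b i - c)) i Pi; rewrite {2}/upd eqxx.
Qed.

(** Over all indices this generates the socle of A modulo the powers; partial lists serve the
    inductions. *)
Definition topprod a q : A := \prod_(i <- q) x i ^+ (a i).-1.
Definition updl a q : 'I_d -> nat := fun i => if i \in q then 1%N else a i.

Local Notation J a := (powI xpredT a).

Lemma topprod_colon a q v : (forall i, 0 < a i)%N -> uniq q ->
  J a (topprod a q * v) -> J (updl a q) v.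
Proof.
move=> a0; elim: q v => [|i q ih] v /=.
  by rewrite /topprod big_nil mul1r => _; apply: powI_sub.
case/andP=> iq uq; rewrite /topprod big_cons -mulrA mulrCA => /(ih _ uq) h.
have := powI_colon (i := i) isT _ h; rewrite /updl (negPf iq) leq_pred => /(_ isT).
apply: powI_sub => j _; split=> //; rewrite /upd inE.
by case: (j == i) => //=; have := a0 i; lia.
Qed.

Lemma topprod_mem a q i : (forall i, 0 < a i)%N -> i \in q -> J a (topprod a q * x i).
Proof.
move=> a0; elim: q => // j q ih; rewrite inE /topprod big_cons => /orP[/eqP <-|iq].
  rewrite mulrAC; apply: idealMr => //; rewrite -exprSr prednK //; exact: powI_mem.
by rewrite -mulrA; apply: idealMl => //; apply: ih.
Qed.

Lemma powI_mulP P b a v w : (forall l, P l -> J a (v * x l ^+ b l)) ->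
  powI P b w -> J a (v * w).
Proof.
move=> h; move: w; apply: powI_min => //.
by apply: idealI => [|y z|y z]; rewrite ?mulr0 ?mulrDr 1?[v * (y * _)]mulrCA; [apply: ideal0 | apply: idealD | apply: idealMl].
Qed.

(** By induction u is t times the shorter product. Being killed by x_i forces t into the ideal with
    exponent a_i - 1 at i and 1 on [q]; the shorter product absorbs every generator of it but
    x_i^(a_i - 1). *)
Lemma topprod_socle a q u : (forall i, 0 < a i)%N -> uniq q ->
  (forall i, i \in q -> J a (x i * u)) -> exists t, J a (u - t * topprod a q).
Proof.
move=> a0; elim: q => [|i q ih] /=.
  by move=> _ _; exists u; rewrite /topprod big_nil mulr1 subrr; apply: ideal0.
case/andP=> iq uq hx; have [|t ht] := ih uq.
  by move=> j jq; apply: hx; rewrite inE jq orbT.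
have /(topprod_colon a0 uq) h : J a (topprod a q * (x i * t)).
  rewrite (_ : _ * _ = x i * u - x i * (u - t * topprod a q)); last by ring.
  by apply: idealB => //; [apply: hx; rewrite inE eqxx | apply: idealMl].
rewrite -(expr1 (x i)) in h.
have {}h := powI_colon (i := i) isT _ h; rewrite /updl (negPf iq) in h.
have [w [e [wP et]]] := powI_split (i := i) isT (h (a0 i)).
rewrite /upd eqxx subn1 in et.
exists e; rewrite (_ : _ - _ = (u - t * topprod a q) + topprod a q * w); last first.
  by rewrite et /topprod big_cons; ring.
apply: idealD => //; apply: powI_mulP wP => l /= /negPf li; rewrite /upd li.
case: ifP => lq; first by rewrite expr1; apply: topprod_mem.
by apply: idealMl => //; apply: powI_mem.
Qed.

(* A is self-injective modulo the ideal of powers: extension along m. *)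
Lemma koszul_lift a (u : 'I_d -> A) : (forall i, 0 < a i)%N ->
  (forall i j, J a (x i * u j - x j * u i)) ->
  (forall i, J a (x i ^+ (a i).-1 * u i)) ->
  exists w, forall i, J a (u i - x i * w).
Proof.
move=> a0 hc ht.
(* [u] lists the values of a map on the generators of m, and w is the value at 1 of an extension,
   built one generator at a time. *)
suff [w hw] : exists w, forall i, i \in enum 'I_d -> J a (u i - x i * w).
  by exists w => i; apply: hw; rewrite mem_enum.
have := enum_uniq 'I_d; elim: (enum _) => [|i q ih] /=; first by exists 0.
case/andP=> iq uq; have [w hw] := ih uq.
have [t tP] : exists t, J a (u i - x i * w - t * topprod a q).
  apply: topprod_socle => // j jq.
  rewrite (_ : _ * _ = (x j * u i - x i * u j) + x i * (u j - x j * w)); last by ring.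
  by apply: idealD => //; apply: idealMl => //; apply: hw.
have ui : uniq (i :: q) by rewrite /= iq.
have /(topprod_colon a0 ui) h : J a (topprod a (i :: q) * t).
  rewrite (_ : _ * _ = x i ^+ (a i).-1 * u i - w * x i ^+ a i
     - x i ^+ (a i).-1 * (u i - x i * w - t * topprod a q)).
    apply: idealB => //; last exact: idealMl.
    by apply: idealB => //; apply: idealMl => //; apply: powI_mem.
  by rewrite -[in X in w * X](prednK (a0 i)) exprS /topprod big_cons; ring.
have [v [e [vP et]]] := powI_split (i := i) isT h.
rewrite /updl inE eqxx expr1 in et.
have hv : J a (topprod a q * v).
  apply: powI_mulP vP => l /= /negPf li; rewrite /updl inE li /=.
  case: ifP => lq; first by rewrite expr1; apply: topprod_mem.
  by apply: idealMl => //; apply: powI_mem.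
(* A multiple of the product over [q] does not disturb the indices in [q]: x_j times it lies in the
   ideal of powers. *)
exists (w + e * topprod a q) => j; rewrite inE => /orP[/eqP->|jq].
  rewrite (_ : _ - _ = (u i - x i * w - t * topprod a q) + topprod a q * v).
    exact: idealD.
  by rewrite et; ring.
rewrite (_ : _ - _ = (u j - x j * w) - e * (topprod a q * x j)); last by ring.
by apply: idealB => //; [apply: hw | apply: idealMl => //; apply: topprod_mem].
Qed.

End Powers.

(** For regularity at j modulo the generators in [P], reorder the generators as [P], then j, then
    the rest: an initial part spans a prime ideal without the next generator. *)
Lemma regular_local_system (A : comNzRingType) (m : {pred A}) : regular_local_ring m ->
  exists (d : nat) (x : 'I_d -> A),
    [/\ noeth A^o, localI (fun a => a \in m), regular_system x &
        (fun a => a \in m : Prop) = powI x xpredT (fun=> 1%N)].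
Proof.
case=> nA lA [d [s [[[C hC] _] sd gen]]].
have nA' := noetherian_noeth nA; have hm := local_ring_localI nA lA.
pose x (i : 'I_d) := s`_i; exists d, x.
have em : (fun a => a \in m : Prop) = powI x xpredT (fun=> 1%N).
  apply: funext => a; apply: propext; split=> [/gen[c ->]|[c ->]].
    by rewrite sd; exists (fun i => c i); apply: eq_bigr => i _; rewrite expr1.
  apply: (ideal_sum (I := fun a => a \in m)); first by case: hm.
  move=> i _; apply: (idealMl (I := fun a => a \in m)); first by case: hm.
  rewrite expr1 /x; apply/gen; exists (fun j : nat => (j == i :> nat)%:R).
  have ilt : (i < size s)%N by rewrite sd.
  rewrite (bigD1 (Ordinal ilt)) //= eqxx mul1r big1 ?addr0 // => j.
  by rewrite -val_eqE /= => /negPf ->; rewrite mul0r.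
split=> // P j Pj u.
pose I0 := fun a : A => a = 0.
have hI0 : ideal I0.
  by apply: idealI => [//|a b -> ->|a b ->]; rewrite /I0 ?addr0 ?mulr0.
have powE Q (q : seq 'I_d) : Q =i q -> forall a, idl I0 [seq x i | i <- q] a <-> powI x Q (fun=> 1%N) a.
  move=> Qq a; split; move: a.
    apply: idl_min => // [|a ->|y /mapP[i iq ->]]; first exact: powI_ideal.
      exact: (ideal0 (powI_ideal _ _ _)).
    by have := @powI_mem _ _ x Q (fun=> 1%N) i; rewrite expr1; apply; move: iq; rewrite -Qq.
  apply: powI_min; first exact: idl_ideal.
  move=> i Qi; rewrite expr1; apply: idl_mem => //; apply: map_f.
  by rewrite -Qq.
pose rest := [seq i <- enum 'I_d | ~~ P i & i != j].
have Pin i : (i \in P) = P i by [].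
have perm : perm_eq (enum P ++ j :: rest) (enum 'I_d).
  apply: uniq_perm; last 1 first.
  - move=> i; rewrite mem_cat mem_enum inE [i \in rest]mem_filter !mem_enum andbT.
    by rewrite Pin [RHS]inE; case: (P i) => //=; case: eqP.
  - rewrite cat_uniq enum_uniq cons_uniq [j \in rest]mem_filter eqxx andbF /= filter_uniq ?enum_uniq // ?andbT.
    rewrite mem_enum negb_or Pin Pj /=; apply/hasPn => i.
    by rewrite [i \in rest]mem_filter [i \in enum P]mem_enum Pin => /andP[/andP[]].
  - exact: enum_uniq.
have Im : idl I0 ([seq x i | i <- enum P] ++ [seq x i | i <- j :: rest]) =1 (fun a => a \in m : Prop).
  move=> a; rewrite -map_cat; apply: etrans (esym (congr1 (@^~ a) em)); apply: propext; apply: powE => i.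
  by rewrite (perm_mem perm) mem_enum.
have sz : size ([seq x i | i <- enum P] ++ [seq x i | i <- j :: rest]) = d.
  by rewrite -map_cat size_map (perm_size perm) size_enum_ord.
have [|[_ _ prM] nz] := idl_prime nA' hm hI0 Im.
  exists (fun i a => a \in C i); first by rewrite sz; apply: prime_chain_chainI.
  by move=> a ->; have [[h _ _] _] := hC.1 0%N isT.
move=> /(powE P (enum P)) h; apply/(powE P (enum P)); first by move=> i; rewrite mem_enum.
case: (prM _ _ (h _)) => //; first by move=> i; rewrite mem_enum.
by move=> /(nz _ _ erefl).
Qed.

(** * Self-injectivity modulo powers of the parameters *)

Section SelfInjective.
Variables (A : comNzRingType) (m : A -> Prop) (d : nat) (x : 'I_d -> A).
Hypotheses (nA : noeth A^o) (hm : localI m) (xreg : regular_system x).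
Hypothesis mE : m = powI x xpredT (fun=> 1%N).

Lemma mem_gen i : m (x i).
Proof. by rewrite mE -[x i]expr1; apply: (powI_mem x (fun=> 1%N)). Qed.

Lemma m_act (V : lmodType A) (S : V -> Prop) v c : submod S ->
  (forall i, S (x i *: v)) -> m c -> S (c *: v).
Proof.
move=> hS h; rewrite mE => -[e ->]; rewrite scaler_suml; apply: (submod_sum hS) => i _.
by rewrite expr1 -scalerA; apply: (submodZ hS).
Qed.

(** For each x_i in turn, multiply by a power that stays outside [S] while the next power does
    not. *)
Lemma socle_elt (V : lmodType A) (S : V -> Prop) (a : 'I_d -> nat) v : submod S ->
  (forall i, S (x i ^+ a i *: v)) -> ~ S v ->
  exists c, ~ S (c *: v) /\ forall i, S (x i *: (c *: v)).
Proof.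
move=> hS hv nv.
suff [c [nc hc]] : exists c, ~ S (c *: v) /\ forall i, i \in enum 'I_d -> S (x i *: (c *: v)).
  by exists c; split=> // i; apply: hc; rewrite mem_enum.
elim: (enum 'I_d) => [|i q [c [nc hc]]]; first by exists 1; rewrite scale1r.
have [k [nk hk]] : exists k, ~ S (x i ^+ k *: (c *: v)) /\ S (x i ^+ k.+1 *: (c *: v)).
  have : S (x i ^+ a i *: (c *: v)) by rewrite scalerA mulrC -scalerA; apply: submodZ.
  elim: (a i) => [|k ihk]; first by rewrite scale1r.
  by case: (pselect (S (x i ^+ k *: (c *: v)))) => [/ihk|h1 h2]; last by exists k.
exists (x i ^+ k * c); rewrite -scalerA; split=> // j; rewrite inE => /orP[/eqP->|jq].
  by rewrite scalerA -exprS.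
by rewrite scalerA mulrC -scalerA; apply: (submodZ hS); apply: hc.
Qed.

(** Noetherian induction: adjoin to [K] an element c outside it with m c inside; one more factor
    from m pays for c. *)
Lemma pow_sub (K : A -> Prop) (a : 'I_d -> nat) : ideal K -> (forall i, K (x i ^+ a i)) ->
  forall (mb : {pred A}), m = (fun a => a \in mb : Prop) ->
  exists N, forall u, ideal_pow mb N u -> K u.
Proof.
move=> hK Ka mb emb; move: K hK Ka.
apply: (@noeth_ind _ A^o (fun K => (forall i, K (x i ^+ a i)) ->
  exists N, forall u, ideal_pow mb N u -> K u) nA) => K hK IH Ka.
case: (pselect (K 1)) => [K1|nK1]; first by exists 0%N => u _; apply: ideal1.
have [|c [nc hc]] := @socle_elt A^o K a 1 hK _ nK1.
  by move=> i; rewrite /GRing.scale /= mulr1.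
have cx i : K (x i * c) by have := hc i; rewrite /GRing.scale /= mulr1.
have {}nc : ~ K c by move: nc; rewrite /GRing.scale /= mulr1.
have [|||N hN] := IH (addI K c) (addI_ideal c hK).
- exact: addI_sub.
- by exists c => //; apply: addI_mem.
- by move=> i; apply: addI_sub.
exists N.+1 => u [k [y [z [h ->]]]]; apply: ideal_sum => // i _.
have [ym /hN[k' [e [Kk ->]]]] := h i (ltn_ord i).
rewrite mulrDr; apply: idealD => //; first exact: idealMl.
rewrite mulrCA; apply: idealMl => //; apply: (@m_act A^o K c (y i)) => //.
by rewrite emb.
Qed.

Variable (a : 'I_d -> nat).
Hypothesis a0 : forall i, (0 < a i)%N.
Local Notation J := (powI x xpredT a).

Lemma topprod_notin : ~ J (topprod x a (enum 'I_d)).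
Proof.
rewrite -[topprod _ _ _]mulr1 => /(topprod_colon xreg a0 (enum_uniq _)).
have [_ m1 _] := hm; move=> J1; apply: m1; rewrite mE.
by move: J1; apply: powI_sub => i _; rewrite /updl mem_enum.
Qed.

Lemma self_injective k (B : 'rV[A]_k -> Prop) (g : 'rV[A]_k) : submod B ->
  (forall i v, B (x i ^+ a i *: v)) -> ~ B g ->
  exists l : 'cV[A]_k, (forall v, B v -> J ((v *m l) 0 0)) /\ ~ J ((g *m l) 0 0).
Proof.
move=> hB BJ ng.
have hJ : ideal J by exact: powI_ideal.
have [c [nc hc]] := socle_elt (a := a) hB (fun i => BJ i g) ng.
pose g' := c *: g; pose s := topprod x a (enum 'I_d).
suff [l [l1 l2]] : exists l : 'cV[A]_k, (forall v, B v -> J ((v *m l) 0 0)) /\ ~ J ((g' *m l) 0 0).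
  exists l; split=> // h; apply: l2; rewrite /g' -scalemxAl mxE; exact: idealMl.
pose W := ('rV[A]_k * A^o)%type.
pose good (G : W -> Prop) := [/\ forall b r, B b -> J r -> G (b, r),
  forall r, G (0, r) -> J r & G (g', s)].
suff key : forall G : W -> Prop, submod G -> good G -> exists l : 'cV[A]_k, (forall v, B v -> J ((v *m l) 0 0)) /\ ~ J ((g' *m l) 0 0).
  (* The initial map, on B + A g'. It is well defined because e g' in [B] forces e into m, which
     kills [s] modulo [J]. *)
  apply: (key (fun z => exists b r e, [/\ B b, J r & z = (b + e *: g', r + e * s)])).
    split; first by exists 0, 0, 0; rewrite scale0r mul0r !addr0; split=> //; [apply: hB.1 | apply: ideal0].
    move=> e _ _ [b [r [f [Bb Jr ->]]]] [b' [r' [f' [Bb' Jr' ->]]]].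
    exists (e *: b + b'), (e * r + r'), (e * f + f'); split; first exact: hB.2.
      by apply: idealD => //; apply: idealMl.
    congr pair; last by change (e * (r + f * s) + (r' + f' * s) = e * r + r' + (e * f + f') * s); ring.
    by rewrite /= scalerDr scalerDl scalerA addrACA.
  split=> [b r Bb Jr|r [b [r' [e [Bb Jr' [e1 ->]]]]]|].
  - by exists b, r, 0; rewrite scale0r mul0r !addr0.
  - apply: idealD => //; case: (pselect (m e)) => [me|ne].
      apply: (@m_act A^o J) => // i; rewrite /GRing.scale /= mulrC.
      by apply: topprod_mem => //; rewrite mem_enum.
    case: nc; apply: (localI_sat hm hB ne); rewrite -/g'.
    by rewrite (_ : e *: g' = - b); [apply: submodN | apply/eqP; rewrite -addr_eq0 addrC -e1].
  - exists 0, 0, 1; rewrite scale1r mul1r !add0r; split=> //; [exact: hB.1|exact: ideal0].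
have nW : noeth W by apply: noeth_prod => //; apply: noeth_row.
apply: (noeth_ind nW) => G hG IH [GB G0 Gg].
have GD u r v t : G (u, r) -> G (v, t) -> G (u + v, r + t) by move=> h1 h2; have := submodD hG h1 h2.
have GB' u r v t : G (u, r) -> G (v, t) -> G (u - v, r - t) by move=> h1 h2; have := submodB hG h1 h2.
have GZ e u r : G (u, r) -> G (e *: u, e * r) by move=> h1; have := submodZ hG e h1.
have Gsum (I : finType) (u : I -> 'rV[A]_k) (r : I -> A) :
   (forall i, G (u i, r i)) -> G (\sum_i u i, \sum_i r i).
  move=> h; apply: (big_rec2 (fun u r => G (u, r))); first exact: hG.1.
  by move=> i y1 y2 _ h1; apply: GD.
case: (pselect (forall v, exists r, G (v, r))) => [tot|ntot].
  have [l hl] := choice (fun i : 'I_k => tot (delta_mx 0 i)).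
  pose L : 'cV[A]_k := \col_i l i.
  have GL v : G (v, (v *m L) 0 0).
    rewrite {1}[v]row_sum_delta mxE; apply: Gsum => i.
    by rewrite mxE; apply: GZ.
  exists L; split=> [v Bv|Jg].
    apply: G0; have := GB' _ _ _ _ (GL v) (GB v 0 Bv (ideal0 hJ)).
    by rewrite subrr subr0.
  apply: topprod_notin; rewrite -/s.
  have := GB' _ _ _ _ Gg (GL g'); rewrite subrr => /G0 h.
  by rewrite -[s](subrK ((g' *m L) 0 0)); apply: idealD.
have [v0 nv0] : exists v, ~ exists r, G (v, r) by apply/existsNP.
pose prG v := exists r, G (v, r).
have hpr : submod prG.
  split; first by exists 0; apply: hG.1.
  by move=> e u v [r ur] [t vt]; exists (e * r + t); apply: GD => //; apply: GZ.
have [|e [ne he]] := socle_elt (a := a) (v := v0) hpr _ nv0.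
  by move=> i; exists 0; apply: GB; [apply: BJ | apply: ideal0].
set v := e *: v0 in ne he.
have [u hu] := choice he.
(* The domain contains all x_i v but not v; the values [u i] at x_i v are x_i w modulo [J] for one
   w, which becomes the value at v. *)
have [||w hw] := koszul_lift xreg (u := u) a0.
- move=> i j; apply: G0.
  have := GB' _ _ _ _ (GZ (x i) _ _ (hu j)) (GZ (x j) _ _ (hu i)).
  by rewrite !scalerA [x j * x i]mulrC subrr.
- move=> i; apply: G0.
  have := GB' _ _ _ _ (GZ (x i ^+ (a i).-1) _ _ (hu i)) (GB _ 0 (BJ i v) (ideal0 hJ)).
  by rewrite scalerA -exprSr prednK // subrr subr0.
apply: (IH (fun z => exists y f, G y /\ z = y + f *: (v, w : A^o))).
- split; first by exists 0, 0; rewrite scale0r addr0; split=> //; apply: hG.1.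
  move=> f _ _ [y [h [Gy ->]]] [y' [h' [Gy' ->]]].
  exists (f *: y + y'), (f * h + h'); split; first exact: hG.2.
  by rewrite scalerDr scalerDl scalerA addrACA.
- by move=> y Gy; exists y, 0; rewrite scale0r addr0.
- exists (v, w); last by move=> h; apply: ne; exists w.
  by exists 0, 1; rewrite scale1r add0r; split=> //; apply: hG.1.
have sub y : G y -> exists z f, G z /\ y = z + f *: (v, w : A^o).
  by move=> Gy; exists y, 0; rewrite scale0r addr0.
split=> [b r Bb Jr|r [[y1 y2] [f [Gy [e1 ->]]]]|]; try by apply: sub; auto.
have mf : m f.
  apply: contrapT => nf; apply: ne; apply: (localI_sat hm hpr nf).
  exists (- y2); rewrite (_ : f *: v = - y1); last by apply/eqP; rewrite -addr_eq0 addrC -e1.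
  by have := submodN hG Gy.
move: mf; rewrite mE => -[f' ef].
have Gf : G (f *: v, \sum_i f' i * u i).
  rewrite ef scaler_suml; apply: Gsum => i; rewrite expr1 -scalerA; exact: GZ.
have := GD _ _ _ _ Gy Gf; rewrite -e1 => /G0 h.
rewrite (_ : _ + _ = (y2 + \sum_i f' i * u i) - \sum_i f' i * (u i - x i * w)).
  apply: idealB => //; apply: ideal_sum => // i _; exact: idealMl.
under [X in _ - X]eq_bigr => i _ do rewrite mulrBr mulrA.
rewrite sumrB -mulr_suml opprB addrA addrAC addrK.
by rewrite /GRing.scale /= ef; under [in LHS]eq_bigr => i _ do rewrite expr1.
Qed.

End SelfInjective.

(** * Finite resolutions *)

Ltac mxabel :=
  repeat (let y := fresh in set y := (_ *m _); clearbody y);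
  repeat (let y := fresh in set y := (_%:M); clearbody y);
  let i := fresh in let j := fresh in
  apply/matrixP => i j; rewrite !mxE;
  repeat match goal with |- context [fun_of_matrix ?M i j] =>
    let e := fresh "e" in move: (fun_of_matrix M i j) => e end; ring.

Section ModMatrices.
Variables (A : comNzRingType).
Implicit Types (I : A -> Prop).

Definition modI I p q (M : 'M[A]_(p, q)) : Prop := forall i j, I (M i j).

Section Closure.
Variables (I : A -> Prop) (hI : ideal I).
Lemma modI0 p q : modI I (0 : 'M_(p, q)).
Proof. by move=> i j; rewrite mxE; apply: ideal0. Qed.
Lemma modID p q (M N : 'M_(p, q)) : modI I M -> modI I N -> modI I (M + N).
Proof. by move=> hM hN i j; rewrite mxE; apply: idealD. Qed.
Lemma modIN p q (M : 'M_(p, q)) : modI I M -> modI I (- M).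
Proof. by move=> hM i j; rewrite mxE; apply: idealN. Qed.
Lemma modIB p q (M N : 'M_(p, q)) : modI I M -> modI I N -> modI I (M - N).
Proof. by move=> hM hN; apply: modID => //; apply: modIN. Qed.
Lemma modIZ p q c (M : 'M_(p, q)) : modI I M -> modI I (c *: M).
Proof. by move=> hM i j; rewrite mxE; apply: idealMl. Qed.
Lemma modIcZ p q c (M : 'M_(p, q)) : I c -> modI I (c *: M).
Proof. by move=> hc i j; rewrite mxE; apply: idealMr. Qed.
Lemma modI_mull p q r (M : 'M_(p, q)) (N : 'M_(q, r)) : modI I N -> modI I (M *m N).
Proof. by move=> hN i j; rewrite mxE; apply: ideal_sum => // k _; apply: idealMl. Qed.
Lemma modI_mulr p q r (M : 'M_(p, q)) (N : 'M_(q, r)) : modI I M -> modI I (M *m N).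
Proof. by move=> hM i j; rewrite mxE; apply: ideal_sum => // k _; apply: idealMr. Qed.
Lemma modI_sum (T : Type) (r : seq T) (P : pred T) p q (F : T -> 'M_(p, q)) :
  (forall i, P i -> modI I (F i)) -> modI I (\sum_(i <- r | P i) F i).
Proof. by move=> h; apply: big_ind => //; [exact: modI0 | exact: modID]. Qed.
Lemma modI_submod p q : submod (modI I (p := p) (q := q)).
Proof. by split=> [|a u v hu hv]; [apply: modI0 | apply: modID => //; apply: modIZ]. Qed.
End Closure.

Lemma modI_sub I J p q (M : 'M_(p, q)) : subs I J -> modI I M -> modI J M.
Proof. by move=> IJ hM i j; apply/IJ/hM. Qed.

Lemma modI_addI I x p q (M : 'M[A]_(p, q)) : modI (addI I x) M ->
  exists N W, modI I N /\ M = N + x *: W.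
Proof.
move=> hM; have [f hf] := choice (fun ij : 'I_p * 'I_q => hM ij.1 ij.2).
have [g hg] := choice hf.
exists (\matrix_(i, j) f (i, j)), (\matrix_(i, j) g (i, j)); split.
  by move=> i j; rewrite mxE; have [] := hg (i, j).
by apply/matrixP => i j; rewrite !mxE; have [_ /= ->] := hg (i, j); rewrite [x * _]mulrC.
Qed.

(** Exactness of A^r -> A^p -> A^q modulo [I], with matrices acting on row vectors. *)
Definition kerI I r p q (E : 'M[A]_(r, p)) (D : 'M[A]_(p, q)) : Prop :=
  modI I (E *m D) /\
  forall v : 'rV_p, modI I (v *m D) -> exists w : 'rV_r, modI I (v - w *m E).

(* A free resolution of length n of coker D over A/I, beyond D. *)
Fixpoint resI I (n p q : nat) (D : 'M[A]_(p, q)) : Prop :=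
  if n is n'.+1 then exists r (E : 'M_(r, p)), kerI I E D /\ resI I n' E
  else forall v : 'rV_p, modI I (v *m D) -> modI I v.

Lemma resI_congr I n p q (D D' : 'M[A]_(p, q)) : ideal I -> modI I (D - D') ->
  resI I n D -> resI I n D'.
Proof.
move=> hI dd.
have tr k (v : 'M_(k, p)) : modI I (v *m D) <-> modI I (v *m D').
  have h : modI I (v *m D - v *m D') by rewrite -mulmxBr; apply: modI_mull.
  split=> hv; first by rewrite -[v *m D'](subKr (v *m D)); apply: modIB.
  by rewrite -[v *m D](subrK (v *m D')); apply: modID.
case: n => [h v /tr/h//|n] /= [r [E [[ED h] res]]].
by exists r, E; split=> //; split=> [|v /tr/h//]; apply/tr.
Qed.

Lemma spanned_mx p (S : 'rV[A]_p -> Prop) : spanned S ->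
  exists r (E : 'M_(r, p)), (forall i, S (row i E)) /\
    forall v, S v -> exists w : 'rV_r, v = w *m E.
Proof.
move=> [n [g [gS gen]]]; exists n, (\matrix_(i < n) g i); split=> [i|v /gen[c ->]].
  by rewrite rowK; apply: gS.
exists (\row_(i < n) c i); rewrite mulmx_sum_row; apply: eq_bigr => i _.
by rewrite mxE rowK.
Qed.

Lemma modI_rowP I p q (M : 'M[A]_(p, q)) : modI I M <-> forall i, modI I (row i M).
Proof.
split=> h i j; first by move=> k; rewrite mxE.
by have := h i 0 j; rewrite mxE.
Qed.

Lemma ker_submod I p q (D : 'M[A]_(p, q)) : ideal I -> submod (fun v : 'rV_p => modI I (v *m D)).
Proof.
move=> hI; split=> [|a u v hu hv]; first by rewrite mul0mx; apply: modI0.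
by rewrite mulmxDl -scalemxAl; apply: modID => //; apply: modIZ.
Qed.

Lemma kerI_ex I p q (D : 'M[A]_(p, q)) : noeth A^o -> ideal I ->
  exists r (E : 'M_(r, p)), kerI I E D.
Proof.
move=> nA hI; have [r [E [h1 h2]]] := spanned_mx (noeth_row nA (ker_submod D hI)).
exists r, E; split; first by apply/modI_rowP => i; rewrite row_mul.
by move=> v /h2[w ->]; exists w; rewrite subrr; apply: modI0.
Qed.

Section Local.
Variables (m : A -> Prop) (nA : noeth A^o) (hm : localI m).

(* x is regular on coker E modulo I. *)
Definition coker_reg I x p q (E : 'M[A]_(p, q)) : Prop :=
  forall (v : 'rV_p) (u : 'rV_q), modI I (v *m E - x *: u) -> exists w, modI I (u - w *m E).

(** Correct each differential by a multiple of x so that the composites vanish modulo [I]; Nakayama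
    then gives exactness. The next cokernel embeds in a free module, so x is regular on it too and
    the induction continues. *)
Lemma resI_lift I x n p q (E : 'M[A]_(p, q)) : ideal I -> m x ->
  (forall a, I (x * a) -> I a) -> coker_reg I x E ->
  resI (addI I x) n E -> resI I n E.
Proof.
move=> hI mx xr; have xrM k l (M : 'M_(k, l)) : modI I (x *: M) -> modI I M.
  by move=> h i j; apply: xr; have := h i j; rewrite mxE.
have hI' := addI_ideal x hI.
have addI_mod k l (M : 'M_(k, l)) : modI I M -> modI (addI I x) M.
  by apply: modI_sub; apply: addI_sub.
elim: n p q E => [|n ihn] p q E cE /=.
  move=> h; have kE := ker_submod E hI.
  apply: (@nakayama A 'rV_p m x _ (modI I (p := 1) (q := p)) (localI_prime hm) mx kE
    (noeth_row nA kE) (modI_submod hI _ _) (localI_sat hm (modI_submod hI _ _))).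
  move=> v vE; have [t [c [It ev]]] := modI_addI (h v (addI_mod _ _ _ vE)).
  exists 1, t, c; split=> //; [by case: hm | | by rewrite scale1r].
  apply: xrM; rewrite scalemxAl (_ : x *: c = v - t); last by rewrite ev addrC addKr.
  by rewrite mulmxBl; apply: modIB => //; apply: modI_mulr.
move=> [r [G [[GE kG] res]]].
(* Modulo [I] each row of [G *m E] is x u, and regularity of x on the cokernel of [E] writes u as w
   E. *)
have [W hW] : exists W : 'M_(r, p), modI I ((G - x *: W) *m E).
  have ex i : exists w, modI I ((row i G - x *: w) *m E).
    have [|t [u [It eu]]] := @modI_addI I x 1 q (row i G *m E).
      by rewrite -row_mul; move: i; apply/modI_rowP.
    have [|w hw] := cE (row i G) u; first by rewrite eu addrK.
    exists w; rewrite mulmxBl eu -scalemxAl -addrA -scalerBr.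
    by apply: modID => //; apply: modIZ.
  have [w hw] := choice ex; exists (\matrix_i w i); apply/modI_rowP => i.
  by rewrite row_mul linearB /= linearZ /= rowK.
set G' := G - x *: W in hW.
have res' : resI (addI I x) n G'.
  apply: (resI_congr hI' _ res); rewrite /G' opprB addrC subrK.
  by apply: modIcZ => //; apply: addI_mem.
have kG' : kerI I G' E.
  split=> //.
  have hT : submod (fun v : 'rV_p => exists w : 'rV_r, modI I (v - w *m G')).
    split; first by exists 0; rewrite mul0mx subr0; apply: modI0.
    move=> a u v [w uw] [w' vw]; exists (a *: w + w').
    rewrite mulmxDl -scalemxAl opprD addrACA -scalerBr.
    by apply: modID => //; apply: modIZ.
  have kE := ker_submod E hI.
  apply: (@nakayama A 'rV_p m x _ _ (localI_prime hm) mx kE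
    (noeth_row nA kE) hT (localI_sat hm hT)).
  move=> v vE; have [w /modI_addI[t [c [It ev]]]] := kG v (addI_mod _ _ _ vE).
  exists 1, (w *m G' + t), (c + w *m W); split.
  - by case: hm.
  - by exists w; rewrite addrC addKr.
  - apply: xrM; rewrite scalemxAl (_ : x *: _ = v - w *m G' - t).
      rewrite 2!mulmxBl -mulmxA; apply: modIB => //; last exact: modI_mulr.
      by apply: modIB => //; apply: modI_mull.
    by rewrite -[v](subrK (w *m G)) ev /G' mulmxBr -scalemxAr; mxabel.
  - by rewrite -[v](subrK (w *m G)) ev /G' mulmxBr -scalemxAr; mxabel.
exists r, G'; split=> //; apply: ihn => // v u h.
apply: kG'.2; apply: xrM; rewrite scalemxAl.
rewrite (_ : x *: u = v *m G' - (v *m G' - x *: u)); last by rewrite subKr.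
by rewrite mulmxBl -mulmxA; apply: modIB => //; [apply: modI_mull | apply: modI_mulr].
Qed.

Lemma resI_field p q (D : 'M[A]_(p, q)) : resI m 1 D.
Proof.
have [hI m1 mu] := hm.
have [r [E kE]] := kerI_ex D nA hI; move: E kE.
elim: r => [|r ihr] E kE; first by exists 0%N, E; split=> // v _ i; case.
case: (pselect (resI m 0 E)) => [res|nres]; first by exists r.+1, E.
have [v [vE nv]] : exists v : 'rV_r.+1, modI m (v *m E) /\ ~ modI m v.
  apply: contrapT => no; apply: nres => v vE; apply: contrapT => nv; apply: no.
  by exists v.
have [i ni] : exists i, ~ m (v 0 i).
  apply: contrapT => no; apply: nv => i j; rewrite ord1; apply: contrapT => nm.
  by apply: no; exists j.
have [b eb] := mu _ ni.
apply: (ihr (row' i E)); split.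
  apply/modI_rowP => j; have /modI_rowP/(_ (lift i j)) := kE.1.
  by rewrite !row_mul row_rowsub.
move=> w wD; have [u hu] := kE.2 _ wD.
pose u' := u - (u 0 i * b) *: v.
have u'i : u' 0 i = 0 by rewrite !mxE -mulrA [b * _]mulrC eb mulr1 subrr.
exists (col' i u'); rewrite (_ : col' i u' *m row' i E = u' *m E).
  rewrite /u' mulmxBl -scalemxAl opprB addrCA.
  by apply: modID => //; apply: modIZ.
apply/matrixP => j k; rewrite !mxE [RHS](bigD1_ord i) //= ord1 u'i mul0r add0r.
by apply: eq_bigr => l _; rewrite !mxE.
Qed.

Variables (d : nat) (x : 'I_d -> A).
Hypothesis (xreg : regular_system x) (mE : m = powI x xpredT (fun=> 1%N)).

(** Start from the residue field and drop the x_j one at a time. Each stage resolves a syzygy [E] of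
    [D], whose cokernel embeds in a free module, so that x_j is regular on it; this costs one step
    of length, uniformly in [D]. *)
Lemma finite_resolution : exists n, forall p q (D : 'M[A]_(p, q)), resI (fun a => a = 0) n D.
Proof.
pose I k := powI x (fun i : 'I_d => (i < k)%N) (fun=> 1%N).
have I0 : I 0%N = (fun a => a = 0).
  apply: funext => a; apply: propext; split=> [[c ->]|->]; first by rewrite big_pred0.
  exact: (ideal0 (powI_ideal _ _ _)).
suff key k : (k <= d)%N -> exists n, forall p q (D : 'M[A]_(p, q)), resI (I (d - k)%N) n D.
  by have := key d (leqnn _); rewrite subnn I0.
have hI l : ideal (I l) by exact: powI_ideal.
elim: k => [_|k ihk kd].
  rewrite subn0 (_ : I d = m); first by exists 1%N; exact: resI_field.
  rewrite mE /I; apply: funext => a; apply: propext.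
  by split; apply: powI_sub => i _; split.
have [n hn] := ihk (ltnW kd); exists n.+1 => p q D.
have lt : (d - k.+1 < d)%N by lia.
pose j := Ordinal lt.
have Ij : I (d - k)%N = addI (I (d - k.+1)%N) (x j).
  apply: funext => a; apply: propext; split; move: a.
    apply: powI_min; first exact/addI_ideal/hI.
    move=> i ilt; rewrite expr1; case: (eqVneq i j) => [->|ij]; first exact/addI_mem/hI.
    apply: addI_sub; rewrite -[x i]expr1; apply: (powI_mem x (fun=> 1%N)).
    by have : (i != j :> nat) by []; rewrite /=; lia.
  apply: addI_min => //.
    by apply: powI_sub => i ilt; split=> //; lia.
  by rewrite -[x j]expr1; apply: (powI_mem x (fun=> 1%N)) => /=; lia.
have jreg a : I (d - k.+1)%N (x j * a) -> I (d - k.+1)%N a.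
  by apply: xreg; rewrite ltnn.
have [r [E kE]] := kerI_ex D nA (hI (d - k.+1)%N).
exists r, E; split=> //; apply: (@resI_lift _ (x j)) => //.
- by rewrite mE -[x j]expr1; apply: (powI_mem x (fun=> 1%N)).
- move=> v u h; apply: kE.2.
  have : modI (I (d - k.+1)%N) (x j *: (u *m D)).
    rewrite scalemxAl (_ : x j *: u = v *m E - (v *m E - x j *: u)); last by rewrite subKr.
    by rewrite mulmxBl -mulmxA; apply: modIB => //; [apply: modI_mull => //; exact: kE.1 | apply: modI_mulr].
  by move=> h' i l; apply: jreg; have := h' i l; rewrite mxE.
- by rewrite -Ij; apply: hn.
Qed.

End Local.

(** * Contractions of almost exact periodic complexes *)

Section Periodic.
Variable (z : A).

Definition almost_exact k0 k1 (a : 'M[A]_(k0, k1)) (b : 'M[A]_(k1, k0)) : Prop :=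
  forall v : 'rV_k1, v *m b = 0 -> exists w, z *: v = w *m a.

Lemma almost_exact_mx k0 k1 (a : 'M[A]_(k0, k1)) (b : 'M[A]_(k1, k0)) k (M : 'M_(k, k1)) :
  almost_exact a b -> M *m b = 0 -> exists W, z *: M = W *m a.
Proof.
move=> h Mb; have ex i : exists w, z *: row i M = w *m a.
  by apply: h; rewrite -row_mul Mb linear0.
have [w hw] := choice ex; exists (\matrix_i w i); apply/row_matrixP => i.
by rewrite linearZ /= hw row_mul rowK.
Qed.

Lemma kerI0_mx r p q (E : 'M[A]_(r, p)) (D : 'M[A]_(p, q)) k (M : 'M_(k, p)) :
  kerI (fun a => a = 0) E D -> M *m D = 0 -> exists W, M = W *m E.
Proof.
move=> [_ h] MD; have ex i : exists w, row i M = w *m E.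
  have [|w hw] := h (row i M); first by rewrite -row_mul MD linear0 => j l; rewrite mxE.
  exists w; apply/eqP; rewrite -subr_eq0; apply/eqP/matrixP => j l.
  by rewrite hw mxE.
have [w hw] := choice ex; exists (\matrix_i w i); apply/row_matrixP => i.
by rewrite hw row_mul rowK.
Qed.

(* Compare the almost exact periodic complex with the finite resolution of a
   cokernel; each lifting step costs a factor z.  Once the resolution stops,
   the homotopy between the two splits a differential up to a power of z. *)
Lemma resolution_splits n k0 k1 p q (a : 'M[A]_(k0, k1)) (b : 'M[A]_(k1, k0))
    (D : 'M[A]_(p, q)) (f : 'M_(k0, p)) (f' : 'M_(k1, q)) (g : 'M_(p, k0))
    (g' : 'M_(q, k1)) (s : 'M_(k0, k1)) (t : 'M_(k1, k0)) (y : A) (e : nat) :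
  a *m b = 0 -> b *m a = 0 -> almost_exact a b -> almost_exact b a ->
  resI (fun a => a = 0) n D ->
  a *m f' = f *m D -> g *m a = y *: (D *m g') ->
  f *m g = (z ^+ e)%:M + s *m b + a *m t ->
  (exists e (s : 'M_(k1, k0)), a *m s *m a = z ^+ e *: a) \/
  (exists e (s : 'M_(k0, k1)), b *m s *m b = z ^+ e *: b).
Proof.
elim: n k0 k1 p q a b D f f' g g' s t y e => [|n ihn] k0 k1 p q a b D f f' g g' s t y e
  ab ba exa exb res fD gD fg; have bfD : b *m f *m D = 0 by rewrite -mulmxA -fD mulmxA ba mul0mx.
  (* The resolution has stopped: [D] is injective, so b f = 0, and multiplying the homotopy formula
     by b splits b. *)
  right; exists e, (- s); rewrite mulmxN mulNmx.
  have bf : b *m f = 0.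
    apply/row_matrixP => i; rewrite linear0; apply/matrixP => j l; rewrite [RHS]mxE.
    by apply: res => {}j {}l; rewrite -row_mul bfD linear0 mxE.
  have : b *m (f *m g) = 0 by rewrite mulmxA bf mul0mx.
  rewrite fg !mulmxDr !mulmxA ba mul0mx addr0 mul_mx_scalar => /eqP.
  by rewrite addrC addr_eq0 => /eqP ->; rewrite opprK.
move: res => [r [E [kE res]]].
(* One step further along both complexes, with [a] and [b] exchanged: [f1] exists by exactness of
   the resolution, [g1] by almost exactness at the cost of a factor z. *)
have [f1 ef1] := kerI0_mx kE bfD.
have ED : E *m D = 0 by apply/matrixP => i j; rewrite kE.1 mxE.
have Ega : (E *m g) *m a = 0 by rewrite -mulmxA gD -scalemxAr mulmxA ED mul0mx scaler0.
have [g1 eg1] := almost_exact_mx exb Ega.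
have h : f1 *m g1 *m b = z ^+ e.+1 *: b + z *: (b *m s *m b).
  have -> : f1 *m g1 *m b = z *: (b *m (f *m g)).
    by rewrite -mulmxA -eg1 -scalemxAr [in LHS]mulmxA -ef1 mulmxA.
  rewrite fg !mulmxDr mul_mx_scalar !mulmxA ba mul0mx addr0.
  by rewrite scalerDr scalerA exprS.
have : (f1 *m g1 - (z ^+ e.+1)%:M - z *: (b *m s)) *m b = 0.
  by rewrite 2!mulmxBl h mul_scalar_mx -scalemxAl; mxabel.
move=> /(almost_exact_mx exa)[r1 er1].
have e1 : (z *: g1) *m b = z ^+ 2 *: (E *m g) by rewrite -scalemxAl -eg1 scalerA.
have e2 : f1 *m (z *: g1) = (z ^+ e.+2)%:M + r1 *m a + b *m (z ^+ 2 *: s).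
  rewrite -er1 -!scalemxAr !scalerBr scalerA -expr2.
  by rewrite [z ^+ e.+2](exprS z e.+1) -scale_scalar_mx; mxabel.
by case: (ihn _ _ _ _ _ _ _ _ _ _ _ _ _ _ _ ba ab exb exa res ef1 e1 e2); [right | left].
Qed.

(** With y = z^(e+1) the first identity is immediate. The defect f = y - N of the second satisfies a
    f = 0 and z f = w a, so z f^2 = 0. Since N (2 y - N) = y^2 - f^2, the factor z (2 y - N) repairs
    it, whence the exponent 2(e+1) + 1. *)
Lemma split_homotopy k0 k1 (a : 'M[A]_(k0, k1)) (b : 'M[A]_(k1, k0)) (s1 : 'M_(k1, k0)) e :
  a *m b = 0 -> b *m a = 0 -> almost_exact a b -> almost_exact b a ->
  a *m s1 *m a = z ^+ e *: a ->
  exists E (h0 : 'M_(k0, k1)) (h1 : 'M_(k1, k0)),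
    (z ^+ E)%:M = a *m h1 + h0 *m b /\ (z ^+ E)%:M = b *m h0 + h1 *m a.
Proof.
move=> ab ba exa exb asa; pose y := z ^+ e.+1.
have [|s0 es0] := almost_exact_mx (M := (z ^+ e)%:M - a *m s1) exb.
  by rewrite mulmxBl asa mul_scalar_mx subrr.
have [t1 e0] : exists t1, a *m t1 + s0 *m b = y%:M.
  by exists (z *: s1); rewrite -es0 -scalemxAr /y exprS -scale_scalar_mx; mxabel.
pose N := b *m s0 + t1 *m a; pose f := y%:M - N.
have aN : a *m N = y *: a.
  rewrite /N mulmxDr !mulmxA ab mul0mx add0r -[a *m t1](addrK (s0 *m b)) e0.
  by rewrite mulmxBl -mulmxA ba mulmx0 subr0 mul_scalar_mx.
have Nb : N *m b = y *: b.
  rewrite /N mulmxDl -!mulmxA ab mulmx0 addr0 -[s0 *m b](addKr (a *m t1)) e0.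
  by rewrite mulmxDr mulmxN mulmxA ba mul0mx oppr0 add0r mul_mx_scalar.
have fb : f *m b = 0 by rewrite /f mulmxBl Nb mul_scalar_mx subrr.
have af : a *m f = 0 by rewrite /f mulmxBr aN mul_mx_scalar subrr.
have [w ew] := almost_exact_mx exa fb.
have ff : z *: (f *m f) = 0 by rewrite scalemxAl ew -mulmxA af mulmx0.
pose g := (y *+ 2)%:M - N.
exists (e.+1 + e.+1).+1, (z *: (s0 *m g)), ((z * y) *: t1).
rewrite exprS exprD -/y; split.
  have gb : g *m b = y *: b.
    by rewrite /g mulmxBl Nb mul_scalar_mx mulr2n scalerDl addrK.
  rewrite -scalemxAr -scalemxAl -mulmxA gb -scalemxAr scalerA -scalerDr e0.
  by rewrite scale_scalar_mx mulrA.
have ag : a *m g = y *: a.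
  by rewrite /g mulmxBr aN mul_mx_scalar mulr2n scalerDl addrK.
rewrite -scalemxAr mulmxA -scalemxAl -scalerA -scalerDr.
rewrite (_ : y *: (t1 *m a) = t1 *m a *m g); last by rewrite -mulmxA ag -scalemxAr.
rewrite -mulmxDl -/N -scale_scalar_mx.
apply/eqP; rewrite -subr_eq0 -scalerBr -ff; apply/eqP; congr (_ *: _).
rewrite /f /g !mulmxBr !mulmxBl -scalar_mxM !mul_mx_scalar !mul_scalar_mx mulr2n scalerDl.
by mxabel.
Qed.

End Periodic.
End ModMatrices.

(** * Serre duality *)

Section Graded.
Variable A : comNzRingType.

(* A 2-periodic complex as one square matrix: P projects onto the even part. *)
Record gcx : Type := GCx {
  gdim : nat;
  gP : 'M[A]_gdim;
  gD : 'M[A]_gdim;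
  gPP : gP *m gP = gP;
  gDD : gD *m gD = 0;
  gPD : gP *m gD + gD *m gP = gD
}.

Notation "''H' ( X , Y )" := 'M[A]_(gdim X, gdim Y) (at level 8, format "''H' ( X ,  Y )").

(** The grading involution: 1 on the even part and -1 on the odd part. *)
Definition eps X : 'H(X, X) := locked (gP X - (1%:M - gP X)).

Lemma epsE X : eps X = gP X - (1%:M - gP X). Proof. by rewrite /eps -lock. Qed.

Lemma eps2 X : eps X *m eps X = 1%:M.
Proof.
rewrite !epsE !mulmxBl !mulmxBr !mul1mx !mulmx1 gPP.
by mxabel.
Qed.

Lemma epsD X : eps X *m gD X = - (gD X *m eps X).
Proof.
have e : gP X *m gD X = gD X - gD X *m gP X by apply/eqP; rewrite eq_sym subr_eq gPD.
by rewrite !epsE !mulmxBl !mulmxBr mul1mx mulmx1 e; mxabel.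
Qed.

Definition sg X Y (u : 'H(X, Y)) : 'H(X, Y) := eps X *m u *m eps Y.
(** Differential of the Hom complex. Matrices act on row vectors, so products compose from left to
    right. *)
Definition df X Y (u : 'H(X, Y)) : 'H(X, Y) := locked (gD X *m u - sg u *m gD Y).
(** The supertrace. *)
Definition str X (u : 'H(X, X)) : A := \tr (eps X *m u).
Definition gQ X (b : bool) : 'H(X, X) := if b then 1%:M - gP X else gP X.
Definition par b X Y (u : 'H(X, Y)) : Prop := gP X *m u = u *m gQ Y b.
Definition comp b X Y (u : 'H(X, Y)) : 'H(X, Y) :=
  locked (gP X *m u *m gQ Y b + (1%:M - gP X) *m u *m gQ Y (~~ b)).
Definition bdry X Y (u : 'H(X, Y)) : Prop := exists w : 'H(X, Y), u = df w.

Lemma dfE X Y (u : 'H(X, Y)) : df u = gD X *m u - sg u *m gD Y.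
Proof. by rewrite /df -lock. Qed.

Lemma compE b X Y (u : 'H(X, Y)) :
  comp b u = gP X *m u *m gQ Y b + (1%:M - gP X) *m u *m gQ Y (~~ b).
Proof. by rewrite /comp -lock. Qed.

Section Basic.
Variables X Y Z : gcx.
Implicit Types (u v : 'H(X, Y)) (w : 'H(Y, Z)).

Lemma sg_linear : linear (@sg X Y).
Proof. by move=> a u v; rewrite /sg mulmxDr mulmxDl -scalemxAr -scalemxAl. Qed.
HB.instance Definition _ := GRing.isLinear.Build A _ _ _ (@sg X Y) sg_linear.

Lemma df_linear : linear (@df X Y).
Proof.
move=> a u v; rewrite !dfE [sg _]linearP /= mulmxDr mulmxDl -scalemxAr -scalemxAl.
by rewrite scalerBr; mxabel.
Qed.
HB.instance Definition _ := GRing.isLinear.Build A _ _ _ (@df X Y) df_linear.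

Lemma comp_linear b (a : A) u v : comp b (a *: u + v) = a *: comp b u + comp b v.
Proof.
by rewrite !compE !mulmxDr !mulmxDl -!scalemxAr -!scalemxAl; mxabel.
Qed.
HB.instance Definition _ b := GRing.isLinear.Build A _ _ _ (@comp b X Y) (fun a u v => @comp_linear b a u v).

Lemma sgK u : sg (sg u) = u.
Proof. by rewrite /sg !mulmxA eps2 mul1mx -mulmxA eps2 mulmx1. Qed.

Lemma sgM u w : sg (u *m w) = sg u *m sg w.
Proof. by rewrite /sg -!mulmxA [eps Y *m (eps Y *m _)]mulmxA eps2 mul1mx. Qed.

Lemma sg_mull u : sg (gD X *m u) = - (gD X *m sg u).
Proof. by rewrite /sg !mulmxA epsD !mulNmx. Qed.

Lemma sg_mulr u : sg (u *m gD Y) = - (sg u *m gD Y).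
Proof. by rewrite /sg -!mulmxA epsD !mulmxN opprK. Qed.

Lemma df_sg u : df (sg u) = - sg (df u).
Proof. by rewrite !dfE linearB /= sg_mull sg_mulr !sgK; mxabel. Qed.

Lemma dfM u w : df (u *m w) = df u *m w + sg u *m df w.
Proof. by rewrite !dfE sgM mulmxBl mulmxBr !mulmxA; mxabel. Qed.

Lemma dfK u : df (df u) = 0.
Proof.
rewrite dfE -[sg (df u)]opprK -df_sg !dfE sgK mulNmx opprK mulmxBr !mulmxA gDD mul0mx.
by rewrite mulmxBl -[u *m _ *m _]mulmxA gDD mulmx0; mxabel.
Qed.

Lemma gQP b : gQ Y b *m gQ Y b = gQ Y b.
Proof.
case: b; rewrite /= ?gPP // !mulmxBl !mulmxBr !mul1mx !mulmx1 gPP.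
by mxabel.
Qed.

Lemma gQPN b : gQ Y b *m gQ Y (~~ b) = 0.
Proof. by case: b; rewrite /= ?mulmxBl ?mulmxBr ?mul1mx ?mulmx1 gPP subrr. Qed.

Lemma gQD b : gQ Y b + gQ Y (~~ b) = 1%:M.
Proof. by case: b; rewrite /=; mxabel. Qed.

Lemma comp_par b u : par b (comp b u).
Proof.
have h : gQ Y (~~ b) *m gQ Y b = 0 by rewrite -{2}(negbK b) gQPN.
rewrite /par compE [LHS]mulmxDr [RHS]mulmxDl -[X in _ = X + _]mulmxA gQP.
rewrite -[X in _ = _ + X]mulmxA h mulmx0 addr0.
by rewrite !mulmxA gPP mulmxBr mulmx1 gPP subrr !mul0mx addr0.
Qed.

Lemma comp_id b u : par b u -> comp b u = u.
Proof.
move=> h; rewrite compE mulmxBl mul1mx mulmxBl h -!mulmxA gQP gQPN mulmx0 subr0.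
by rewrite -mulmxDr gQD mulmx1.
Qed.

Lemma comp_sum b u : comp b u + comp (~~ b) u = u.
Proof.
rewrite !compE negbK addrACA -!mulmxDr gQD [gQ _ _ + _]addrC gQD !mulmx1.
by rewrite mulmxBl mul1mx; mxabel.
Qed.

Lemma eps_par b u : par b u -> eps X *m u = (-1) ^+ b *: (u *m eps Y).
Proof.
move=> h; rewrite !epsE mulmxBl [(1%:M - _) *m u]mulmxBl mul1mx h.
by case: b {h} => /=; rewrite ?expr1 ?expr0 ?scaleN1r ?scale1r !mulmxBr !mulmx1; mxabel.
Qed.

Lemma par_sg b u : par b u -> sg u = (-1) ^+ b *: u.
Proof. by move=> /eps_par h; rewrite /sg h -scalemxAl -mulmxA eps2 mulmx1. Qed.

Lemma parZ b c u : par b u -> par b (c *: u).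
Proof. by rewrite /par -scalemxAr -scalemxAl => ->. Qed.

Lemma parB b u v : par b u -> par b v -> par b (u - v).
Proof. by rewrite /par mulmxBr mulmxBl => -> ->. Qed.

Lemma gD_gQ b : gQ Y b *m gD Y = gD Y *m gQ Y (~~ b).
Proof.
have e : gP Y *m gD Y = gD Y - gD Y *m gP Y by apply/eqP; rewrite eq_sym subr_eq gPD.
by case: b => /=; rewrite ?mulmxBl ?mulmxBr ?mul1mx ?mulmx1 e // subKr.
Qed.

Lemma parM b c u w : par b u -> par c w -> par (b (+) c) (u *m w).
Proof.
rewrite /par => hu hw; rewrite mulmxA hu -!mulmxA; congr (u *m _).
case: b {hu} => /=; last exact: hw.
rewrite mulmxBl mul1mx hw -[w in w - _]mulmx1 -mulmxBr; congr (w *m _).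
by case: c {hw} => //=; rewrite subKr.
Qed.

Lemma par_df b u : par b u -> par (~~ b) (df u).
Proof.
move=> h; rewrite dfE (par_sg h); apply: parB; last first.
  rewrite /par mulmxA -!scalemxAr h -scalemxAl -!mulmxA [gQ Y b *m _]gD_gQ.
  by rewrite -scalemxAl.
have e : gP X *m gD X = gD X - gD X *m gP X by apply/eqP; rewrite eq_sym subr_eq gPD.
rewrite /par mulmxA e mulmxBl -!mulmxA h -mulmxBr; congr (_ *m _).
by apply/eqP; rewrite subr_eq -mulmxDr addrC gQD mulmx1.
Qed.

Lemma comp_df b u : comp (~~ b) (df u) = df (comp b u).
Proof.
rewrite -{1}(comp_sum b u) linearD /= linearD /= [X in X + _]comp_id; last first.
  exact/par_df/comp_par.
have h := par_df (comp_par (~~ b) u); rewrite negbK in h.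
set v := df (comp (~~ b) u) in h *.
rewrite (_ : comp (~~ b) v = 0) ?addr0 //.
have := comp_sum b v; rewrite (comp_id h) => /eqP.
by rewrite -subr_eq0 addrC addKr => /eqP.
Qed.

End Basic.

Lemma str_linear X : scalar (@str X).
Proof. by move=> a u v; rewrite /str mulmxDr linearD /= -scalemxAr linearZ. Qed.
HB.instance Definition _ X := GRing.isLinear.Build A _ _ _ (@str X) (@str_linear X).

Lemma str_sg X (u : 'H(X, X)) : str (sg u) = str u.
Proof. by rewrite /str /sg !mulmxA eps2 mul1mx mxtrace_mulC. Qed.

Lemma str_df X (u : 'H(X, X)) : str (df u) = 0.
Proof.
rewrite /str dfE mulmxBr linearB /= /sg !mulmxA eps2 mul1mx.
by rewrite -[u *m _ *m _]mulmxA [X in _ - X]mxtrace_mulC subrr.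
Qed.

Lemma str_odd X (u : 'H(X, X)) : par true u -> str u = 0.
Proof.
move=> h; rewrite /str (eps_par h) expr1 scaleN1r.
rewrite epsE mulmxBr mulmxBr mulmx1 opprB linearB /= linearB /=.
have e : \tr (u *m gP X) = 0.
  by rewrite mxtrace_mulC -gPP -mulmxA h mulmxA mxtrace_mulC mulmxA mulmxBl mul1mx gPP subrr mul0mx linear0.
have e' : \tr u = 0.
  rewrite -[u](comp_id h) compE linearD /= mxtrace_mulC mulmxA mulmxBl mul1mx gPP subrr mul0mx linear0.
  by rewrite mxtrace_mulC mulmxA mulmxBr mulmx1 gPP subrr mul0mx linear0 addr0.
by rewrite e e' !subr0.
Qed.

Lemma str_sym X Y b (g : 'H(X, Y)) (s : 'H(Y, X)) : par b g ->
  str (g *m s) = (-1) ^+ b * str (s *m g).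
Proof.
move=> h; rewrite /str mulmxA (eps_par h) -scalemxAl linearZ /=; congr (_ * _).
by rewrite -mulmxA mxtrace_mulC mulmxA.
Qed.

Lemma bdry_submod X Y : submod (@bdry X Y).
Proof.
split; first by exists 0; rewrite linear0.
by move=> a u v [w ->] [w' ->]; exists (a *: w + w'); rewrite linearP.
Qed.

Lemma bdry_mulr X Y Z (u : 'H(X, Y)) (w : 'H(Y, Z)) : df w = 0 -> bdry u -> bdry (u *m w).
Proof. by move=> dw [v ->]; exists (v *m w); rewrite dfM dw mulmx0 addr0. Qed.

Lemma bdry_mull X Y Z (u : 'H(X, Y)) (w : 'H(Y, Z)) : df u = 0 -> bdry w -> bdry (u *m w).
Proof.
move=> du [v ->]; exists (sg u *m v); rewrite dfM sgK df_sg du.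
by rewrite linear0 oppr0 mul0mx add0r.
Qed.

(** Multiplication by c is null-homotopic. Of the oddness of [h] only the sign rule is recorded,
    which is what [nullh_left] uses. *)
Definition nullh X (c : A) : Prop := exists h : 'H(X, X),
  sg h = - h /\ gD X *m h + h *m gD X = c%:M.

Lemma nullh_left X Y c h (u : 'H(X, Y)) : sg h = - h ->
  gD X *m h + h *m gD X = c%:M -> df (h *m u) = c *: u - h *m df u.
Proof.
move=> sh e; rewrite dfM sh dfE sh mulNmx opprK e mul_scalar_mx.
by rewrite mulNmx.
Qed.

Lemma modI_df I X Y (u : 'H(X, Y)) : ideal I -> modI I u -> modI I (df u).
Proof.
move=> hI h; rewrite dfE; apply: modIB => //; first exact: modI_mull.
by apply: modI_mulr => //; apply: modI_mulr => //; apply: modI_mull.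
Qed.

Lemma modI_comp I b X Y (u : 'H(X, Y)) : ideal I -> modI I u -> modI I (comp b u).
Proof.
by move=> hI h; rewrite compE; apply: modID => //; apply: modI_mulr => //; apply: modI_mull.
Qed.

(** * Descent along the regular sequence and non-degeneracy *)

Section Duality.
Variables (m : A -> Prop) (d : nat) (x : 'I_d -> A) (a : 'I_d -> nat).
Hypotheses (nA : noeth A^o) (hm : localI m) (xreg : regular_system x).
Hypotheses (mE : m = powI x xpredT (fun=> 1%N)) (a0 : forall i, (0 < a i)%N).

Let y i := x i ^+ a i.
Let Ij (j : nat) := powI x (fun i : 'I_d => (i < j)%N) a.
Local Notation J := (powI x xpredT a).

Let hI P : ideal (powI x P a). Proof. exact: powI_ideal. Qed.
Let hIj j : ideal (Ij j). Proof. exact: powI_ideal. Qed.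
Hint Resolve hI hIj : core.

Lemma Ij_S (j : 'I_d) : Ij j.+1 = addI (Ij j) (y j).
Proof.
apply: funext => u; apply: propext; split; move: u.
  apply: powI_min; first exact: addI_ideal.
  move=> i; rewrite ltnS leq_eqVlt => /orP[/eqP/val_inj ->|ij].
    exact: addI_mem.
  by apply: addI_sub; apply: (powI_mem x a).
apply: addI_min => //; last by apply: (powI_mem x a) => /=; apply: ltnSn.
by apply: powI_sub => i ij; split=> //; apply: ltnW.
Qed.

Lemma Ij_d : Ij d = J.
Proof.
by apply: funext => u; apply: propext; split; apply: powI_sub => i _; split.
Qed.

Lemma Ij_0 p q (M : 'M_(p, q)) : modI (Ij 0) M -> M = 0.
Proof. by move=> h; apply/matrixP => i j; have [c ->] := h i j; rewrite big_pred0 // mxE. Qed.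

Lemma powI_regM P (j : 'I_d) p q (M : 'M_(p, q)) : ~~ P j ->
  modI (powI x P a) (y j *: M) -> modI (powI x P a) M.
Proof.
move=> Pj h i l; apply: (powI_regX (n := a j) xreg Pj).
by have := h i l; rewrite mxE.
Qed.

Lemma Ij_regM (j : 'I_d) p q (M : 'M_(p, q)) : modI (Ij j) (y j *: M) -> modI (Ij j) M.
Proof. by apply: powI_regM; rewrite ltnn. Qed.

(** Descent through the I_j. A difference g - df w in I_(j+1) is N + y_j c with N in I_j, and c is a
    cocycle modulo I_j because y_j is regular. Adding h c to w, with [h] a contraction of y_j,
    removes y_j c modulo I_j. *)
Lemma bdry_mod X Y (g : 'H(X, Y)) : (forall i, nullh X (y i)) -> df g = 0 ->
  (exists w, modI J (g - df w)) -> bdry g.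
Proof.
move=> hX dg; rewrite -Ij_d => gJ.
suff: exists w, modI (Ij 0) (g - df w).
  by case=> w /Ij_0/eqP; rewrite subr_eq0 => /eqP ->; exists w.
have : (d <= d)%N by [].
elim: {-3}d gJ => // j ih [w gw] jd; apply: (ih _ (ltnW jd)).
pose k := Ordinal jd; rewrite (Ij_S k) in gw.
have [N [c [hN e]]] := modI_addI gw.
have dc : modI (Ij j) (df c).
  apply: (@Ij_regM k); rewrite -linearZ /= (_ : y k *: c = (g - df w) - N); last by rewrite e addrC addKr.
  by rewrite !linearB /= dg dfK subrr sub0r; apply: modIN => //; apply: modI_df.
have [h [sh eh]] := hX k; exists (w + h *m c).
rewrite linearD /= (nullh_left _ sh eh) opprD addrA e.
rewrite (_ : _ - _ = N + h *m df c); last by mxabel.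
by apply: modID => //; apply: modI_mull.
Qed.

(* Iterated connecting homomorphism for the regular sequence: u is a cocycle
   modulo y_0, ..., y_(j-1), and u0 represents its image. *)
Fixpoint desc X Y (j : nat) (u u0 : 'H(X, Y)) : Prop :=
  if j is j'.+1 then exists u', (forall k : 'I_d, k = j' :> nat ->
      modI (Ij j') (df u - y k *: u')) /\ desc j' u' u0
  else u = u0.

(** Regularity makes the quotient of [df u] by y_j a cocycle modulo the smaller ideal; taking its
    component of the right parity keeps the parity of the final cocycle under control. *)
Lemma desc_ex X Y j b (u : 'H(X, Y)) : (j <= d)%N -> par b u -> modI (Ij j) (df u) ->
  exists u0, [/\ desc j u u0, df u0 = 0 & par (b (+) odd j) u0].
Proof.
elim: j b u => [|j ih] b u jd pu du.
  by exists u; split=> //; [apply: Ij_0 | rewrite addbF].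
pose k := Ordinal jd; rewrite (Ij_S k) in du.
have [N [c [hN e]]] := modI_addI du.
pose c' := comp (~~ b) c.
have ec : modI (Ij j) (df u - y k *: c').
  rewrite -[df u](comp_id (par_df pu)) e linearD linearZ /= addrK.
  exact: modI_comp.
have [|u0 [h1 h2 h3]] := ih (~~ b) c' (ltnW jd) (comp_par _ _).
  apply: (@Ij_regM k); rewrite -linearZ /= (_ : y k *: c' = df u - (df u - y k *: c')); last by rewrite subKr.
  by rewrite linearB /= dfK sub0r; apply: modIN => //; apply: modI_df.
exists u0; split=> //; last by move: h3; rewrite /= addbN addNb.
by exists c'; split=> // k' ek; rewrite (_ : k' = k) //; apply: val_inj.
Qed.

Lemma desc_mulr X Y Z j (u u0 : 'H(X, Y)) (g : 'H(Y, Z)) : df g = 0 ->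
  desc j u u0 -> desc j (u *m g) (u0 *m g).
Proof.
move=> dg; elim: j u => [|j ih] u /=; first by move->.
move=> [u' [h hu]]; exists (u' *m g); split; last exact: ih.
move=> k kj; rewrite dfM dg mulmx0 addr0 scalemxAl -mulmxBl.
by apply: modI_mulr => //; apply: h.
Qed.

(** Each connecting map has degree one and contributes one sign (-1)^b. *)
Lemma desc_mull X Y Z j b (u u0 : 'H(Y, Z)) (g : 'H(X, Y)) : df g = 0 -> par b g ->
  desc j u u0 -> desc j ((-1) ^+ (b * j) *: (g *m u)) (g *m u0).
Proof.
move=> dg pg; elim: j u => [|j ih] u /=; first by move->; rewrite muln0 scale1r.
move=> [u' [h hu]]; exists ((-1) ^+ (b * j) *: (g *m u')); split; last exact: ih.
move=> k kj; rewrite linearZ /= dfM dg mul0mx add0r (par_sg pg) -scalemxAl scalerA -exprD.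
rewrite mulnS addnAC addnn -mul2n exprD exprM sqrrN !expr1n mul1r.
rewrite scalerA mulrC -scalerA -scalerBr; apply: modIZ => //.
by rewrite scalemxAr -mulmxBr; apply: modI_mull => //; apply: h.
Qed.

(** Reverses the connecting maps: if the image is a boundary, then u is a boundary up to an error in
    I_j and terms v_k that are cocycles modulo the y_i with i different from k. This shape is chosen
    for the supertrace estimate that follows. *)
Lemma desc_bdry X j (u u0 : 'H(X, X)) : (forall i, nullh X (y i)) -> (j <= d)%N ->
  desc j u u0 -> bdry u0 -> exists w i (v : 'I_d -> 'H(X, X)),
    [/\ u = df w + i + \sum_(k < d | (k < j)%N) v k, modI (Ij j) i &
        forall k : 'I_d, (k < j)%N -> modI (powI x (fun i : 'I_d => (i < j)%N && (i != k)) a) (df (v k))].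
Proof.
move=> hX; elim: j u => [|j ih] u jd /=.
  move=> -> [w ->]; exists w, 0, (fun=> 0); split=> //; last exact: modI0.
  by rewrite big1 // !addr0.
move=> [u' [hu /ih h /h{h}[|w [i [v [eu hi hv]]]]]]; first exact: ltnW.
pose k := Ordinal jd; have [h [sh eh]] := hX k.
(* As df (h v_l) = y_j v_l - h df v_l, subtracting y_j w and [S] from u leaves a cocycle modulo I_j,
   which becomes the new term v_j. *)
pose S := \sum_(l < d | (l < j)%N) h *m v l.
exists 0, (y k *: w), (fun l => if l == k then u - y k *: w - S else h *m v l); split.
- rewrite linear0 add0r (bigD1 k) //= eqxx.
  rewrite [X in _ + (_ + X)](_ : _ = S); first by rewrite subrK addrC subrK.
  apply: eq_big => [l|l /andP[_ /negPf ->] //].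
  by rewrite ltnS leq_eqVlt -val_eqE /=; case: ltngtP.
- by apply: modIcZ => //; apply: (powI_mem x a) => /=.
move=> l lj; case: eqP => [->|/eqP lk].
  have : modI (Ij j) (df (u - y k *: w - S)).
    have -> : df (u - y k *: w - S) = (df u - y k *: u') + y k *: i + \sum_(l < d | (l < j)%N) h *m df (v l).
      rewrite !linearB linearZ /= eu !scalerDr.
      rewrite /S linear_sum /=; under eq_bigr => q _ do rewrite (nullh_left _ sh eh).
      rewrite sumrB -scaler_sumr; mxabel.
    apply: modID => //; first apply: modID => //; first exact: hu.
      exact: modIZ.
    apply: modI_sum => // q qj; apply: modI_mull => //.
    by have := hv q qj; apply: modI_sub; apply: powI_sub => r /andP[].
  apply: modI_sub; apply: powI_sub => r rj; split=> //.
  by rewrite ltnS ltnW //= -val_eqE /= neq_ltn rj.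
have lj' : (l < j)%N.
  by move: lj lk; rewrite ltnS leq_eqVlt -val_eqE /=; case: ltngtP.
rewrite (nullh_left _ sh eh); apply: modIB => //.
  by apply: modIcZ => //; apply: (powI_mem x a) => /=; rewrite ltnSn eq_sym.
apply: modI_mull => //; have := hv l lj'; apply: modI_sub; apply: powI_sub => r /andP[rj ->].
by rewrite ltnS ltnW.
Qed.

Lemma modI_tr I p (M : 'M[A]_p) : ideal I -> modI I M -> I (\tr M).
Proof. by move=> h hM; apply: ideal_sum => // i _; apply: hM. Qed.

(** For the terms v_k: from y_k v_k = df (h v_k) + h df v_k, the supertrace of v_k times y_k lies in
    the ideal of the other y_i, modulo which y_k is regular. *)
Lemma desc_str X (u u0 : 'H(X, X)) : (forall i, nullh X (y i)) ->
  desc d u u0 -> bdry u0 -> J (str u).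
Proof.
move=> hX hu /(desc_bdry hX (leqnn _) hu)[w [i [v [-> hi hv]]]].
rewrite !linearD /= str_df add0r; apply: idealD => //.
  by apply: modI_tr => //; apply: modI_mull => //; rewrite -Ij_d.
rewrite linear_sum /=; apply: ideal_sum => // k _.
have {}hv := hv k (ltn_ord k).
have sub : subs (powI x (fun i : 'I_d => (i < d)%N && (i != k)) a) J by apply: powI_sub.
apply: sub; apply: (powI_regX (j := k) (n := a k) xreg); first by rewrite eqxx andbF.
have [h [sh eh]] := hX k.
have e : y k *: v k = df (h *m v k) + h *m df (v k) by rewrite (nullh_left _ sh eh) subrK.
rewrite (_ : _ * _ = str (y k *: v k)); last by rewrite linearZ.
rewrite e linearD /= str_df add0r.
by apply: modI_tr => //; apply: modI_mull => //; apply: modI_mull.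
Qed.

Lemma mxvec_tr p q (u : 'M[A]_(p, q)) (s : 'M[A]_(q, p)) :
  (mxvec u *m (mxvec s^T)^T) 0 0 = \tr (u *m s).
Proof.
transitivity (\sum_(ij : 'I_p * 'I_q) u ij.1 ij.2 * s ij.2 ij.1).
  rewrite mxE (reindex _ (curry_mxvec_bij _ _)) /=; apply: eq_bigr => -[i j] _ /=.
  by rewrite [(mxvec _)^T _ _]mxE !mxvecE mxE.
rewrite -(pair_bigA _ (fun i j => u i j * s j i)) /=.
by apply: eq_bigr => i _; rewrite mxE.
Qed.

Lemma self_injective_mx p q (B : 'M[A]_(p, q) -> Prop) g : submod B ->
  (forall i v, B (y i *: v)) -> ~ B g ->
  exists s : 'M_(q, p), (forall v, B v -> J (\tr (v *m s))) /\ ~ J (\tr (g *m s)).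
Proof.
move=> hB BJ ng.
have [|||l [l1 l2]] := @self_injective A m d x nA hm xreg mE a a0 _ (fun v => B (vec_mx v)) (mxvec g).
- by split=> [|c u v hu hv]; rewrite ?linear0 ?linearP; [apply: hB.1 | apply: hB.2].
- by move=> i v; rewrite linearZ; apply: BJ.
- by rewrite mxvecK.
pose s := (vec_mx l^T)^T; have e : (mxvec s^T)^T = l by rewrite /s trmxK vec_mxK trmxK.
exists s; split=> [v Bv|]; rewrite -mxvec_tr e //; apply: l1.
by rewrite mxvecK.
Qed.

(** Unlike [bdry], this contains all multiples of the y_i, as self-injectivity modulo [J]
    requires. *)
Definition bdryJ X Y (u : 'H(X, Y)) : Prop := exists w, modI J (u - df w).

Lemma bdryJ_submod X Y : submod (@bdryJ X Y).
Proof.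
split; first by exists 0; rewrite linear0 subr0; apply: modI0.
move=> c u v [w hw] [w' hw']; exists (c *: w + w'); rewrite linearP /= opprD addrACA -scalerBr.
by apply: modID => //; apply: modIZ.
Qed.

Lemma bdryJ_J X Y i (v : 'H(X, Y)) : bdryJ (y i *: v).
Proof.
exists 0; rewrite linear0 subr0; apply: modIcZ => //; exact: (powI_mem x a).
Qed.

(* Serre duality: composition Hom(Y,Z) x Hom(Z,Y[d]) is non-degenerate. *)
Lemma serre_duality Y Z b (g : 'H(Y, Z)) : (forall i, nullh Y (y i)) ->
  (forall i, nullh Z (y i)) -> df g = 0 -> par b g -> ~ bdry g ->
  exists s : 'H(Z, Y), [/\ df s = 0, par (b (+) odd d) s, ~ bdry (s *m g) & ~ bdry (g *m s)].
Proof.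
move=> hY hZ dg pg ng.
have [||s' [s1 s2]] := self_injective_mx (bdryJ_submod Y Z) _ (g := g).
- by move=> i v; apply: bdryJ_J.
- by move=> gJ; apply: ng; apply: bdry_mod.
(* The sign matrix turns the trace pairing into the supertrace pairing, under which [df] is adjoint
   to itself up to sign; as s' annihilates boundaries modulo [J], s is a cocycle modulo [J]. *)
pose s := eps Z *m s'.
have strE u : str (s *m u) = \tr (u *m s').
  by rewrite /str /s !mulmxA eps2 mul1mx mxtrace_mulC.
have ds : modI J (df s).
  have key v : J (str (df s *m v)).
    have : str (df (s *m v)) = 0 by rewrite str_df.
    rewrite dfM linearD /= => /eqP; rewrite addr_eq0 => /eqP ->; apply: idealN => //.
    rewrite -[df v]sgK -sgM str_sg strE; apply: s1.
    exists (- sg v); rewrite -[sg (df v)]opprK -df_sg linearN /= opprK addNr.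
    exact: modI0.
  have es : modI J (eps Z *m df s).
    move=> i j; have := key (delta_mx j i); rewrite /str mulmxA.
    rewrite /mxtrace (bigD1 i) //= big1 ?addr0; last first.
      move=> l li; rewrite mxE big1 // => r _.
      by rewrite [delta_mx _ _ _ _]mxE (negPf li) andbF mulr0.
    rewrite mxE (bigD1 j) //= big1 ?addr0 => [|r /negPf rj]; last by rewrite [delta_mx _ _ _ _]mxE rj mulr0.
    by rewrite [delta_mx _ _ _ _]mxE !eqxx mulr1.
  by rewrite -[df s]mul1mx -(eps2 Z) -mulmxA; apply: modI_mull.
(* The component of parity b suffices, since odd endomorphisms have supertrace 0; d connecting maps
   turn it into a cocycle over A. *)
have [|s0 [h1 h2 h3]] := @desc_ex _ _ d b (comp b s) (leqnn _) (comp_par _ _).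
  by rewrite -comp_df Ij_d; apply: modI_comp.
have sg1 : ~ J (str (comp b s *m g)).
  move=> h; apply: s2; rewrite -strE -[s](comp_sum b) mulmxDl linearD /=.
  apply: idealD => //; rewrite str_odd; first exact: ideal0.
  by have := parM (comp_par (~~ b) s) pg; rewrite addNb addbb.
exists s0; split=> //.
  by move=> hb; apply: sg1; apply: desc_str hZ _ hb; apply: desc_mulr.
move=> hb; apply: sg1; have := desc_str hY (desc_mull dg pg h1) hb.
rewrite linearZ /= (str_sym _ pg) mulrA -signr_odd => h.
have := idealMl (hI xpredT) ((-1) ^+ odd (b * d) * (-1) ^+ b) h.
by rewrite [_ ^+ _ * _]mulrC mulrA; set e := _ ^+ _; set f := _ ^+ _; rewrite (_ : _ * _ = (e * e) * (f * f) * str (comp b s *m g)); [rewrite -!expr2 !sqrr_sign !mul1r | ring].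
Qed.

End Duality.
End Graded.

(** * Auslander-Reiten morphisms *)

Section LocalModulo.
Variables (R : pzRingType) (C N : R -> Prop).
Hypotheses (C1 : C 1) (CB : forall u v, C u -> C v -> C (u - v)).
Hypotheses (CM : forall u v, C u -> C v -> C (u * v)).
Hypotheses (N0 : N 0) (NB : forall u v, N u -> N v -> N (u - v)).
Hypotheses (NMl : forall u v, C u -> N v -> N (u * v)).
Hypotheses (NMr : forall u v, C v -> N u -> N (u * v)).

(** Endomorphisms in the homotopy category are cocycles [C] modulo boundaries [N]; units, nilpotents
    and the radical are expressed on representatives. *)
Definition unitC u : Prop := exists v, [/\ C v, N (u * v - 1) & N (v * u - 1)].

Definition localC : Prop := ~ N 1 /\ forall u, C u -> unitC u \/ exists k, N (u ^+ k).

Definition radC u : Prop := C u /\ ~ unitC u.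

Let C0 : C 0. Proof. by rewrite -(subrr 1); apply: CB. Qed.
Let CN u : C u -> C (- u). Proof. by move=> h; rewrite -sub0r; apply: CB. Qed.
Let CD u v : C u -> C v -> C (u + v).
Proof. by move=> hu hv; rewrite -[v]opprK; apply: CB => //; apply: CN. Qed.
Let CX u k : C u -> C (u ^+ k).
Proof. by move=> hu; elim: k => // k ih; rewrite exprS; apply: CM. Qed.
Let NN u : N u -> N (- u). Proof. by move=> h; rewrite -sub0r; apply: NB. Qed.
Let ND u v : N u -> N v -> N (u + v).
Proof. by move=> hu hv; rewrite -[v]opprK; apply: NB => //; apply: NN. Qed.

Lemma nil_unit q k : C q -> N (q ^+ k) -> unitC (1 - q).
Proof.
move=> Cq Nq; exists (\sum_(i < k) q ^+ i).
have e : (1 - q) * (\sum_(i < k) q ^+ i) = 1 - q ^+ k.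
  by rewrite -opprB mulNr -subrX1 opprB.
have e' : (\sum_(i < k) q ^+ i) * (1 - q) = 1 - q ^+ k.
  rewrite -e mulrBr mulrBl mulr1 mul1r mulr_suml mulr_sumr; congr (_ - _).
  by apply: eq_bigr => i _; rewrite -exprSr -exprS.
split; first by apply: big_ind => // i _; apply: CX.
  by rewrite e addrAC subrr sub0r; apply: NN.
by rewrite e' addrAC subrr sub0r; apply: NN.
Qed.

Lemma unitC_congr u v : C (u - v) -> N (u - v) -> unitC u -> unitC v.
Proof.
move=> Cuv h [u' [Cu' h1 h2]]; exists u'; split=> //.
  rewrite (_ : _ - 1 = (u * u' - 1) - (u - v) * u'); first by apply: NB => //; apply: NMr.
  by rewrite mulrBl opprB [RHS]addrC addrA subrK.
rewrite (_ : _ - 1 = (u' * u - 1) - u' * (u - v)); first by apply: NB => //; apply: NMl.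
by rewrite mulrBr opprB [RHS]addrC addrA subrK.
Qed.

Hypothesis (locC : localC).

(* A one-sided inverse is two-sided, since a nilpotent element has none. *)
Lemma unitC_left u v : C u -> C v -> N (u * v - 1) -> unitC u /\ unitC v.
Proof.
move=> Cu Cv h; have [n1 loc] := locC.
have hk k : N (u ^+ k * v ^+ k - 1).
  elim: k => [|k ih]; first by rewrite !expr0 mulr1 subrr.
  rewrite exprSr exprS (_ : _ - 1 = u ^+ k * ((u * v - 1) * v ^+ k) + (u ^+ k * v ^+ k - 1)).
    by apply: ND => //; apply: NMl; [apply: CX | apply: NMr => //; apply: CX].
  by rewrite mulrBl mulrBr mul1r addrA subrK !mulrA.
case: (loc u Cu) => [[u' [Cu' h1 h2]]|[k nk]]; last first.
  case: n1; rewrite -[1](subKr (u ^+ k * v ^+ k)); apply: NB => //.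
  by apply: NMr => //; apply: CX.
split; first by exists u'.
apply: (@unitC_congr u'); first exact: CB.
  rewrite (_ : _ - v = - (u' * (u * v - 1)) + (u' * u - 1) * v).
    by apply: ND; [apply/NN/NMl | apply: NMr].
  by rewrite mulrBr mulrBl mul1r mulr1 mulrA opprB -addrA; congr (_ + _); rewrite addrA addNr add0r.
by exists u.
Qed.

Lemma radC_mull u v : C u -> radC v -> radC (u * v).
Proof.
move=> Cu [Cv nv]; split; first exact: CM.
move=> [w [Cw h1 h2]]; apply: nv; have Cwu := CM Cw Cu.
by apply: (unitC_left Cwu Cv _).2; rewrite -mulrA.
Qed.

Lemma radC_unit u : radC u -> unitC (1 - u).
Proof.
move=> [Cu nu]; case: (locC.2 u Cu) => // -[k]; exact: nil_unit.
Qed.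

(** If w inverted u + v, the nonunit w v would be congruent to the unit 1 - w u. *)
Lemma radC_add u v : radC u -> radC v -> radC (u + v).
Proof.
move=> ru rv; have [Cu _] := ru; have [Cv _] := rv.
split; first exact: CD.
move=> [w [Cw h1 h2]].
have r1 := radC_mull Cw ru; have [Cwv nwv] := radC_mull Cw rv.
apply: nwv; apply: (@unitC_congr (1 - w * u)) (radC_unit r1).
  by apply: CB => //; apply: CB => //; case: r1.
rewrite (_ : _ - _ = - (w * (u + v) - 1)); first exact: NN.
by rewrite mulrDr opprB opprD addrA.
Qed.

Lemma radC0 : radC 0.
Proof.
have [n1 _] := locC; split=> //.
move=> [w [Cw]]; rewrite mul0r sub0r => h _; apply: n1; rewrite -[1]opprK; exact: NN.
Qed.

End LocalModulo.

(** * Retractions and socles in the homotopy category *)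

Section Core.
Variables (A : comNzRingType) (m : A -> Prop) (d : nat) (x : 'I_d -> A).
Hypotheses (nA : noeth A^o) (hm : localI m) (xreg : regular_system x).
Hypotheses (mE : m = powI x xpredT (fun=> 1%N)).

Notation "''H' ( X , Y )" := 'M[A]_(gdim X, gdim Y) (at level 8, format "''H' ( X ,  Y )").

Definition cyc b (X Y : gcx A) (u : 'H(X, Y)) : Prop := par b u /\ df u = 0.

Definition isoM (X Y : gcx A) (u : 'H(X, Y)) : Prop :=
  exists v : 'H(Y, X), [/\ cyc false v, bdry (u *m v - 1%:M) & bdry (v *m u - 1%:M)].

Definition localM (X : gcx A) : Prop := ~ bdry (1%:M : 'H(X, X)) /\
  forall u : 'H(X, X), cyc false u -> isoM u \/ exists k, bdry (u ^+ k).

Definition torsion (X : gcx A) : Prop :=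
  exists e : nat, forall i, nullh X (x i ^+ e).

Lemma cyc1 X : cyc false (1%:M : 'H(X, X)).
Proof.
split; first by rewrite /par mulmx1 mul1mx.
by rewrite dfE /sg mulmx1 mulmx1 eps2 mul1mx subrr.
Qed.

Lemma cycB b X Y (u v : 'H(X, Y)) : cyc b u -> cyc b v -> cyc b (u - v).
Proof. by move=> [p1 d1] [p2 d2]; split; [apply: parB | rewrite linearB /= d1 d2 subrr]. Qed.

Lemma cycZ b X Y c (u : 'H(X, Y)) : cyc b u -> cyc b (c *: u).
Proof. by move=> [p1 d1]; split; [apply: parZ | rewrite linearZ /= d1 scaler0]. Qed.

Lemma cycM b c X Y Z (u : 'H(X, Y)) (v : 'H(Y, Z)) : cyc b u -> cyc c v -> cyc (b (+) c) (u *m v).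
Proof. by move=> [p1 d1] [p2 d2]; split; [apply: parM | rewrite dfM d1 d2 mul0mx mulmx0 addr0]. Qed.

Lemma cycX X (u : 'H(X, X)) k : cyc false u -> cyc false (u ^+ k).
Proof.
move=> cu; elim: k => [|k ih]; first exact: cyc1.
by rewrite exprS; apply: (cycM cu ih).
Qed.

Lemma bdryB X Y (u v : 'H(X, Y)) : bdry u -> bdry v -> bdry (u - v).
Proof. exact: (submodB (bdry_submod X Y)). Qed.

Lemma bdryD X Y (u v : 'H(X, Y)) : bdry u -> bdry v -> bdry (u + v).
Proof. exact: (submodD (bdry_submod X Y)). Qed.

Lemma cyc_bdryl b X Y Z (u : 'H(X, Y)) (v : 'H(Y, Z)) : cyc b u -> bdry v -> bdry (u *m v).
Proof. by case=> _; apply: bdry_mull. Qed.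

Lemma cyc_bdryr b X Y Z (u : 'H(X, Y)) (v : 'H(Y, Z)) : cyc b v -> bdry u -> bdry (u *m v).
Proof. by case=> _; apply: bdry_mulr. Qed.

(* The idempotent t v s, with v inverse to s t, cannot be nilpotent. *)
Lemma retraction_iso X Y (t : 'H(X, Y)) (s : 'H(Y, X)) : localM X -> ~ bdry (1%:M : 'H(Y, Y)) ->
  cyc false t -> cyc false s -> isoM (s *m t) -> isoM t /\ isoM s.
Proof.
move=> locX nY ct cs [v [cv h1 h2]].
have cvs : cyc false (v *m s) := cycM cv cs.
have ctv : cyc false (t *m v) := cycM ct cv.
pose e := t *m (v *m s); have ce : cyc false e := cycM ct cvs.
have st1 : bdry (v *m s *m t - 1%:M) by rewrite -mulmxA.
have ee : bdry (e *m e - e).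
  rewrite (_ : _ - e = t *m ((v *m s *m t - 1%:M) *m (v *m s))).
    by apply: (cyc_bdryl ct); apply: (cyc_bdryr cvs).
  by rewrite mulmxBl mul1mx mulmxBr /e !mulmxA.
have hk k : bdry (v *m s *m (e ^+ k) *m t - 1%:M).
  elim: k => [|k ih]; first by rewrite mulmx1.
  rewrite exprS (_ : _ - _ = (v *m s *m t - 1%:M) *m (v *m s *m (e ^+ k) *m t)
    + (v *m s *m (e ^+ k) *m t - 1%:M)).
    by apply: bdryD => //; apply: (cyc_bdryr (cycM (cycM cvs (cycX k ce)) ct)).
  by rewrite [in RHS]mulmxBl mul1mx addrA subrK /e -[_ * _]/(_ *m _) !mulmxA.
have [[f [cf f1 f2]]|[k ek]] := locX.2 e ce; last first.
  case: nY; rewrite -[1%:M](subKr (v *m s *m (e ^+ k) *m t)); apply: bdryB => //.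
  by apply: (cyc_bdryr ct); apply: (cyc_bdryl cvs).
have e1 : bdry (e - 1%:M).
  rewrite (_ : _ - _ = f *m (e *m e - e) - (f *m e - 1%:M) *m e + (f *m e - 1%:M)).
    by apply: bdryD => //; apply: bdryB; [apply: (cyc_bdryl cf) | apply: (cyc_bdryr ce)].
  rewrite mulmxBl mul1mx mulmxBr !mulmxA; mxabel.
split; first by exists (v *m s); split.
by exists (t *m v); split=> //; rewrite ?mulmxA // -mulmxA.
Qed.

Section Socle.
Variables (a : 'I_d -> nat) (a0 : forall i, (0 < a i)%N).
Local Notation J := (powI x xpredT a).

Lemma noeth_mx p q : noeth 'M[A]_(p, q).
Proof. by apply: (@noeth_image _ _ _ vec_mx mxvec mxvecK); apply: noeth_row. Qed.

(** The trace pairing turns the descending chain into an ascending chain of annihilators, and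
    self-injectivity recovers each [W n] from its annihilator. *)
Lemma dcc_mx p q (W : nat -> 'M[A]_(p, q) -> Prop) : (forall n, submod (W n)) ->
  (forall n i v, W n (x i ^+ a i *: v)) -> (forall n, subs (W n.+1) (W n)) ->
  exists N, subs (W N) (W N.+1).
Proof.
move=> hW WJ dec; have hJ := powI_ideal x xpredT a.
pose perp n (s : 'M[A]_(q, p)) := forall v, W n v -> J (\tr (v *m s)).
have [||N hN] := @noeth_acc _ _ perp (@noeth_mx q p).
- move=> n; split=> [v _|c s t hs ht v Wv]; first by rewrite mulmx0 linear0; apply: ideal0.
  rewrite mulmxDr -scalemxAr linearP /=; apply: idealD => //; last exact: ht.
  by apply: idealMl => //; apply: hs.
- by move=> n s h v /dec; apply: h.
exists N => v WNv; apply: contrapT => nW.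
have [s [s1 s2]] := self_injective_mx nA hm xreg mE a0 (hW N.+1) (WJ N.+1) nW.
by apply: s2; apply: (hN N.+1 s s1).
Qed.

(** [act] abstracts composition with the radical on either side. If no such h exists, there are
    h_(k+1) = r_k h_k, none a boundary. The submodules (A + rad) h_k, modulo [bdryJ], stabilise, so
    some h_N is r h_N with r in the radical, although 1 - r acts injectively. *)
Lemma socle_exists X Y p r (rad : 'M[A]_r -> Prop) (act : 'M[A]_r -> 'H(X, Y) -> 'H(X, Y)) :
  (forall i, nullh X (x i ^+ a i)) -> submod rad ->
  (forall c r1 r2 h, act (c *: r1 + r2) h = c *: act r1 h + act r2 h) ->
  (forall r1 r2, rad r1 -> rad r2 -> exists r3, rad r3 /\ forall h, act r1 (act r2 h) = act r3 h) ->
  (forall r1 (h : 'H(X, Y)), rad r1 -> cyc p h -> cyc p (act r1 h)) ->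
  (forall r1 (h : 'H(X, Y)), rad r1 -> cyc p h -> bdry (h - act r1 h) -> bdry h) ->
  (exists h : 'H(X, Y), cyc p h /\ ~ bdry h) ->
  exists h : 'H(X, Y), [/\ cyc p h, ~ bdry h & forall r1, rad r1 -> bdry (act r1 h)].
Proof.
move=> hX hrad lact actM actc actinj [h0 [ch0 nh0]]; apply: contrapT => none.
have act0 h : act 0 h = 0 by have := lact (-1) 0 0 h; rewrite scaler0 addr0 scaleN1r addNr.
pose T := {h : 'H(X, Y) | cyc p h /\ ~ bdry h}.
have step (h : T) : exists h' : T, exists2 r1, rad r1 & sval h' = act r1 (sval h).
  case: h => h [ch nh] /=; apply: contrapT => no; apply: none; exists h; split=> // r1 hr.
  apply: contrapT => nb; apply: no.
  by exists (exist _ (act r1 h) (conj (actc _ _ hr ch) nb)); exists r1.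
have [nx nxP] := choice step.
pose s k : T := iter k nx (exist _ h0 (conj ch0 nh0)).
pose B := bdryJ x a (X := X) (Y := Y).
pose W k u := exists c r1, rad r1 /\ B (u - (c *: sval (s k) + act r1 (sval (s k)))).
have hB := bdryJ_submod x a X Y.
have [|||N hN] := @dcc_mx _ _ W.
- move=> k; split.
    exists 0, 0; split; first exact: (submod0 hrad).
    by rewrite scale0r act0 !addr0 subr0; apply: (submod0 hB).
  move=> c u v [c1 [r1 [hr1 b1]]] [c2 [r2 [hr2 b2]]].
  exists (c * c1 + c2), (c *: r1 + r2); split; first exact: hrad.2.
  rewrite (_ : _ - _ = c *: (u - (c1 *: sval (s k) + act r1 (sval (s k)))) +
    (v - (c2 *: sval (s k) + act r2 (sval (s k))))); first exact: hB.2.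
  by rewrite lact scalerDl -scalerA scalerBr scalerDr; mxabel.
- move=> k i v; exists 0, 0; split; first exact: (submod0 hrad).
  by rewrite scale0r act0 addr0 subr0; apply: bdryJ_J.
- move=> k u [c [r1 [hr1 b1]]]; have [r2 hr2 e] := nxP (s k).
  have [r3 [hr3 e3]] := actM _ _ hr1 hr2.
  exists 0, (c *: r2 + r3); split; first exact: hrad.2.
  by rewrite scale0r add0r lact -e3 -e.
have [|c [r1 [hr1 b1]]] := hN (sval (s N)).
  exists 1, 0; split; first exact: (submod0 hrad).
  by rewrite scale1r act0 addr0 subrr; apply: (submod0 hB).
have [r2 hr2 e] := nxP (s N); have [r3 [hr3 e3]] := actM _ _ hr1 hr2.
have [ch nh] := svalP (s N).
have hr : rad (c *: r2 + r3) by apply: hrad.2.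
(* The relation is known modulo [J] only; for cocycles this is enough. *)
apply: nh; apply: (actinj _ _ hr ch); apply: (bdry_mod xreg hX).
  by apply: (cycB ch (actc _ _ hr ch)).2.
by move: b1; rewrite /s /= e -/(s N) e3 lact.
Qed.

End Socle.

Lemma torsion_uniform X Y : torsion X -> torsion Y -> exists e, (0 < e)%N /\
  forall i, nullh X (x i ^+ e) /\ nullh Y (x i ^+ e).
Proof.
have mono Z e f i : (e <= f)%N -> nullh Z (x i ^+ e) -> nullh Z (x i ^+ f).
  move=> /subnK <- [h [sh eh]]; exists (x i ^+ (f - e) *: h).
  rewrite linearZ /= sh scalerN; split=> //.
  by rewrite -scalemxAr -scalemxAl -scalerDr eh scale_scalar_mx exprD.
move=> [e he] [f hf]; exists (maxn e f).+1; split=> // i.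
by split; [apply: (mono _ e) | apply: (mono _ f)] => //; rewrite ltnW // ltnS ?leq_maxl ?leq_maxr.
Qed.

Let p := odd d.

Lemma serre X Y b (g : 'H(X, Y)) : torsion X -> torsion Y -> cyc b g -> ~ bdry g ->
  exists s : 'H(Y, X), [/\ cyc (b (+) p) s, ~ bdry (s *m g) & ~ bdry (g *m s)].
Proof.
move=> tX tY [pg dg] ng; have [e [e0 he]] := torsion_uniform tX tY.
have [|||s [h1 h2 h3 h4]] := @serre_duality A m d x (fun=> e) nA hm xreg mE _ X Y b g _ _ dg pg ng => //.
- by move=> i; case: (he i).
- by move=> i; case: (he i).
by exists s.
Qed.

(** * AR morphisms of a local object *)

Section LocalObject.
Variable M : gcx A.
Hypotheses (tM : torsion M) (locM : localM M).

Let C := cyc false (X := M) (Y := M).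
Let N := @bdry A M M.
Let rad := radC (R := 'M[A]_(gdim M)) C N.
Let C1 : C 1%:M. Proof. exact: cyc1. Qed.
Let CB (u v : 'H(M, M)) : C u -> C v -> C (u - v). Proof. exact: cycB. Qed.
Let CM (u v : 'H(M, M)) : C u -> C v -> C (u *m v). Proof. exact: cycM. Qed.
Let N0 : N 0. Proof. exact: (submod0 (bdry_submod M M)). Qed.
Let NB (u v : 'H(M, M)) : N u -> N v -> N (u - v). Proof. exact: bdryB. Qed.
Let NMl (u v : 'H(M, M)) : C u -> N v -> N (u *m v). Proof. exact: cyc_bdryl. Qed.
Let NMr (u v : 'H(M, M)) : C v -> N u -> N (u *m v). Proof. exact: cyc_bdryr. Qed.

Lemma rad_submod : submod rad.
Proof.
have r0 := radC0 C1 CB N0 NB (locM : localC (R := 'M[A]_(gdim M)) C N).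
split; first exact: r0.
move=> c u v ru rv; apply: (radC_add (R := 'M[A]_(gdim M)) C1 CB CM N0 NB NMl NMr locM) => //.
rewrite -mul_scalar_mx; apply: (radC_mull (R := 'M[A]_(gdim M)) C1 CB CM N0 NB NMl NMr locM) => //.
rewrite -[c%:M]mulr1 -[_ * _]/(_ *m _) mul_scalar_mx; exact: cycZ.
Qed.

Lemma nonzero_shift : exists h : 'H(M, M), cyc p h /\ ~ bdry h.
Proof.
have [s [h1 _ h3]] := serre tM tM (cyc1 M) locM.1.
by exists s; split=> //; move: h3; rewrite mul1mx.
Qed.

(** With products composing from left to right, [r *m h] is h after r, the composite that concerns
    triangles ending at M. *)
Lemma right_socle : exists h : 'H(M, M), [/\ cyc p h, ~ bdry h & forall r, rad r -> bdry (r *m h)].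
Proof.
have [e [e0 he]] := torsion_uniform tM tM.
apply: (@socle_exists (fun=> e) _ M M p _ rad (fun r h => r *m h)) => //.
- by move=> i; case: (he i).
- exact: rad_submod.
- by move=> c r1 r2 h; rewrite mulmxDl scalemxAl.
- move=> r1 r2 h1 h2; exists (r1 *m r2); split; last by move=> h; rewrite mulmxA.
  by apply: (radC_mull (R := 'M[A]_(gdim M)) C1 CB CM N0 NB NMl NMr locM) => //; case: h1.
- by move=> r h [cr _] ch; apply: (cycM cr ch).
- move=> r h hr ch b; have [v [cv _ v2]] := radC_unit (R := 'M[A]_(gdim M)) C1 CB CM N0 NB locM hr.
  rewrite -[h]mul1mx -[1%:M](subKr (v * (1 - r))) mulmxBl; apply: bdryB.
    by rewrite -mulmxA mulmxBl mul1mx; apply: (cyc_bdryl cv).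
  by apply: (cyc_bdryr ch).
- exact: nonzero_shift.
Qed.

Lemma left_socle : exists h : 'H(M, M), [/\ cyc p h, ~ bdry h & forall r, rad r -> bdry (h *m r)].
Proof.
have [e [e0 he]] := torsion_uniform tM tM.
apply: (@socle_exists (fun=> e) _ M M p _ rad (fun r h => h *m r)) => //.
- by move=> i; case: (he i).
- exact: rad_submod.
- by move=> c r1 r2 h; rewrite mulmxDr scalemxAr.
- move=> r1 r2 h1 h2; exists (r2 *m r1); split; last by move=> h; rewrite mulmxA.
  by apply: (radC_mull (R := 'M[A]_(gdim M)) C1 CB CM N0 NB NMl NMr locM) => //; case: h2.
- by move=> r h [cr _] ch; have := cycM ch cr; rewrite addbF.
- move=> r h hr ch b; have [v [cv v1 _]] := radC_unit (R := 'M[A]_(gdim M)) C1 CB CM N0 NB locM hr.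
  rewrite -[h]mulmx1 -[1%:M](subKr ((1 - r) * v)) mulmxBr; apply: bdryB.
    by rewrite mulmxA mulmxBr mulmx1; apply: (cyc_bdryr cv).
  by apply: (cyc_bdryl ch).
- exact: nonzero_shift.
Qed.

Lemma right_AR_morphism : exists h : 'H(M, M), [/\ cyc p h, ~ bdry h &
  forall D (t : 'H(D, M)), torsion D -> localM D -> cyc false t -> ~ isoM t -> bdry (t *m h)].
Proof.
have [h [ch nh hr]] := right_socle; exists h; split=> // D t tD locD ct nt.
apply: contrapT => nb.
have [s [cs nb' _]] := serre tD tM (cycM ct ch) nb.
rewrite addbb in cs; apply: nb'; rewrite mulmxA; apply: hr; split; first exact: (cycM cs ct).
by move=> ist; apply: nt; apply: (retraction_iso locD locM.1 ct cs ist).1.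
Qed.

Lemma left_AR_morphism : exists h : 'H(M, M), [/\ cyc p h, ~ bdry h &
  forall D (t : 'H(M, D)), torsion D -> localM D -> cyc false t -> ~ isoM t -> bdry (h *m t)].
Proof.
have [h [ch nh hr]] := left_socle; exists h; split=> // D t tD locD ct nt.
apply: contrapT => nb.
have [s [cs _ nb']] := serre tM tD (cycM ch ct) nb.
rewrite addbF addbb in cs; apply: nb'; rewrite -mulmxA; apply: hr; split; first exact: (cycM ct cs).
by move=> ist; apply: nt; apply: (retraction_iso locD locM.1 cs ct ist).2.
Qed.

End LocalObject.
End Core.

(** * Matrices of complexes and chain maps *)

Section Coordinates.
Variable A : comNzRingType.

Notation "''H' ( X , Y )" := 'M[A]_(gdim X, gdim Y) (at level 8, format "''H' ( X ,  Y )").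

Definition mxl (U V : vectType A) (f : {linear U -> V}) : 'M[A]_(dim U, dim V) :=
  lin1_mx (v2r \o f \o r2v).

Lemma mxlE (U V : vectType A) (f : {linear U -> V}) u : v2r (f u) = v2r u *m mxl f.
Proof. by rewrite /mxl mul_rV_lin1 /= v2rK. Qed.

Definition lmx (U V : vectType A) (M : 'M[A]_(dim U, dim V)) (u : U) : V :=
  r2v (v2r u *m M).

Lemma lmx_linear (U V : vectType A) M : linear (@lmx U V M).
Proof. by move=> a u v; rewrite /lmx linearP mulmxDl -scalemxAl linearP. Qed.
HB.instance Definition _ (U V : vectType A) M := GRing.isLinear.Build A U V _ (@lmx U V M) (@lmx_linear U V M).

Lemma lmxE (U V : vectType A) M u : v2r (@lmx U V M u) = v2r u *m M.
Proof. by rewrite /lmx r2vK. Qed.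

Lemma mx_ext (U : vectType A) k (M N : 'M[A]_(dim U, k)) :
  (forall u : U, v2r u *m M = v2r u *m N) -> M = N.
Proof.
by move=> h; apply/row_matrixP => i; rewrite !rowE; have := h (r2v (delta_mx 0 i)); rewrite r2vK.
Qed.

Lemma lmxK (U V : vectType A) (M : 'M_(dim U, dim V)) : mxl (@lmx U V M) = M.
Proof. by apply: (@mx_ext U) => u; rewrite -mxlE lmxE. Qed.

Lemma v2r0 (U : vectType A) (u : U) : v2r u = 0 -> u = 0.
Proof. by move=> h; apply: v2r_inj; rewrite h linear0. Qed.

Variable (X : cplx A).

Let n0 := dim (cx0 X).
Let n1 := dim (cx1 X).

Lemma mxl01 : mxl (dif0 X) *m mxl (dif1 X) = 0.
Proof. by apply: (@mx_ext (cx0 X)) => u; rewrite mulmxA -!mxlE dif10 linear0 mulmx0. Qed.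
Lemma mxl10 : mxl (dif1 X) *m mxl (dif0 X) = 0.
Proof. by apply: (@mx_ext (cx1 X)) => u; rewrite mulmxA -!mxlE dif01 linear0 mulmx0. Qed.

Definition toP : 'M[A]_(n0 + n1) := block_mx 1%:M 0 0 0.
Definition toD : 'M[A]_(n0 + n1) := block_mx 0 (mxl (dif0 X)) (mxl (dif1 X)) 0.

Lemma toPP : toP *m toP = toP.
Proof. by rewrite mulmx_block !mulmx0 !mul0mx !mulmx1 !addr0. Qed.
Lemma toDD : toD *m toD = 0.
Proof.
by rewrite mulmx_block !mulmx0 !mul0mx !addr0 !add0r mxl01 mxl10 -block_mx0.
Qed.
Lemma toPD : toP *m toD + toD *m toP = toD.
Proof.
by rewrite !mulmx_block !mulmx0 !mul0mx !mul1mx !mulmx1 !addr0 add_block_mx !addr0 !add0r.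
Qed.

Definition toG : gcx A := GCx toPP toDD toPD.

End Coordinates.

(** * Chain maps as even cocycles, maps involving a shift as odd ones *)

Section Morphisms.
Variable A : comNzRingType.
Implicit Types (X Y Z : cplx A).

Notation "''H' ( X , Y )" := 'M[A]_(gdim X, gdim Y) (at level 8, format "''H' ( X ,  Y )").

Definition blk X Y a b c e : 'H(toG X, toG Y) :=
  @block_mx A (dim (cx0 X)) (dim (cx1 X)) (dim (cx0 Y)) (dim (cx1 Y)) a b c e.

Lemma blkP X Y (u : 'H(toG X, toG Y)) : exists a b c e, u = blk a b c e.
Proof. by rewrite -[u]submxK; do 4!eexists. Qed.

Lemma blk_inj X Y a b c e a' b' c' e' :
  @blk X Y a b c e = blk a' b' c' e' -> [/\ a = a', b = b', c = c' & e = e'].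
Proof. exact: eq_block_mx. Qed.

Lemma blkM X Y Z a b c e a' b' c' e' :
  @blk X Y a b c e *m @blk Y Z a' b' c' e' =
  blk (a *m a' + b *m c') (a *m b' + b *m e') (c *m a' + e *m c') (c *m b' + e *m e').
Proof. exact: mulmx_block. Qed.

Lemma blkB X Y a b c e a' b' c' e' :
  @blk X Y a b c e - blk a' b' c' e' = blk (a - a') (b - b') (c - c') (e - e').
Proof. by rewrite /blk opp_block_mx add_block_mx. Qed.

Lemma blk1 X : (1%:M : 'H(toG X, toG X)) = blk 1%:M 0 0 1%:M.
Proof. exact: scalar_mx_block. Qed.

Lemma blk0 X Y : (0 : 'H(toG X, toG Y)) = blk 0 0 0 0.
Proof. by rewrite /blk block_mx0. Qed.

Lemma gP_blk X : gP (toG X) = blk 1%:M 0 0 0. Proof. by []. Qed.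
Lemma gD_blk X : gD (toG X) = blk 0 (mxl (dif0 X)) (mxl (dif1 X)) 0. Proof. by []. Qed.

Lemma eps_blk X : eps (toG X) = blk 1%:M 0 0 (- 1%:M).
Proof. by rewrite epsE gP_blk blk1 !blkB !subrr !subr0 sub0r. Qed.

Lemma sg_blk X Y a b c e : sg (@blk X Y a b c e) = blk a (- b) (- c) e.
Proof.
rewrite /sg !eps_blk !blkM !mul1mx !mul0mx !mulmx0 !mulmx1 !addr0 !add0r.
by rewrite !mulNmx !mulmxN !mul1mx !mulmx1 opprK.
Qed.

Lemma df_blk X Y a b c e : df (@blk X Y a b c e) =
  blk (mxl (dif0 X) *m c + b *m mxl (dif1 Y)) (mxl (dif0 X) *m e - a *m mxl (dif0 Y))
      (mxl (dif1 X) *m a - e *m mxl (dif1 Y)) (mxl (dif1 X) *m b + c *m mxl (dif0 Y)).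
Proof.
rewrite dfE sg_blk !gD_blk !blkM blkB !mul0mx !mulmx0 !addr0 !add0r.
by rewrite !mulNmx !opprK.
Qed.

Lemma par_blk X Y a b c e (t : bool) : par t (@blk X Y a b c e) <->
  if t then a = 0 /\ e = 0 else b = 0 /\ c = 0.
Proof.
rewrite /par; case: t; rewrite /gQ !gP_blk ?blk1 ?blkB !blkM.
  rewrite !(subrr, subr0, mul1mx, mul0mx, mulmx0, mulmx1, addr0, add0r); split.
    by case/blk_inj => -> _ _ <-.
  by case=> -> ->.
rewrite !(mul1mx, mul0mx, mulmx0, mulmx1, addr0); split.
  by case/blk_inj => _ -> <-.
by case=> -> ->.
Qed.

Definition mof X Y (f : cmap X Y) : 'H(toG X, toG Y) :=
  blk (mxl (map0 f)) 0 0 (mxl (map1 f)).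

Lemma mof_cyc X Y (f : cmap X Y) : cyc false (mof f).
Proof.
split; first by apply/par_blk.
rewrite /mof df_blk blk0 !mulmx0 !mul0mx !addr0.
rewrite (_ : _ *m _ = mxl (map0 f) *m mxl (dif0 Y)); last first.
  by apply: (@mx_ext _ (cx0 X)) => u; rewrite !mulmxA -!mxlE cmap0P.
rewrite (_ : mxl (dif1 X) *m _ = mxl (map1 f) *m mxl (dif1 Y)); last first.
  by apply: (@mx_ext _ (cx1 X)) => u; rewrite !mulmxA -!mxlE cmap1P.
by rewrite !subrr.
Qed.

Lemma cyc_mof X Y (u : 'H(toG X, toG Y)) : cyc false u -> exists f : cmap X Y, mof f = u.
Proof.
have [a [b [c [e ->]]]] := blkP u; case=> /par_blk[-> ->].
rewrite df_blk blk0 => /blk_inj[_ /eqP h0 /eqP h1 _].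
move: h0 h1; rewrite !subr_eq0 => /eqP h0 /eqP h1.
have c0 x : lmx e (dif0 X x) = dif0 Y (lmx a x).
  by apply: v2r_inj; rewrite !(lmxE, mxlE) -!mulmxA h0.
have c1 x : lmx a (dif1 X x) = dif1 Y (lmx e x).
  by apply: v2r_inj; rewrite !(lmxE, mxlE) -!mulmxA h1.
by exists (@CMap A X Y (@lmx A _ _ a) (@lmx A _ _ e) c0 c1); rewrite /mof /= !lmxK.
Qed.

Lemma mof_comp X Y Z (g : cmap Y Z) (f : cmap X Y) : mof (cmap_comp g f) = mof f *m mof g.
Proof.
rewrite /mof blkM !mul0mx !mulmx0 !addr0 !add0r; congr blk.
  by apply: (@mx_ext _ (cx0 X)) => u; rewrite !mulmxA -!mxlE.
by apply: (@mx_ext _ (cx1 X)) => u; rewrite !mulmxA -!mxlE.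
Qed.

Lemma mof_id X : mof (cmap_id X) = 1%:M.
Proof.
rewrite /mof blk1; congr blk.
  by apply: (@mx_ext _ (cx0 X)) => u; rewrite -mxlE mulmx1.
by apply: (@mx_ext _ (cx1 X)) => u; rewrite -mxlE mulmx1.
Qed.

Lemma mof_zero X Y : mof (cmap_zero X Y) = 0.
Proof.
rewrite /mof blk0; congr blk.
  by apply: (@mx_ext _ (cx0 X)) => u; rewrite -mxlE mulmx0 linear0.
by apply: (@mx_ext _ (cx1 X)) => u; rewrite -mxlE mulmx0 linear0.
Qed.

(** The diagonal blocks of [df w] are made of the off-diagonal blocks of w, so the latter form a
    homotopy for any primitive w. *)
Lemma homotopicP X Y (f g : cmap X Y) : homotopic f g <-> bdry (mof f - mof g).
Proof.
rewrite /mof blkB !subrr; split.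
  case=> s0 [s1 [h0 h1]]; exists (blk 0 (mxl s0) (mxl s1) 0).
  rewrite df_blk !mulmx0 !mul0mx !subrr; congr blk.
    by apply: (@mx_ext _ (cx0 X)) => u; rewrite mulmxBr mulmxDr !mulmxA -!mxlE -linearB h0 linearD /= addrC.
  by apply: (@mx_ext _ (cx1 X)) => u; rewrite mulmxBr mulmxDr !mulmxA -!mxlE -linearB h1 linearD /= addrC.
case=> w; have [a [b [c [e ->]]]] := blkP w; rewrite df_blk => /blk_inj[h0 _ _ h1].
exists (@lmx A _ _ b), (@lmx A _ _ c); split=> x; apply: v2r_inj.
  by rewrite linearB linearD /= !(lmxE, mxlE) -mulmxBr h0 mulmxDr !mulmxA addrC.
by rewrite linearB linearD /= !(lmxE, mxlE) -mulmxBr h1 mulmxDr !mulmxA addrC.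
Qed.

Lemma homotopic0P X Y (f : cmap X Y) : homotopic f (cmap_zero X Y) <-> bdry (mof f).
Proof. by rewrite homotopicP mof_zero subr0. Qed.

Lemma is_isoP X Y (f : cmap X Y) : is_iso f <-> isoM (mof f).
Proof.
split=> [[g [/homotopicP h1 /homotopicP h2]]|[v [/cyc_mof[g <-] h1 h2]]].
  by exists (mof g); split; [apply: mof_cyc | |]; rewrite -mof_comp -mof_id.
by exists g; split; apply/homotopicP; rewrite mof_comp mof_id.
Qed.

Lemma is_zeroP X : is_zero X <-> bdry (1%:M : 'H(toG X, toG X)).
Proof. by rewrite /is_zero homotopic0P mof_id. Qed.

(* Morphisms of odd degree are morphisms into, or out of, a shift. *)
Definition oof X Y (h : cmap X (cshift Y)) : 'H(toG X, toG Y) :=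
  @blk X Y 0 (mxl (map0 h : {linear cx0 X -> cx1 Y})) (mxl (map1 h : {linear cx1 X -> cx0 Y})) 0.

Definition oof' X Y (w : cmap (cshift X) Y) : 'H(toG X, toG Y) :=
  @blk X Y 0 (mxl (map1 w : {linear cx0 X -> cx1 Y})) (mxl (map0 w : {linear cx1 X -> cx0 Y})) 0.

Lemma cyc_oof X Y (u : 'H(toG X, toG Y)) : cyc true u -> exists h : cmap X (cshift Y), oof h = u.
Proof.
have [a [b [c [e ->]]]] := blkP u; case=> /par_blk[-> ->].
rewrite df_blk blk0 => /blk_inj[/eqP h0 _ _ /eqP h1].
move: h0 h1; rewrite !addr_eq0 => /eqP h0 /eqP h1.
have c0 x : lmx c (dif0 X x) = dif0 (cshift Y) (@lmx A (cx0 X) (cx1 Y) b x).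
  by apply: v2r_inj; rewrite /= linearN /= !(lmxE, mxlE) -!mulmxA h0 mulmxN.
have c1 x : lmx b (dif1 X x) = dif1 (cshift Y) (@lmx A (cx1 X) (cx0 Y) c x).
  by apply: v2r_inj; rewrite /= linearN /= !(lmxE, mxlE) -!mulmxA h1 mulmxN.
by exists (@CMap A X (cshift Y) (@lmx A (cx0 X) (cx1 Y) b) (@lmx A (cx1 X) (cx0 Y) c) c0 c1); rewrite /oof /= !lmxK.
Qed.

Lemma cyc_oof' X Y (u : 'H(toG X, toG Y)) : cyc true u -> exists w : cmap (cshift X) Y, oof' w = u.
Proof.
have [a [b [c [e ->]]]] := blkP u; case=> /par_blk[-> ->].
rewrite df_blk blk0 => /blk_inj[h0 _ _ h1].
move: h0 => /eqP; rewrite addrC addr_eq0 => /eqP h0.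
move: h1 => /eqP; rewrite addrC addr_eq0 => /eqP h1.
have c0 x : lmx b (dif0 (cshift X) x) = dif0 Y (@lmx A (cx1 X) (cx0 Y) c x).
  by apply: v2r_inj; rewrite /= lmxE linearN /= !(lmxE, mxlE) mulNmx -!mulmxA h1 mulmxN.
have c1 x : lmx c (dif1 (cshift X) x) = dif1 Y (@lmx A (cx0 X) (cx1 Y) b x).
  by apply: v2r_inj; rewrite /= lmxE linearN /= !(lmxE, mxlE) mulNmx -!mulmxA h0 mulmxN.
by exists (@CMap A (cshift X) Y (@lmx A (cx1 X) (cx0 Y) c) (@lmx A (cx0 X) (cx1 Y) b) c0 c1); rewrite /oof' /= !lmxK.
Qed.

Lemma oof_comp X Y Z (h : cmap Y (cshift Z)) (f : cmap X Y) : oof (cmap_comp h f) = mof f *m oof h.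
Proof.
rewrite /mof /oof blkM !mul0mx !mulmx0 !addr0 !add0r; congr blk.
  by apply: (@mx_ext _ (cx0 X)) => u; rewrite !mulmxA -!mxlE.
by apply: (@mx_ext _ (cx1 X)) => u; rewrite !mulmxA -!mxlE.
Qed.

Lemma oof'_comp X Y Z (f : cmap Y Z) (w : cmap (cshift X) Y) : oof' (cmap_comp f w) = oof' w *m mof f.
Proof.
rewrite /mof /oof' blkM !mul0mx !mulmx0 !addr0 !add0r; congr blk.
  by apply: (@mx_ext _ (cx0 X)) => u; rewrite !mulmxA -!mxlE.
by apply: (@mx_ext _ (cx1 X)) => u; rewrite !mulmxA -!mxlE.
Qed.

Lemma oof0P X Y (h : cmap X (cshift Y)) : homotopic h (cmap_zero _ _) <-> bdry (oof h).
Proof.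
rewrite /oof; split.
  case=> s0 [s1 [h0 h1]].
  exists (@blk X Y (mxl (s0 : {linear cx0 X -> cx0 Y})) 0 0 (mxl (s1 : {linear cx1 X -> cx1 Y}))).
  rewrite df_blk !mulmx0 !mul0mx !addr0; congr blk.
    apply: (@mx_ext _ (cx0 X)) => u; rewrite mulmxBr !mulmxA -!mxlE.
    by have := h0 u; rewrite /= subr0 => ->; rewrite linearD linearN addrC.
  apply: (@mx_ext _ (cx1 X)) => u; rewrite mulmxBr !mulmxA -!mxlE.
  by have := h1 u; rewrite /= subr0 => ->; rewrite linearD linearN addrC.
case=> w; have [a [b [c [e ->]]]] := blkP w; rewrite df_blk => /blk_inj[_ h0 h1 _].
exists (@lmx A (cx0 X) (cx0 Y) a), (@lmx A (cx1 X) (cx1 Y) e); split=> x; apply: v2r_inj => /=.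
  by rewrite subr0 linearD linearN /= !(lmxE, mxlE) h0 mulmxBr !mulmxA addrC.
by rewrite subr0 linearD linearN /= !(lmxE, mxlE) h1 mulmxBr !mulmxA addrC.
Qed.

Lemma oof'0P X Y (w : cmap (cshift X) Y) : homotopic w (cmap_zero _ _) <-> bdry (oof' w).
Proof.
rewrite /oof'; split.
  case=> s0 [s1 [h0 h1]].
  (* Here the shift negates the term through the source rather than the one through the target,
     hence the overall minus. *)
  exists (- @blk X Y (mxl (s1 : {linear cx0 X -> cx0 Y})) 0 0 (mxl (s0 : {linear cx1 X -> cx1 Y}))).
  rewrite linearN /= df_blk !mulmx0 !mul0mx !addr0 /blk opp_block_mx !oppr0; congr block_mx.
    apply: (@mx_ext _ (cx0 X)) => u; rewrite opprB mulmxBr !mulmxA -!mxlE.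
    by have := h1 u; rewrite /= subr0 => ->; rewrite linearD; congr (_ + _); rewrite linearN linearN.
  apply: (@mx_ext _ (cx1 X)) => u; rewrite opprB mulmxBr !mulmxA -!mxlE.
  by have := h0 u; rewrite /= subr0 => ->; rewrite linearD; congr (_ + _); rewrite linearN linearN.
case=> w'; have [a [b [c [e ->]]]] := blkP w'; rewrite df_blk => /blk_inj[_ h0 h1 _].
exists (\- @lmx A (cx1 X) (cx1 Y) e), (\- @lmx A (cx0 X) (cx0 Y) a); split=> x; apply: v2r_inj => /=.
  by rewrite subr0 linearD !linearN /= !(lmxE, mxlE) h1 opprK mulmxBr !mulmxA addrC.
by rewrite subr0 linearD !linearN /= !(lmxE, mxlE) h0 opprK mulmxBr !mulmxA addrC.
Qed.

End Morphisms.

(** * Lifting idempotents *)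

Section Fitting.
Variables (A : comNzRingType) (mb : {pred A}).
Let m : A -> Prop := fun a => a \in mb.
Hypotheses (hm : localI m) (complete : adically_complete mb).

Lemma ideal_pow_ideal n : ideal (ideal_pow mb n).
Proof.
case: n => [|n]; first by split.
apply: idealI.
- by exists 0%N, (fun=> 0), (fun=> 0); split=> //; rewrite big_ord0.
- move=> _ _ [k [u [v [h ->]]]] [k' [u' [v' [h' ->]]]].
  exists (k + k')%N, (fun i => if (i < k)%N then u i else u' (i - k)%N),
    (fun i => if (i < k)%N then v i else v' (i - k)%N); split.
    by move=> i ilt; case: ltnP => [/h//|ki]; apply: h'; lia.
  rewrite big_split_ord /=; congr (_ + _); apply: eq_bigr => i _.
    by rewrite ltn_ord.
  by rewrite ltnNge leq_addr /= addKn.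
- move=> a _ [k [u [v [h ->]]]]; exists k, (fun i => a * u i), v; split.
    by move=> i /h[um vm]; split=> //; apply: (idealMl (I := m)) => //; case: hm.
  by rewrite mulr_sumr; apply: eq_bigr => i _; rewrite mulrA.
Qed.

Lemma ideal_powS n a b : m a -> ideal_pow mb n b -> ideal_pow mb n.+1 (a * b).
Proof.
by move=> ma hb; exists 1%N, (fun=> a), (fun=> b); split=> //; rewrite big_ord1.
Qed.

Lemma ideal_pow_dec n : subs (ideal_pow mb n.+1) (ideal_pow mb n).
Proof.
elim: n => // n ih _ [k [u [v [h ->]]]]; apply: (ideal_sum (ideal_pow_ideal _)) => i _.
by have [um /ih vm] := h i (ltn_ord i); apply: ideal_powS.
Qed.

Lemma ideal_pow1 : subs (ideal_pow mb 1) m.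
Proof.
have [mI _ _] := hm; move=> _ [k [u [v [h ->]]]]; apply: (ideal_sum mI) => i _.
by apply: idealMr => //; have [] := h i (ltn_ord i).
Qed.

Lemma modI_powM n p q r (M : 'M[A]_(p, q)) (N : 'M_(q, r)) :
  modI m M -> modI (ideal_pow mb n) N -> modI (ideal_pow mb n.+1) (M *m N).
Proof.
move=> hM hN i j; rewrite mxE; apply: (ideal_sum (ideal_pow_ideal _)) => k _.
exact: ideal_powS.
Qed.

Lemma modI_powX n (M : 'M[A]_n) k : modI m M -> modI (ideal_pow mb k) (M ^+ k).
Proof.
by move=> hM; elim: k => [//|k ih]; rewrite exprS; apply: modI_powM.
Qed.

(** Newton's step for T^2 - T, with 2q - 1 standing in for its inverse: (2q - 1)^2 = 1 + 4 (q^2 - q)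
    is 1 up to the defect. *)
Fixpoint newton (p : {poly A}) (n : nat) : {poly A} :=
  if n is n'.+1 then let q := newton p n' in 3%:R * q ^+ 2 - 2%:R * q ^+ 3 else p.

Lemma newton_defect p n (q := newton p n) :
  newton p n.+1 ^+ 2 - newton p n.+1 = (q ^+ 2 - q) ^+ 2 * (4%:R * (q ^+ 2 - q) - 3%:R).
Proof. by rewrite /= -/q; ring. Qed.

Lemma newton_step p n (q := newton p n) :
  newton p n.+1 - q = (q ^+ 2 - q) * (1 - 2%:R * q).
Proof. by rewrite /= -/q; ring. Qed.

Lemma modI_horner I n (F : 'M[A]_n.+1) (p : {poly A}) : ideal I ->
  (forall i, I p`_i) -> modI I (horner_mx F p).
Proof.
move=> hI hp; rewrite -[p]coefK poly_def rmorph_sum /=; apply: modI_sum => // i _.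
by rewrite linearZ /=; apply: modIcZ.
Qed.

(** The defect is squared at each step, so the iterates converge entrywise. They are polynomials in
    [F], hence commute with whatever commutes with [F]; separatedness passes this to the limit. *)
Lemma lift_idempotent n (F : 'M[A]_n.+1) (p : {poly A}) :
  modI m (horner_mx F (p ^+ 2 - p)) ->
  exists e : 'M_n.+1, [/\ e *m e = e, (forall K : 'M_n.+1, K *m F = F *m K -> K *m e = e *m K)
    & modI m (e - horner_mx F p)].
Proof.
move=> h0; have [mI _ _] := hm; pose q := newton p.
have hq k : modI (ideal_pow mb k.+1) (horner_mx F (q k ^+ 2 - q k)).
  elim: k => [|k ih].
    have := @modI_powM 0 _ _ _ _ (1%:M : 'M_n.+1) h0; rewrite mulmx1; apply.
    by [].
  rewrite /q newton_defect -/(q k); move: ih; set dl := q k ^+ 2 - q k => ih.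
  rewrite rmorphM rmorphXn /= expr2 -!mulmxE.
  apply: (modI_mulr (ideal_pow_ideal k.+2)); apply: (@modI_powM k.+1) => //.
  apply: modI_sub ih; elim: k {dl} => [|k ihk]; first exact: ideal_pow1.
  by move=> a /ideal_pow_dec/ihk.
have hstep k : modI (ideal_pow mb k.+1) (horner_mx F (q k.+1) - horner_mx F (q k)).
  rewrite -rmorphB /= /q newton_step rmorphM /= -mulmxE; apply: (modI_mulr (ideal_pow_ideal k.+1)).
  exact: hq.
have [e he] : exists e : 'M_n.+1, forall k, modI (ideal_pow mb k) (e - horner_mx F (q k)).
  have ex (ij : 'I_n.+1 * 'I_n.+1) : exists a, forall k, ideal_pow mb k (a - horner_mx F (q k) ij.1 ij.2).
    apply: complete.2 => k; apply: ideal_pow_dec.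
    by have := hstep k ij.1 ij.2; rewrite !mxE.
  have [e he] := choice ex; exists (\matrix_(i, j) e (i, j)) => k i j.
  by rewrite !mxE; exact: he (i, j) k.
have sep (M : 'M[A]_n.+1) : (forall k, modI (ideal_pow mb k) M) -> M = 0.
  by move=> h; apply/matrixP => i j; rewrite mxE; apply: complete.1 => k; apply: h.
exists e; split.
- apply/eqP; rewrite -subr_eq0; apply/eqP/sep => k.
  rewrite (_ : _ - e = e *m (e - horner_mx F (q k)) + (e - horner_mx F (q k)) *m horner_mx F (q k)
    - (e - horner_mx F (q k)) + horner_mx F (q k ^+ 2 - q k)).
    have hI := ideal_pow_ideal k; have hek := he k.
    apply: modID => //; last by apply: modI_sub (hq k); apply: ideal_pow_dec.
    by apply: modIB => //; apply: modID => //; [apply: modI_mull | apply: modI_mulr].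
  rewrite rmorphB rmorphXn /= expr2 -[_ * _]/(_ *m _) mulmxBr mulmxBl; mxabel.
- move=> K KF; apply/eqP; rewrite -subr_eq0; apply/eqP/sep => k.
  have Kq : K *m horner_mx F (q k) = horner_mx F (q k) *m K by apply: comm_mx_horner.
  rewrite (_ : _ - _ = K *m (e - horner_mx F (q k)) - (e - horner_mx F (q k)) *m K).
    have hI := ideal_pow_ideal k; have hek := he k.
    by apply: modIB => //; [apply: modI_mull | apply: modI_mulr].
  by rewrite mulmxBr mulmxBl Kq; mxabel.
- rewrite (_ : _ - _ = (e - horner_mx F (q 1%N)) + (horner_mx F (q 1%N) - horner_mx F (q 0%N))).
    by apply: modID => //; [apply: modI_sub (he 1%N) | apply: modI_sub (hstep 0%N)]; apply: ideal_pow1.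
  by rewrite addrA subrK.
Qed.

(* Modulo m the characteristic polynomial is T^k q with q(0) a unit; as
   1 = b q - T q1, the element (- T q1)^(k+1) is idempotent modulo T^k q. *)
Lemma fitting_idempotent n (F : 'M[A]_n) :
  exists (e : 'M_n) (k : nat) (v : 'M_n),
    [/\ e *m e = e, (forall K : 'M_n, K *m F = F *m K -> K *m e = e *m K),
        (forall K : 'M_n, K *m F = F *m K -> K *m v = v *m K),
        modI m (F ^+ k *m (1%:M - e)) & modI m (e - F *m v)].
Proof.
case: n F => [|n] F.
  exists 0, 0%N, 0; split=> [||||[]//]; rewrite ?mulmx0 // ?mulmx1; last by case.
  - by move=> K _; rewrite mulmx0 mul0mx.
  - by move=> K _; rewrite mulmx0 mul0mx.
have [mI m1 mu] := hm.
pose c := char_poly F; have mc : c \is monic by apply: char_poly_monic.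
have ex : exists k, `[< ~ m c`_k >].
  exists n.+1; apply/asboolP; have := monicP mc; rewrite lead_coefE size_char_poly /= => ->.
  exact: m1.
pose k := ex_minn ex.
have [mk kmin] : ~ m c`_k /\ forall i, (i < k)%N -> m c`_i.
  rewrite /k; case: ex_minnP => l /asboolP nl lmin; split=> // i il.
  by apply: contrapT => ni; have := lmin i; rewrite leqNgt il => h; have : false by apply/h/asboolP.
pose r := take_poly k c; pose q := drop_poly k c.
have ec : r + q * 'X^k = c by apply: poly_take_drop.
have [b eb] := mu _ mk.
pose q1 := drop_poly 1 q.
have eq1 : q = (c`_k)%:P + q1 * 'X.
  rewrite -[LHS](poly_take_drop 1 q) expr1; congr (_ + _).
  apply/polyP => i; rewrite coef_take_poly coefC coef_drop_poly.
  by case: i => [|i] /=; rewrite ?addn0.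
pose y : {poly A} := - (b%:P * q1).
have e1 : b%:P * q + 'X * y = 1.
  rewrite eq1 /y mulrDr -polyCM [b * _]mulrC eb; ring.
(* The exponent k + 1 makes p divisible by T^k, and modulo m the idempotent is then F times a
   polynomial in F even when k = 0. *)
pose p := ('X * y) ^+ k.+1.
have [w ew] : exists w, 1 - p = q * w.
  exists (b%:P * \sum_(i < k.+1) 1 ^+ (k.+1.-1 - i) * ('X * y) ^+ i).
  rewrite -{1}(expr1n _ k.+1) /p subrXX mulrA; congr (_ * _).
  by rewrite -{1}e1 addrK mulrC.
have pE : p = 'X^k * ('X * y ^+ k.+1) by rewrite /p exprMn [_ ^+ k.+1]exprS mulrA ['X^k * _]mulrC.
have Rr : modI m (horner_mx F r).
  apply: modI_horner => // i; rewrite coef_take_poly; case: ltnP => [/kmin//|_].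
  exact: ideal0.
have Rq : modI m (horner_mx F (q * 'X^k)).
  have := Cayley_Hamilton F; rewrite -/c -ec rmorphD /= => /eqP.
  by rewrite addrC addr_eq0 => /eqP ->; apply: modIN.
have Rqw z : modI m (horner_mx F (q * 'X^k * z)).
  by rewrite rmorphM -mulmxE; apply: modI_mulr.
have [|e [ee eK ep]] := @lift_idempotent n F p.
  rewrite (_ : _ - p = q * 'X^k * (- w * 'X * y ^+ k.+1)); first exact: Rqw.
  rewrite (_ : p ^+ 2 - p = - (1 - p) * p); last by ring.
  by rewrite ew pE mulNr -!mulrA !mulNr !mulrN [w * _]mulrCA.
exists e, k, (horner_mx F ('X^k * y ^+ k.+1)); split=> //.
- by move=> K KF; apply: comm_mx_horner.
- rewrite (_ : _ *m _ = F ^+ k *m (1%:M - horner_mx F p) - F ^+ k *m (e - horner_mx F p)).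
    apply: modIB => //; last exact: modI_mull.
    rewrite (_ : _ *m _ = horner_mx F (q * 'X^k * w)) // -mulrA [_ * w]mulrC mulrA -ew mulrC.
    by rewrite rmorphM /= [horner_mx F (1 - p)]rmorphB /= [horner_mx F 1]rmorph1 [horner_mx F 'X^k]rmorphXn /= horner_mx_X.
  by rewrite -mulmxBr; congr (_ *m _); mxabel.
- rewrite (_ : F *m _ = horner_mx F p) //.
  by rewrite pE mulrCA [RHS]rmorphM /= horner_mx_X.
Qed.

End Fitting.

(** * Splitting idempotent matrices over a local ring *)

Section IdempotentSplitting.
Variables (A : comNzRingType) (m : A -> Prop) (hm : localI m).

Definition splits n (e : 'M[A]_n) : Prop :=
  exists r (i : 'M_(r, n)) (p : 'M_(n, r)), p *m i = e /\ i *m p = 1%:M.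

Lemma splits_conj n (e f g g' : 'M[A]_n) : g' *m g = 1%:M -> g *m g' = 1%:M ->
  e = g' *m f *m g -> splits f -> splits e.
Proof.
move=> g1 g2 -> [r [i [p [<- ip]]]]; exists r, (i *m g), (g' *m p); split.
  by rewrite !mulmxA.
by rewrite mulmxA -[i *m g *m g']mulmxA g2 mulmx1.
Qed.

(* Projective modules over a local ring are free. *)
Lemma idempotent_splits n (e : 'M[A]_n) : e *m e = e -> splits e /\ splits (1%:M - e).
Proof.
have [mI m1 mu] := hm.
elim: n e => [|n ih] e ee.
  have tr (f : 'M[A]_0) : splits f.
    by exists 0%N, 1%:M, f; split; apply/matrixP; case.
  by split.
(* One of e and 1 - e has a unit in the corner, and the claim is symmetric in the two. *)
suff key (f : 'M[A]_n.+1) : f *m f = f -> ~ m (f 0 0) -> splits f /\ splits (1%:M - f).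
  case: (pselect (m (e 0 0))) => me; last exact: key.
  have [||h1 h2] := key (1%:M - e) _ _.
  - by rewrite mulmxBl mul1mx mulmxBr mulmx1 ee; mxabel.
  - rewrite !mxE eqxx => h; apply: m1; rewrite -[1](subrK (e 0 0)); exact: idealD.
  by split=> //; rewrite -[e](subKr 1%:M).
clear e ee; move: f; rewrite -[n.+1]/(1 + n)%N => e ee ne.
pose a := ulsubmx e; pose b := ursubmx e; pose c := dlsubmx e; pose d := drsubmx e.
have eE : e = block_mx a b c d by rewrite submxK.
have a00 : a 0 0 = e 0 0 by rewrite !mxE; congr (e _ _); apply: val_inj.
have [t et] := mu _ ne.
have aE : a = (e 0 0)%:M by rewrite [a]mx11_scalar a00.
have ee' := ee; move: ee; rewrite eE mulmx_block => /eq_block_mx[e1 e2 e3 e4].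
(* The first row (a b) of e satisfies (a b) e = (a b), so using it as a basis vector makes e block
   lower triangular; [k] then clears the lower left block. *)
pose g : 'M_(1 + n) := block_mx a b 0 1%:M.
pose g' : 'M_(1 + n) := block_mx t%:M (- (t *: b)) 0 1%:M.
have gg' : g *m g' = 1%:M.
  rewrite mulmx_block !(mulmx0, mul0mx, mulmx1, mul1mx, addr0, add0r) aE -scalar_mxM et.
  by rewrite mul_scalar_mx scalerN scalerA et scale1r addNr -scalar_mx_block.
have g'g : g' *m g = 1%:M.
  rewrite mulmx_block !(mulmx0, mul0mx, mulmx1, mul1mx, addr0, add0r) aE -scalar_mxM mulrC et.
  by rewrite mul_scalar_mx addrN -scalar_mx_block.
pose c2 := t *: c; pose d2 := d - c2 *m b.
pose M : 'M_(1 + n) := block_mx 1%:M 0 c2 d2.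
have ge : g *m e = M *m g.
  rewrite eE /M !mulmx_block !(mulmx0, mul0mx, mulmx1, mul1mx, addr0, add0r) e1 e2.
  rewrite /d2 /c2 aE mul_mx_scalar scalerA et scale1r.
  by rewrite [_ *m b + _]addrC subrK.
have MM : M *m M = M.
  have Me : M = g *m e *m g' by rewrite ge -mulmxA gg' mulmx1.
  rewrite Me -!mulmxA [g' *m (g *m _)]mulmxA g'g mul1mx.
  by rewrite [e *m (e *m _)]mulmxA ee'.
move: MM; rewrite /M mulmx_block !(mulmx0, mul0mx, mulmx1, mul1mx, addr0, add0r).
case/eq_block_mx => _ _ /eqP; rewrite -subr_eq0 addrAC subrr add0r => /eqP dc dd.
pose k : 'M_(1 + n) := block_mx 1%:M 0 (- c2) 1%:M.
pose k' : 'M_(1 + n) := block_mx 1%:M 0 c2 1%:M.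
pose D : 'M_(1 + n) := block_mx 1%:M 0 0 d2.
have kk' : k *m k' = 1%:M.
  rewrite mulmx_block !(mulmx0, mul0mx, mulmx1, mul1mx, addr0, add0r) addNr.
  by rewrite -scalar_mx_block.
have k'k : k' *m k = 1%:M.
  rewrite mulmx_block !(mulmx0, mul0mx, mulmx1, mul1mx, addr0, add0r) addrN.
  by rewrite -scalar_mx_block.
have ek : M = k' *m D *m k.
  rewrite !mulmx_block !(mulmx0, mul0mx, mulmx1, mul1mx, addr0, add0r).
  by rewrite mulmxN dc oppr0 addr0.
have eg : e = g' *m M *m g by rewrite -mulmxA -ge mulmxA g'g mul1mx.
have ek' : 1%:M - M = k' *m (1%:M - D) *m k by rewrite mulmxBr mulmxBl mulmx1 k'k -ek.
have eg' : 1%:M - e = g' *m (1%:M - M) *m g by rewrite mulmxBr mulmxBl mulmx1 g'g -eg.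
have [[r [i [p [pi ip]]]] [r' [i' [p' [pi' ip']]]]] := ih d2 dd.
rewrite -eE; split.
  apply: (splits_conj g'g gg' eg); apply: (splits_conj k'k kk' ek).
  exists (1 + r)%N, (block_mx 1%:M 0 0 i), (block_mx 1%:M 0 0 p).
  rewrite !mulmx_block !(mulmx0, mul0mx, mulmx1, mul1mx, addr0, add0r) pi ip.
  by rewrite -scalar_mx_block.
apply: (splits_conj g'g gg' eg'); apply: (splits_conj k'k kk' ek').
exists r', (row_mx 0 i'), (col_mx 0 p'); split; last by rewrite mul_row_col mulmx0 add0r.
rewrite mul_col_row !mulmx0 !mul0mx pi' scalar_mx_block opp_block_mx add_block_mx.
by rewrite !subrr.
Qed.

End IdempotentSplitting.

(** * Finite length cohomology *)

Section FiniteLength.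
Local Open Scope quotient_scope.
Variables (A : comNzRingType) (m : A -> Prop) (d : nat) (x : 'I_d -> A).
Hypotheses (nA : noeth A^o) (hm : localI m) (xreg : regular_system x).
Hypotheses (mE : m = powI x xpredT (fun=> 1%N)).

Lemma submod_pred (V : lmodType A) (S : V -> Prop) : submod S ->
  submod_closed [pred v | `[< S v >]].
Proof.
move=> hS; split; first by rewrite inE; apply/asboolP; apply: submod0.
by move=> a u v; rewrite !inE => /asboolP su /asboolP sv; apply/asboolP; apply: hS.2.
Qed.

Lemma pred_submod (V : lmodType A) (S : {pred V}) : submod_closed S ->
  submod (fun v => v \in S : Prop).
Proof. by case=> h0 h; split=> // a u v; apply: h. Qed.

(** c kills each factor of a composition series: otherwise c S_(i+1) + S_i is all of S_(i+1), and a
    generator w of the factor satisfies w = a c w modulo S_i, although 1 - a c is a unit. *)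
Lemma finite_length_kill (V : lmodType A) : finite_length V ->
  exists n, forall c, m c -> forall v : V, c ^+ n *: v = 0.
Proof.
move=> [n [S [hS S0 Sn inc simple]]]; exists n => c mc v.
suff key i : (i <= n)%N -> forall u, u \in S i -> c ^+ i *: u = 0 by apply: key; rewrite // Sn.
elim: i => [_ u|i ih ilt u uS]; first by rewrite S0 inE => /eqP ->; rewrite scaler0.
have h1 := pred_submod (hS i (ltnW ilt)); have h2 := pred_submod (hS i.+1 ilt).
have [s12 ns] := inc i ilt; rewrite exprSr -scalerA; apply: ih; first exact: ltnW.
have [w wS nw] : exists2 w, w \in S i.+1 & w \notin S i.
  apply: contrapT => no; apply: ns => w wS; apply: contrapT => /negP nw.
  by apply: no; exists w.
pose T1 y := exists u s, [/\ u \in S i.+1, s \in S i & y = c *: u + s].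
have hT1 : submod T1.
  split; first by exists 0, 0; rewrite scaler0 addr0; split=> //; [apply: (submod0 h2) | apply: (submod0 h1)].
  move=> a _ _ [u1 [s1 [hu1 hs1 ->]]] [u2 [s2 [hu2 hs2 ->]]].
  exists (a *: u1 + u2), (a *: s1 + s2); split; [exact: h2.2 | exact: h1.2 |].
  by rewrite !scalerDr !scalerA [c * a]mulrC addrACA.
pose T2 y := exists a s, s \in S i /\ y = a *: w + s.
have hT2 : submod T2.
  split; first by exists 0, 0; rewrite scale0r addr0; split=> //; apply: (submod0 h1).
  move=> a _ _ [a1 [s1 [hs1 ->]]] [a2 [s2 [hs2 ->]]].
  exists (a * a1 + a2), (a *: s1 + s2); split; first exact: h1.2.
  by rewrite scalerDr scalerA scalerDl addrACA.
have [||e|e] := simple i _ ilt (submod_pred hT2).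
- by move=> y yS; rewrite inE; apply/asboolP; exists 0, y; rewrite scale0r add0r.
- move=> y; rewrite inE => /asboolP[a [s [hs ->]]].
  by apply: (submodD h2); [apply: (submodZ h2) | apply: s12].
- have : w \in [pred v | `[< T2 v >]].
    rewrite inE; apply/asboolP; exists 1, 0; rewrite scale1r addr0; split=> //.
    exact: (submod0 h1).
  by rewrite e (negPf nw).
have [||e'|e'] := simple i _ ilt (submod_pred hT1).
- by move=> y yS; rewrite inE; apply/asboolP; exists 0, y; rewrite scaler0 add0r; split=> //; apply: (submod0 h2).
- move=> y; rewrite inE => /asboolP[u1 [s1 [hu hs ->]]].
  by apply: (submodD h2); [apply: (submodZ h2) | apply: s12].
- rewrite -e' inE; apply/asboolP; exists u, 0; rewrite addr0; split=> //.
  exact: (submod0 h1).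
have : w \in [pred v | `[< T1 v >]] by rewrite e'.
rewrite inE => /asboolP[u1 [s1 [hu hs ew]]].
have : u1 \in [pred v | `[< T2 v >]] by rewrite e.
rewrite inE => /asboolP[a [s2 [hs2 eu]]].
apply: contraNT nw => _; have [mI m1 _] := hm.
apply: (localI_sat hm h1 (s := 1 - a * c)).
  move=> h; apply: m1; rewrite -[1](subrK (a * c)); apply: idealD => //.
  exact: idealMl.
have {}ew : w = (a * c) *: w + (c *: s2 + s1).
  by rewrite {1}ew eu scalerDr scalerA [c * a]mulrC addrA.
rewrite scalerBl scale1r {1}ew addrC addKr.
by apply: (submodD h1) => //; apply: (submodZ h1).
Qed.

(** Noetherian induction builds the series from the top: below the series of a larger submodule,
    insert [S], where the larger one adjoins to [S] a socle element modulo [S]. *)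
Lemma kill_finite_length (V : lmodType A) (e : nat) : noeth V ->
  (forall i (v : V), x i ^+ e *: v = 0) -> finite_length V.
Proof.
move=> nV hk.
pose series (S : V -> Prop) := exists (n : nat) (C : nat -> V -> Prop), [/\
    forall i, (i <= n)%N -> submod (C i), C 0%N = S, C n = (fun=> True) &
    forall i, (i < n)%N -> [/\ subs (C i) (C i.+1), ~ subs (C i.+1) (C i) &
      forall T : V -> Prop, submod T -> subs (C i) T -> subs T (C i.+1) -> T = C i \/ T = C i.+1]].
suff [n [C [hC C0 Cn inc]]] : series (fun v => v = 0).
  exists n, (fun i => [pred v | `[< C i v >]] : {pred V}); split.
  - by move=> i /hC; apply: submod_pred.
  - move=> v; rewrite !inE C0; apply/asboolP/eqP => //.
  - by move=> v; rewrite !inE Cn; apply/asboolP.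
  - move=> i /inc[s12 ns _]; split=> [v|h]; rewrite ?inE.
      by move=> /asboolP/s12 h; apply/asboolP.
    apply: ns => v Cv; have := h v; rewrite !inE => /(_ _)/asboolP; apply.
    exact/asboolP.
  - move=> i T /inc[_ _ simple] hT s1 s2.
    have [||e1|e1] := simple _ (pred_submod hT).
    + by move=> v Cv; apply: s1; rewrite inE; apply/asboolP.
    + by move=> v /s2; rewrite inE => /asboolP.
    + left=> v; rewrite inE -e1; apply/idP/asboolP => //.
    + right=> v; rewrite inE -e1; apply/idP/asboolP => //.
have h0 : submod (fun v : V => v = 0).
  by split=> // a u v -> ->; rewrite scaler0 addr0.
apply: (fun h => @noeth_ind A V series nV h _ h0) => S hS IH.
case: (pselect (forall v, S v)) => [Sall|].
  exists 0%N, (fun=> S); split=> //.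
  by apply: funext => v; apply: propext; split.
move=> /existsNP[v0 nv0].
have [|c [nc hc]] := socle_elt (x := x) (a := fun=> e) hS _ nv0.
  by move=> i; rewrite hk; apply: (submod0 hS).
set v := c *: v0 in nc hc.
pose T y := exists s a, S s /\ y = s + a *: v.
have hT : submod T.
  split; first by exists 0, 0; rewrite scale0r addr0; split=> //; apply: (submod0 hS).
  move=> a _ _ [s1 [a1 [hs1 ->]]] [s2 [a2 [hs2 ->]]].
  exists (a *: s1 + s2), (a * a1 + a2); split; first exact: hS.2.
  by rewrite scalerDr scalerA scalerDl addrACA.
have ST : subs S T by move=> y Sy; exists y, 0; rewrite scale0r addr0.
have Tv : T v by exists 0, 1; rewrite scale1r add0r; split=> //; apply: (submod0 hS).
have [//|n [C [hC C0 Cn inc]]] := IH T hT ST _; first by exists v.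
exists n.+1, (fun i => if i is i'.+1 then C i' else S); split=> //.
  by case=> // i; apply: hC.
case=> [_|i]; last exact: inc.
rewrite C0; split=> //; first by move=> h; apply: nc; apply: h.
move=> U hU SU UT; case: (pselect (subs U S)) => [US|nUS].
  by left; apply: funext => y; apply: propext; split; [apply: US | apply: SU].
right; apply: funext => y; apply: propext; split; first exact: UT.
have Uv : U v.
  have [u Uu nSu] : exists2 u, U u & ~ S u.
    by apply: contrapT => no; apply: nUS => u Uu; apply: contrapT => nSu; apply: no; exists u.
  have [s [a [Ss eu]]] := UT u Uu.
  case: (pselect (m a)) => ma.
    case: nSu; rewrite eu; apply: (submodD hS) => //.
    exact: (m_act mE).
  apply: (localI_sat hm hU ma); rewrite (_ : a *: v = u - s); last by rewrite eu addrC addKr.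
  by apply: (submodB hU) => //; apply: SU.
by move=> [s [a [Ss ->]]]; apply: (submodD hU); [apply: SU | apply: (submodZ hU)].
Qed.

End FiniteLength.

(** * Annihilators of cohomology *)

Section Cohomology.
Local Open Scope quotient_scope.
Variables (A : comNzRingType) (U V W : lmodType A).
Variables (f : {linear U -> V}) (g : {linear V -> W}).

Let pi (z : cocycle g) : cohomology f g :=
  \pi_(Quotient.quot (@coboundary_pred A U V W f g)) z.

Let pi_linear : linear pi.
Proof.
move=> a u v; rewrite /pi lmod_quot_pi_add; congr (_ + _).
by rewrite /GRing.scale /= lmod_quot_scaleE.
Qed.

Let pi_ex q : exists z, q = pi z.
Proof. by elim/lmod_quot_ind: q => z; exists z. Qed.

Let pi_eq0 z : pi z = 0 <-> exists u, cocycle_val z = f u.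
Proof.
have -> : 0 = pi 0 by have := pi_linear (-1) 0 0; rewrite scaler0 addr0 scaleN1r addNr.
split=> [/eqP|h].
  by rewrite /pi -Quotient.idealrBE subr0 inE => /asboolP.
by apply/eqP; rewrite /pi -Quotient.idealrBE subr0 inE; apply/asboolP.
Qed.

Lemma cohomology_kill c : (forall q : cohomology f g, c *: q = 0) <->
  (forall v, g v = 0 -> exists u, c *: v = f u).
Proof.
have piZ z : c *: pi z = pi (c *: z).
  have pi0 : pi 0 = 0 by have := pi_linear (-1) 0 0; rewrite scaler0 addr0 scaleN1r addNr.
  by have := pi_linear c z 0; rewrite pi0 !addr0.
split=> [h v gv|h q].
  have vP : v \in cocycle_pred g by rewrite inE gv.
  have := h (pi (Cocycle vP)); rewrite piZ => /pi_eq0[u e]; exists u.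
  by rewrite -e.
have [z ->] := pi_ex q; rewrite piZ; apply/pi_eq0.
by have /eqP := cocycleP z; rewrite /= => gz; have [u e] := h _ gz; exists u; rewrite -e.
Qed.

Lemma noeth_sub (M N : lmodType A) (h : M -> N) : linear h -> injective h -> noeth N -> noeth M.
Proof.
move=> hl hi nN S hS.
have h0 : h 0 = 0 by have := hl (-1) 0 0; rewrite scaler0 addr0 scaleN1r addNr.
have [|n [y [yS gen]]] := nN (fun v => exists2 w, S w & h w = v).
  split; first by exists 0 => //; apply: (submod0 hS).
  move=> a _ _ [u Su <-] [v Sv <-]; exists (a *: u + v); last by rewrite hl.
  exact: hS.2.
have [i|t ht] := @choice 'I_n _ (fun i w => S w /\ h w = y i).
  by have [w Sw e] := yS i (ltn_ord i); exists w.
pose t' (i : nat) := if insub i is Some j then t j else 0.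
exists n, t'; split=> [i ilt|w Sw].
  by rewrite /t' insubT; apply: (ht _).1.
have [|c e] := gen (h w); first by exists w.
exists c; apply: hi; rewrite e.
have hs (r : seq 'I_n) (F : 'I_n -> M) : h (\sum_(i <- r) F i) = \sum_(i <- r) h (F i).
  elim: r => [|i r ih]; first by rewrite !big_nil.
  by rewrite !big_cons -ih -[F i]scale1r hl !scale1r.
rewrite hs; apply: eq_bigr => i _; rewrite /t' valK.
by have := hl (c i) (t i) 0; rewrite h0 !addr0 => ->; rewrite (ht i).2.
Qed.

Lemma noeth_cohomology : noeth V -> noeth (cohomology f g).
Proof.
move=> nV; have nZ : noeth (cocycle g).
  by apply: (@noeth_sub _ _ (@cocycle_val A V W g)) nV => // z z' e; apply: val_inj.
pose pil : {linear cocycle g -> cohomology f g} :=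
  HB.pack pi (GRing.isLinear.Build _ _ _ _ pi pi_linear).
have [s hs] := choice pi_ex.
by apply: (@noeth_image A _ _ pil s _ nZ) => q; rewrite /pil /= -hs.
Qed.

End Cohomology.

(** * Finite length and null-homotopic multiplications *)

Section Torsion.
Variables (A : comNzRingType) (m : A -> Prop) (d : nat) (x : 'I_d -> A).
Hypotheses (nA : noeth A^o) (hm : localI m) (xreg : regular_system x).
Hypotheses (mE : m = powI x xpredT (fun=> 1%N)).

Definition killsH c (X : cplx A) : Prop :=
  (forall u, dif0 X u = 0 -> exists v, c *: u = dif1 X v) /\
  (forall u, dif1 X u = 0 -> exists v, c *: u = dif0 X v).

Lemma noeth_vect (V : vectType A) : noeth V.
Proof. by apply: (@noeth_image A _ _ r2v v2r v2rK); apply: noeth_row. Qed.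

Lemma nullh_mono Z c e f : (e <= f)%N -> nullh Z (c ^+ e) -> nullh (A := A) Z (c ^+ f).
Proof.
move=> /subnK <- [h [sh eh]]; exists (c ^+ (f - e) *: h).
rewrite linearZ /= sh scalerN; split=> //.
by rewrite -scalemxAr -scalemxAl -scalerDr eh scale_scalar_mx exprD.
Qed.

Lemma in_Kf_killsH X : in_Kf X <-> exists e, forall i, killsH (x i ^+ e) X.
Proof.
split.
  case=> /(finite_length_kill hm)[n0 h0] /(finite_length_kill hm)[n1 h1].
  exists (maxn n0 n1) => i; have mx := mem_gen mE i; split=> u du.
    have [v ev] := (cohomology_kill _ _ _).1 (h0 _ mx) u du.
    exists (x i ^+ (maxn n0 n1 - n0) *: v); rewrite linearZ /= -ev scalerA -exprD subnK //.
    exact: leq_maxl.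
  have [v ev] := (cohomology_kill _ _ _).1 (h1 _ mx) u du.
  exists (x i ^+ (maxn n0 n1 - n1) *: v); rewrite linearZ /= -ev scalerA -exprD subnK //.
  exact: leq_maxr.
case=> e he; split.
  apply: (kill_finite_length hm mE (e := e)); first exact/noeth_cohomology/noeth_vect.
  by move=> i; apply/cohomology_kill; have [] := he i.
apply: (kill_finite_length hm mE (e := e)); first exact/noeth_cohomology/noeth_vect.
by move=> i; apply/cohomology_kill; have [] := he i.
Qed.

Lemma nullh_killsH c X : nullh (toG X) c -> killsH c X.
Proof.
move=> [h [_]]; have [h00 [h0 [h1 [h11 ->]]]] := blkP h.
rewrite gD_blk !blkM /blk add_block_mx.
rewrite (_ : c%:M = block_mx c%:M 0 0 c%:M); last exact: scalar_mx_block.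
case/eq_block_mx; rewrite !mul0mx !mulmx0 !add0r !addr0 => e0 _ _ e1.
split=> u du.
  exists (lmx h0 u); apply: v2r_inj; rewrite mxlE lmxE linearZ /= -mul_mx_scalar -e0.
  by rewrite mulmxDr mulmxA -mxlE du linear0 mul0mx add0r mulmxA.
exists (lmx h1 u); apply: v2r_inj; rewrite mxlE lmxE linearZ /= -mul_mx_scalar -e1.
by rewrite mulmxDr mulmxA -mxlE du linear0 mul0mx add0r mulmxA.
Qed.

(* [resolution_splits] applies to a resolution of the cokernel of a
   differential, which is finite since A is regular. *)
Lemma killsH_nullh c X : killsH c X -> exists e, nullh (toG X) (c ^+ e).
Proof.
move=> [k0 k1]; pose a := mxl (dif0 X); pose b := mxl (dif1 X).
have ab : a *m b = 0 := mxl01 X; have ba : b *m a = 0 := mxl10 X.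
have exa : almost_exact c a b.
  move=> v vb; have [|w ew] := k1 (r2v v); first by apply: v2r0; rewrite mxlE r2vK.
  by exists (v2r w); rewrite -mxlE -ew linearZ /= r2vK.
have exb : almost_exact c b a.
  move=> v va; have [|w ew] := k0 (r2v v); first by apply: v2r0; rewrite mxlE r2vK.
  by exists (v2r w); rewrite -mxlE -ew linearZ /= r2vK.
have [n res] := finite_resolution nA hm xreg mE.
have e1 : a *m 1%:M = 1%:M *m a by rewrite mulmx1 mul1mx.
have e2 : 1%:M *m a = 1 *: (a *m 1%:M) by rewrite scale1r e1.
have e3 : (1%:M : 'M[A]_(dim (cx0 X))) *m 1%:M = (c ^+ 0)%:M + (0 : 'M_(_, dim (cx1 X))) *m b + a *m 0.
  by rewrite mulmx1 mul0mx mulmx0 !addr0.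
have [e [h0 [h1 [q0 q1]]]] : exists e (h0 : 'M_(dim (cx0 X), dim (cx1 X))) (h1 : 'M_(dim (cx1 X), dim (cx0 X))),
    (c ^+ e)%:M = a *m h1 + h0 *m b /\ (c ^+ e)%:M = b *m h0 + h1 *m a.
  case: (resolution_splits ab ba exa exb (res _ _ a) e1 e2 e3) => -[e [s es]].
    exact: (split_homotopy ab ba exa exb es).
  have [E [h1 [h0 [q1 q0]]]] := split_homotopy ba ab exb exa es.
  by exists E, h0, h1.
exists e, (blk 0 h0 h1 0); split; first by rewrite sg_blk /blk opp_block_mx !oppr0.
rewrite gD_blk !blkM /blk add_block_mx !mul0mx !mulmx0 !add0r !addr0 -/a -/b -q0 -q1.
by rewrite -scalar_mx_block.
Qed.

Lemma in_Kf_torsion X : in_Kf X <-> torsion x (toG X).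
Proof.
rewrite in_Kf_killsH; split=> [[e he]|[e he]]; last by exists e => i; apply: nullh_killsH.
have [f hf] := choice (fun i => killsH_nullh (he i)).
(* [e] kills the cohomology, [f i] is the further power needed for a contraction, and the maximum
   makes it independent of i. *)
exists (e * \max_i f i)%N => i; apply: (@nullh_mono _ _ (e * f i)%N); last by rewrite exprM.
by rewrite leq_mul2l leq_bigmax orbT.
Qed.

End Torsion.

(** * Triangles *)

Section Isomorphisms.
Variable A : comNzRingType.
Implicit Types (X Y Z : cplx A).

Lemma homotopic_eq X Y (f g : cmap X Y) : map0 f =1 map0 g -> map1 f =1 map1 g -> homotopic f g.
Proof.
move=> e0 e1; exists (\0), (\0); split=> x; rewrite /= ?e0 ?e1 subrr linear0.
  by rewrite addr0.
by rewrite addr0.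
Qed.

Lemma strict_iso X Y (f : cmap X Y) (g : cmap Y X) :
  cancel (map0 f) (map0 g) -> cancel (map1 f) (map1 g) ->
  cancel (map0 g) (map0 f) -> cancel (map1 g) (map1 f) -> is_iso f.
Proof. by move=> *; exists g; split; apply: homotopic_eq. Qed.

Lemma isoM_comp X Y Z (f : cmap X Y) (g : cmap Y Z) : is_iso f -> is_iso g -> is_iso (cmap_comp g f).
Proof.
rewrite !is_isoP mof_comp => -[f' [cf' f1 f2]] [g' [cg' g1 g2]].
have cf := mof_cyc f; have cg := mof_cyc g.
exists (g' *m f'); split; first exact: (cycM cg' cf').
  rewrite (_ : _ - _ = mof f *m ((mof g *m g' - 1%:M) *m f') + (mof f *m f' - 1%:M)).
    by apply: bdryD => //; apply: (cyc_bdryl cf); apply: (cyc_bdryr cf').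
  by rewrite mulmxBl mul1mx mulmxBr !mulmxA; mxabel.
rewrite (_ : _ - _ = g' *m ((f' *m mof f - 1%:M) *m mof g) + (g' *m mof g - 1%:M)).
  by apply: bdryD => //; apply: (cyc_bdryl cg'); apply: (cyc_bdryr cg).
by rewrite mulmxBl mul1mx mulmxBr !mulmxA; mxabel.
Qed.

Lemma isomorphic_trans X Y Z : isomorphic X Y -> isomorphic Y Z -> isomorphic X Z.
Proof. by move=> [f hf] [g hg]; exists (cmap_comp g f); apply: isoM_comp. Qed.

Lemma homotopic_cshift X Y (f g : cmap X Y) : homotopic f g -> homotopic (cshift_map f) (cshift_map g).
Proof.
move=> [s0 [s1 [h0 h1]]]; exists (\- s1), (\- s0); split=> x /=.
  by rewrite h1 linearN opprK linearN opprK.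
by rewrite h0 linearN opprK linearN opprK.
Qed.

Lemma cshift_map_iso X Y (f : cmap X Y) : is_iso f -> is_iso (cshift_map f).
Proof.
move=> [g [/homotopic_cshift h1 /homotopic_cshift h2]]; exists (cshift_map g).
by split.
Qed.

Lemma isomorphic_cshift X Y : isomorphic X Y -> isomorphic (cshift X) (cshift Y).
Proof. by move=> [f hf]; exists (cshift_map f); apply: cshift_map_iso. Qed.

Program Definition cshift2 X : cmap (cshift (cshift X)) X :=
  @CMap A (cshift (cshift X)) X idfun idfun _ _.
Next Obligation. by rewrite opprK. Qed.
Next Obligation. by rewrite opprK. Qed.

Lemma isomorphic_cshift2 X : isomorphic X (cshift (cshift X)).
Proof. by exists (cunshiftK X); apply: (@strict_iso _ _ _ (cshift2 X)). Qed.

Program Definition cshift_dsum X Y : cmap (cshift (dsum X Y)) (dsum (cshift X) (cshift Y)) :=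
  @CMap A (cshift (dsum X Y)) (dsum (cshift X) (cshift Y)) idfun idfun _ _.
Program Definition dsum_cshift X Y : cmap (dsum (cshift X) (cshift Y)) (cshift (dsum X Y)) :=
  @CMap A (dsum (cshift X) (cshift Y)) (cshift (dsum X Y)) idfun idfun _ _.

Lemma isomorphic_cshift_dsum X Y : isomorphic (cshift (dsum X Y)) (dsum (cshift X) (cshift Y)).
Proof. by exists (cshift_dsum X Y); apply: (@strict_iso _ _ _ (dsum_cshift X Y)). Qed.

Lemma is_zero_cshift X : is_zero (cshift X) -> is_zero X.
Proof.
move=> [s0 [s1 [h0 h1]]]; exists (\- s1), (\- s0); split=> x /=.
  by have := h1 x; rewrite /= linearN => ->; rewrite linearN.
by have := h0 x; rewrite /= linearN => ->; rewrite linearN.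
Qed.

Lemma killsH_cshift c X : killsH c X -> killsH c (cshift X).
Proof.
move=> [h0 h1]; split=> u /= /eqP; rewrite oppr_eq0 => /eqP.
  by move=> /h1[v e]; exists (- v); rewrite linearN opprK.
by move=> /h0[v e]; exists (- v); rewrite linearN opprK.
Qed.

Lemma killsH_retract c X Y (f : cmap X Y) (g : cmap Y X) :
  cancel (map0 g) (map0 f) -> cancel (map1 g) (map1 f) -> killsH c X -> killsH c Y.
Proof.
move=> e0 e1 [h0 h1]; split=> u du.
  have [|v ev] := h0 (map0 g u); first by rewrite -cmap0P du linear0.
  by exists (map1 f v); rewrite -cmap1P -ev linearZ /= e0.
have [|v ev] := h1 (map1 g u); first by rewrite -cmap1P du linear0.
by exists (map0 f v); rewrite -cmap0P -ev linearZ /= e1.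
Qed.

(** One factor c is spent on the source and one on the target, as in the long exact sequence of the
    cone. *)
Lemma killsH_cone c X Y (w : cmap X Y) : killsH c X -> killsH c Y -> killsH (c ^+ 2) (cone w).
Proof.
move=> [x0 x1] [y0 y1]; split=> -[p q] [] /= /eqP; rewrite oppr_eq0 => /eqP dp /eqP; rewrite subr_eq0 => /eqP dq.
  have [p' ep] := x1 p dp.
  have [|q' eq] := y0 (c *: q - map0 w p').
    by rewrite linearB linearZ /= dq -cmap0P -ep linearZ /= subrr.
  exists (- (c *: p'), q'); congr pair; rewrite /= linearN linearZ /= opprK.
    by rewrite -ep scalerA.
  by rewrite -eq scalerBr scalerA subrK.
have [p' ep] := x0 p dp.
have [|q' eq] := y1 (c *: q - map1 w p').
  by rewrite linearB linearZ /= dq -cmap1P -ep linearZ /= subrr.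
exists (- (c *: p'), q'); congr pair; rewrite /= linearN linearZ /= opprK.
    by rewrite -ep scalerA.
by rewrite -eq scalerBr scalerA subrK.
Qed.

End Isomorphisms.

(** * Cones and rotation of triangles *)

Section Triangles.
Variable A : comNzRingType.

Lemma is_iso_id (X : cplx A) : is_iso (cmap_id X).
Proof. by apply: (@strict_iso _ _ _ _ (cmap_id X)). Qed.

(* E is the cone itself, followed by X[-1][1] = X. *)
Lemma left_triangle (L M : cplx A) (w : cmap (cunshift L) M) :
  exact_triangle w (cone_in w) (cmap_comp (cunshiftK L) (cmap_comp (cshift2 L) (cone_out w))).
Proof.
exists (cunshift L), M, w, (cmap_id _), (cmap_id _), (cmap_id _); split.
  by split; apply: is_iso_id.
by split; apply: homotopic_eq.
Qed.

Section Rotation.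
Variables (M N : cplx A) (h : cmap M (cshift N)).

Program Definition unshift_map : cmap (cunshift M) N :=
  @CMap A (cunshift M) N (map1 h) (map0 h) _ _.
Next Obligation. by rewrite linearN cmap1P /= opprK. Qed.
Next Obligation. by rewrite linearN cmap0P /= opprK. Qed.

Let E := cone unshift_map.

Program Definition rot_g : cmap E M := @CMap A E M fst fst _ _.
Next Obligation. by rewrite opprK. Qed.
Next Obligation. by rewrite opprK. Qed.

Let f := cone_in unshift_map.

(** The component -h is forced: the last map of a cone triangle is minus the first projection and
    has to give back h. *)
Definition rot_c0 (p : cx0 M) : cx1 N * (cx0 M * cx0 N) := (- map0 h p, (p, 0)).
Definition rot_c1 (p : cx1 M) : cx0 N * (cx1 M * cx1 N) := (- map1 h p, (p, 0)).
Fact rot_c0_linear : linear rot_c0.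
Proof.
move=> a u v; rewrite /rot_c0 linearP opprD -scalerN.
by congr (_, (_, _)); rewrite /= scaler0 addr0.
Qed.
Fact rot_c1_linear : linear rot_c1.
Proof.
move=> a u v; rewrite /rot_c1 linearP opprD -scalerN.
by congr (_, (_, _)); rewrite /= scaler0 addr0.
Qed.
HB.instance Definition _ := GRing.isLinear.Build A _ _ _ rot_c0 rot_c0_linear.
HB.instance Definition _ := GRing.isLinear.Build A _ _ _ rot_c1 rot_c1_linear.

Program Definition rot_c : cmap M (cone f) := @CMap A M (cone f) rot_c0 rot_c1 _ _.
Next Obligation.
rewrite /rot_c1 /rot_c0 /cone_dif0 /= cmap0P /= !opprK; congr (_, _).
  by rewrite linearN opprK.
by congr (_, _) => /=; [rewrite opprK subr0 | rewrite linear0 sub0r opprK addNr].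
Qed.
Next Obligation.
rewrite /rot_c1 /rot_c0 /cone_dif1 /= cmap1P /= !opprK; congr (_, _).
  by rewrite linearN opprK.
by congr (_, _) => /=; [rewrite opprK subr0 | rewrite linear0 sub0r opprK addNr].
Qed.

Program Definition rot_c' : cmap (cone f) M :=
  @CMap A (cone f) M (fst \o snd) (fst \o snd) _ _.
Next Obligation. by rewrite opprK subr0. Qed.
Next Obligation. by rewrite opprK subr0. Qed.

(* The homotopies move the component in N of E to the first component of the
   cone of f. *)
Definition rot_s0 (p : cx0 M * cx0 N) : cx0 N * (cx1 M * cx1 N) := (p.2, 0).
Definition rot_s1 (p : cx1 M * cx1 N) : cx1 N * (cx0 M * cx0 N) := (p.2, 0).
Fact rot_s0_linear : linear rot_s0.
Proof. by move=> a u v; congr (_, (_, _)); rewrite /= scaler0 addr0. Qed.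
Fact rot_s1_linear : linear rot_s1.
Proof. by move=> a u v; congr (_, (_, _)); rewrite /= scaler0 addr0. Qed.
HB.instance Definition _ := GRing.isLinear.Build A _ _ _ rot_s0 rot_s0_linear.
HB.instance Definition _ := GRing.isLinear.Build A _ _ _ rot_s1 rot_s1_linear.

Lemma rot_c_iso : is_iso rot_c.
Proof.
exists rot_c'; split; first by apply: homotopic_eq.
exists (rot_s0 \o snd), (rot_s1 \o snd); split=> -[n' [u v]];
  (apply: injective_projections; [|apply: injective_projections]); rewrite /=.
- by rewrite -addrA addKr.
- by rewrite subrr !(linear0, oppr0, subr0, addr0).
- by rewrite !(linear0, oppr0, subr0, sub0r, addr0).
- by rewrite -addrA addKr.
- by rewrite subrr !(linear0, oppr0, subr0, addr0).
- by rewrite !(linear0, oppr0, subr0, sub0r, addr0).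
Qed.

(** E is the cone of the map M[-1] -> N given by h, but that cone triangle starts at M[-1]. To begin
    at N, it is rotated: the cone of N -> E contracts to M. *)
Lemma right_triangle : exists f g, exact_triangle (N := N) (E := E) (M := M) f g h.
Proof.
exists f, rot_g, N, E, f, (cmap_id N), (cmap_id E), rot_c; split.
  by split; [apply: is_iso_id | apply: is_iso_id | apply: rot_c_iso].
split.
- by apply: homotopic_eq.
- exists rot_s0, rot_s1; split=> -[u v];
    (apply: injective_projections; [|apply: injective_projections]); rewrite /=.
  + by rewrite addKr subr0.
  + by rewrite subrr !(linear0, oppr0, subr0, addr0).
  + by rewrite !(linear0, oppr0, subr0, sub0r, addr0).
  + by rewrite addKr subr0.
  + by rewrite subrr !(linear0, oppr0, subr0, addr0).
  + by rewrite !(linear0, oppr0, subr0, sub0r, addr0).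
by apply: homotopic_eq => u /=; rewrite opprK.
Qed.

End Rotation.
End Triangles.

(** * Indecomposable complexes *)

Section Summand.
Variables (A : comNzRingType) (X : cplx A).
Let a := mxl (dif0 X).
Let b := mxl (dif1 X).

(** The differentials are transported along the splittings. The idempotents commute with them
    strictly, so Y is a retract of X on the nose, not only up to homotopy. *)
Lemma idempotent_summand (e0 : 'M_(dim (cx0 X))) (e1 : 'M_(dim (cx1 X))) :
  a *m e1 = e0 *m a -> b *m e0 = e1 *m b -> splits e0 -> splits e1 ->
  exists (Y : cplx A) (f : cmap X Y) (g : cmap Y X),
    [/\ cancel (map0 g) (map0 f), cancel (map1 g) (map1 f),
        (forall u, v2r (map0 g (map0 f u)) = v2r u *m e0) &
        (forall u, v2r (map1 g (map1 f u)) = v2r u *m e1)].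
Proof.
move=> ae be [r0 [i0 [p0 [pi0 ip0]]]] [r1 [i1 [p1 [pi1 ip1]]]].
have ab : a *m b = 0 := mxl01 X; have ba : b *m a = 0 := mxl10 X.
pose a' := i0 *m a *m p1; pose b' := i1 *m b *m p0.
have ap : a *m p1 = p0 *m a'.
  by rewrite /a' !mulmxA pi0 -ae -pi1 -!mulmxA ip1 mulmx1.
have bp : b *m p0 = p1 *m b'.
  by rewrite /b' !mulmxA pi1 -be -pi0 -!mulmxA ip0 mulmx1.
have ia : i0 *m a = a' *m i1.
  by rewrite /a' -!mulmxA pi1 ae mulmxA -pi0 !mulmxA ip0 mul1mx.
have ib : i1 *m b = b' *m i0.
  by rewrite /b' -!mulmxA pi0 be mulmxA -pi1 !mulmxA ip1 mul1mx.
have ab' : a' *m b' = 0 by rewrite /a' -mulmxA -bp mulmxA -[i0 *m a *m b]mulmxA ab mulmx0 mul0mx.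
have ba' : b' *m a' = 0 by rewrite /b' -mulmxA -ap mulmxA -[i1 *m b *m a]mulmxA ba mulmx0 mul0mx.
have c10 (u : 'rV[A]_r0) : mulmxr b' (mulmxr a' u) = 0 by rewrite /= -mulmxA ab' mulmx0.
have c01 (u : 'rV[A]_r1) : mulmxr a' (mulmxr b' u) = 0 by rewrite /= -mulmxA ba' mulmx0.
pose Y := @Cplx A 'rV[A]_r0 'rV[A]_r1 (mulmxr a') (mulmxr b') c10 c01.
have f0 u : (mulmxr p1 \o v2r) (dif0 X u) = dif0 Y ((mulmxr p0 \o v2r) u).
  by rewrite /= mxlE -!mulmxA ap.
have f1 u : (mulmxr p0 \o v2r) (dif1 X u) = dif1 Y ((mulmxr p1 \o v2r) u).
  by rewrite /= mxlE -!mulmxA bp.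
have g0 u : (r2v \o mulmxr i1) (dif0 Y u) = dif0 X ((r2v \o mulmxr i0) u).
  by apply: v2r_inj; rewrite /= r2vK mxlE r2vK -[LHS]mulmxA -ia mulmxA.
have g1 u : (r2v \o mulmxr i0) (dif1 Y u) = dif1 X ((r2v \o mulmxr i1) u).
  by apply: v2r_inj; rewrite /= r2vK mxlE r2vK -[LHS]mulmxA -ib mulmxA.
exists Y, (@CMap A X Y (mulmxr p0 \o v2r) (mulmxr p1 \o v2r) f0 f1),
  (@CMap A Y X (r2v \o mulmxr i0) (r2v \o mulmxr i1) g0 g1).
split=> u /=; rewrite ?r2vK -?mulmxA ?ip0 ?ip1 ?pi0 ?pi1 ?mulmx1 //.
Qed.

End Summand.

Section KrullSchmidt.
Variables (A : comNzRingType) (mb : {pred A}) (d : nat) (x : 'I_d -> A).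
Let m : A -> Prop := fun a => a \in mb.
Hypotheses (nA : noeth A^o) (hm : localI m) (xreg : regular_system x).
Hypotheses (mE : m = powI x xpredT (fun=> 1%N)) (complete : adically_complete mb).

Notation "''H' ( X , Y )" := 'M[A]_(gdim X, gdim Y) (at level 8, format "''H' ( X ,  Y )").

(** A high power has entries in the ideal of powers of the x_i, and a cocycle that vanishes modulo
    this ideal is a boundary. *)
Lemma cyc_modI_nilpotent X (w : 'H(X, X)) : torsion x X -> cyc false w -> modI m w ->
  exists k, @bdry A X X (w ^+ k).
Proof.
move=> [e he] cw mw.
have hJ := powI_ideal x xpredT (fun=> e).
have [k hk] := @pow_sub A m d x nA mE (powI x xpredT (fun=> e)) (fun=> e) hJ
  (fun i => powI_mem x (fun=> e) (P := xpredT) (i := i) isT) mb erefl.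
exists k; apply: (bdry_mod (a := fun=> e) xreg he (cycX k cw).2).
exists 0; rewrite linear0 subr0; apply: modI_sub hk _.
by apply: (@modI_powX A mb).
Qed.

Lemma cyc_bdry_exp X (q w : 'H(X, X)) k : cyc false q -> cyc false w -> @bdry A X X (q - w) ->
  @bdry A X X (q ^+ k - w ^+ k).
Proof.
move=> cq cw b.
elim: k => [|k ih]; first by rewrite subrr; apply: (submod0 (bdry_submod X X)).
rewrite !exprS (_ : _ - _ = q *m (q ^+ k - w ^+ k) + (q - w) *m w ^+ k).
  by apply: bdryD; [apply: (cyc_bdryl cq) | apply: (cyc_bdryr (cycX k cw))].
by rewrite mulmxBr mulmxBl -!mulmxE; mxabel.
Qed.

(** The Fitting idempotent e commutes with the parity projection and the differential because u
    does, so it is a chain map. If e is null-homotopic, u^k is homotopic to u^k (1 - e), which has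
    entries in m and is nilpotent. If 1 - e is, then 1 - u v is homotopic to e - u v, nilpotent
    likewise, so u is invertible. *)
Lemma indecomposable_local (X : cplx A) : indecomposable X -> localM (toG X).
Proof.
move=> [kX nX dec]; split; first by move=> /is_zeroP.
set G := toG X => u cu.
have tG : torsion x G := (in_Kf_torsion nA hm xreg mE X).1 kX.
have [e [k [v [ee eK vK e1 e2]]]] := fitting_idempotent hm complete u.
have Pu : gP G *m u = u *m gP G by case: cu.
have Du : gD G *m u = u *m gD G.
  by case: cu => pu; rewrite dfE (par_sg pu) scale1r => /eqP; rewrite subr_eq0 => /eqP.
have cyc_comm (w : 'H(G, G)) : gP G *m w = w *m gP G -> gD G *m w = w *m gD G -> cyc false w.
  move=> pw dw; have pw' : par false w by [].
  by split=> //; rewrite dfE (par_sg pw') scale1r dw subrr.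
have ce : cyc false e by apply: cyc_comm; apply: eK.
have cv : cyc false v by apply: cyc_comm; apply: vK.
have c1e : cyc false (1%:M - e) by apply: cycB => //; apply: cyc1.
have ue : u *m e = e *m u by apply: eK.
have uv : u *m v = v *m u by apply: vK.
(* Both idempotents split degreewise, so X is strictly a direct sum of two complexes, one of which
   is zero up to homotopy. *)
have caseE : bdry e \/ bdry (1%:M - e).
  have [e00 [e01 [e10 [e11 eE]]]] := blkP e.
  have [z1 z2] : e01 = 0 /\ e10 = 0 by have := ce.1; rewrite eE => /par_blk.
  rewrite z1 z2 in eE.
  have [q0 _ _ q1] : [/\ e00 *m e00 = e00, True, True & e11 *m e11 = e11].
    move: ee; rewrite eE blkM !mul0mx !mulmx0 !addr0 !add0r => /blk_inj[-> _ _ ->].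
    by split.
  have [ae be] : mxl (dif0 X) *m e11 = e00 *m mxl (dif0 X) /\ mxl (dif1 X) *m e00 = e11 *m mxl (dif1 X).
    have := ce.2; rewrite eE df_blk blk0 => /blk_inj[_ /eqP h1 /eqP h2 _].
    by move: h1 h2; rewrite !subr_eq0 => /eqP -> /eqP ->.
  have [s0 s0'] := idempotent_splits hm q0; have [s1 s1'] := idempotent_splits hm q1.
  have [Y [fY [gY [Y0 Y1 YE0 YE1]]]] := idempotent_summand ae be s0 s1.
  have [||Z [fZ [gZ [Z0 Z1 ZE0 ZE1]]]] := idempotent_summand _ _ s0' s1'.
  - by rewrite mulmxBr mulmxBl ae mulmx1 mul1mx.
  - by rewrite mulmxBr mulmxBl be mulmx1 mul1mx.
  have eY : mof (cmap_comp gY fY) = e.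
    rewrite eE /mof; congr blk.
      by apply: (@mx_ext _ (cx0 X)) => t; rewrite -mxlE -YE0.
    by apply: (@mx_ext _ (cx1 X)) => t; rewrite -mxlE -YE1.
  have eZ : mof (cmap_comp gZ fZ) = 1%:M - e.
    rewrite eE blk1 blkB !subrr /mof; congr blk.
      by apply: (@mx_ext _ (cx0 X)) => t; rewrite -mxlE -ZE0.
    by apply: (@mx_ext _ (cx1 X)) => t; rewrite -mxlE -ZE1.
  have [kX' hX'] := (in_Kf_killsH nA hm mE X).1 kX.
  have kY : in_Kf Y by apply/(in_Kf_killsH nA hm mE); exists kX' => i; apply: killsH_retract Y0 Y1 (hX' i).
  have kZ : in_Kf Z by apply/(in_Kf_killsH nA hm mE); exists kX' => i; apply: killsH_retract Z0 Z1 (hX' i).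
  suff iso : isomorphic X (dsum Y Z).
    have [z|z] := dec Y Z kY kZ iso.
      left; rewrite -eY mof_comp -[mof fY]mulmx1; move/is_zeroP: z => z.
      by apply: (cyc_bdryr (mof_cyc gY)); apply: (cyc_bdryl (mof_cyc fY)).
    right; rewrite -eZ mof_comp -[mof fZ]mulmx1; move/is_zeroP: z => z.
    by apply: (cyc_bdryr (mof_cyc gZ)); apply: (cyc_bdryl (mof_cyc fZ)).
  have q0' : e00 *m (1%:M - e00) = 0 by rewrite mulmxBr mulmx1 q0 subrr.
  have q1' : e11 *m (1%:M - e11) = 0 by rewrite mulmxBr mulmx1 q1 subrr.
  have q0'' : (1%:M - e00) *m e00 = 0 by rewrite mulmxBl mul1mx q0 subrr.
  have q1'' : (1%:M - e11) *m e11 = 0 by rewrite mulmxBl mul1mx q1 subrr.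
  have ZY0 y : map0 fZ (map0 gY y) = 0.
    rewrite -[LHS]Z0 (_ : map0 gZ _ = 0) ?linear0 //; apply: v2r0.
    by rewrite ZE0 -[y]Y0 YE0 -mulmxA q0' mulmx0.
  have ZY1 y : map1 fZ (map1 gY y) = 0.
    rewrite -[LHS]Z1 (_ : map1 gZ _ = 0) ?linear0 //; apply: v2r0.
    by rewrite ZE1 -[y]Y1 YE1 -mulmxA q1' mulmx0.
  have YZ0 z : map0 fY (map0 gZ z) = 0.
    rewrite -[LHS]Y0 (_ : map0 gY _ = 0) ?linear0 //; apply: v2r0.
    by rewrite YE0 -[z]Z0 ZE0 -mulmxA q0'' mulmx0.
  have YZ1 z : map1 fY (map1 gZ z) = 0.
    rewrite -[LHS]Y1 (_ : map1 gY _ = 0) ?linear0 //; apply: v2r0.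
    by rewrite YE1 -[z]Z1 ZE1 -mulmxA q1'' mulmx0.
  pose F0 (t : cx0 X) := (map0 fY t, map0 fZ t).
  pose F1 (t : cx1 X) := (map1 fY t, map1 fZ t).
  pose G0 (t : cx0 Y * cx0 Z) := map0 gY t.1 + map0 gZ t.2.
  pose G1 (t : cx1 Y * cx1 Z) := map1 gY t.1 + map1 gZ t.2.
  have lF0 : linear F0 by move=> c t t'; rewrite /F0 !linearP.
  have lF1 : linear F1 by move=> c t t'; rewrite /F1 !linearP.
  have lG0 : linear G0 by move=> c t t'; rewrite /G0 /= !linearP /= scalerDr addrACA.
  have lG1 : linear G1 by move=> c t t'; rewrite /G1 /= !linearP /= scalerDr addrACA.
  pose LF0 : {linear cx0 X -> cx0 (dsum Y Z)} := HB.pack F0 (GRing.isLinear.Build _ _ _ _ F0 lF0).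
  pose LF1 : {linear cx1 X -> cx1 (dsum Y Z)} := HB.pack F1 (GRing.isLinear.Build _ _ _ _ F1 lF1).
  pose LG0 : {linear cx0 (dsum Y Z) -> cx0 X} := HB.pack G0 (GRing.isLinear.Build _ _ _ _ G0 lG0).
  pose LG1 : {linear cx1 (dsum Y Z) -> cx1 X} := HB.pack G1 (GRing.isLinear.Build _ _ _ _ G1 lG1).
  have cF0 t : LF1 (dif0 X t) = dif0 (dsum Y Z) (LF0 t) by rewrite /= /F0 /F1 !cmap0P.
  have cF1 t : LF0 (dif1 X t) = dif1 (dsum Y Z) (LF1 t) by rewrite /= /F0 /F1 !cmap1P.
  have cG0 t : LG1 (dif0 (dsum Y Z) t) = dif0 X (LG0 t) by rewrite /= /G0 /G1 /= linearD !cmap0P.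
  have cG1 t : LG0 (dif1 (dsum Y Z) t) = dif1 X (LG1 t) by rewrite /= /G0 /G1 /= linearD !cmap1P.
  exists (CMap cF0 cF1); apply: (@strict_iso _ _ _ _ (CMap cG0 cG1)) => t.
  - by apply: v2r_inj; rewrite /= /G0 /F0 /= linearD /= YE0 ZE0 -mulmxDr addrC subrK mulmx1.
  - by apply: v2r_inj; rewrite /= /G1 /F1 /= linearD /= YE1 ZE1 -mulmxDr addrC subrK mulmx1.
  - by case: t => y z; rewrite /= /G0 /F0 /= !linearD /= Y0 Z0 ZY0 YZ0 addr0 add0r.
  - by case: t => y z; rewrite /= /G1 /F1 /= !linearD /= Y1 Z1 ZY1 YZ1 addr0 add0r.
case: caseE => be.
  right; pose w := u ^+ k *m (1%:M - e).
  have cw : cyc false w := cycM (cycX k cu) c1e.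
  have [l bl] := cyc_modI_nilpotent tG cw e1.
  exists (k * l)%N; rewrite exprM -[_ ^+ l](subrK (w ^+ l)); apply: bdryD => //.
  apply: cyc_bdry_exp => //; first exact: cycX.
  rewrite (_ : _ - w = u ^+ k *m e); first by apply: (cyc_bdryl (cycX k cu)).
  by rewrite /w mulmxBr mulmx1 subKr.
left; pose w := e - u *m v; have cw : cyc false w := cycB ce (cycM cu cv).
have [l bl] := cyc_modI_nilpotent tG cw e2.
pose q := (1%:M - e) + w; have cq : cyc false q.
  by rewrite /q /w addrA subrK; apply: cycB; [apply: cyc1 | apply: (cycM cu cv)].
have bq : bdry (q ^+ l).
  rewrite -[_ ^+ l](subrK (w ^+ l)); apply: bdryD => //; apply: cyc_bdry_exp => //.
  by rewrite /q addrK.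
have [t [ct t1 t2]] := @nil_unit 'M[A]_(gdim G) (cyc false (X := G) (Y := G)) (@bdry A G G)
  (cyc1 G) (@cycB A false G G) (@cycM A false false G G G) (submod0 (bdry_submod G G))
  (@bdryB A G G) q l cq bq.
have euv : 1 - q = u *m v by rewrite /q /w addrA subrK subKr.
rewrite euv in t1 t2; rewrite -!mulmxE in t1 t2.
have r1 : bdry (u *m (v *m t) - 1%:M) by rewrite mulmxA.
have l1 : bdry ((t *m v) *m u - 1%:M) by rewrite -mulmxA -uv.
exists (v *m t); split=> //; first exact: (cycM cv ct).
have cL : cyc false (t *m v) := cycM ct cv; have cR : cyc false (v *m t) := cycM cv ct.
(* The left inverse t v and the right inverse v t agree up to a boundary. *)
rewrite (_ : _ - _ = (t *m v *m (u *m (v *m t) - 1%:M) - (t *m v *m u - 1%:M) *m (v *m t)) *m u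
  + (t *m v *m u - 1%:M)).
  apply: bdryD => //; apply: (cyc_bdryr cu); apply: bdryB; first exact: (cyc_bdryl cL).
  exact: (cyc_bdryr cR).
rewrite !mulmxBl !mulmxBr !mulmx1 !mul1mx !mulmxBl !mulmxA; mxabel.
Qed.

Lemma in_Kf_cshift (X : cplx A) : in_Kf X -> in_Kf (cshift X).
Proof.
move=> /(in_Kf_killsH nA hm mE)[e he]; apply/(in_Kf_killsH nA hm mE).
by exists e => i; apply: killsH_cshift.
Qed.

Lemma in_Kf_cone (X Y : cplx A) (w : cmap X Y) : in_Kf X -> in_Kf Y -> in_Kf (cone w).
Proof.
move=> kX kY; have tX := (in_Kf_torsion nA hm xreg mE X).1 kX.
have tY := (in_Kf_torsion nA hm xreg mE Y).1 kY.
have [e [_ he]] := torsion_uniform tX tY.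
apply/(in_Kf_killsH nA hm mE); exists (e * 2)%N => i; rewrite exprM.
by apply: killsH_cone; apply: nullh_killsH; case: (he i).
Qed.

Lemma indecomposable_cshift (X : cplx A) : indecomposable X -> indecomposable (cshift X).
Proof.
move=> [kX nX dec]; split; first exact: in_Kf_cshift.
  by move=> /is_zero_cshift.
move=> Y Z kY kZ iso.
have [|||z|z] := dec (cshift Y) (cshift Z).
- exact: in_Kf_cshift.
- exact: in_Kf_cshift.
- apply: isomorphic_trans (isomorphic_cshift2 X) _.
  apply: isomorphic_trans (isomorphic_cshift iso) _.
  exact: isomorphic_cshift_dsum.
- by left; apply: is_zero_cshift.
- by right; apply: is_zero_cshift.
Qed.

Lemma mof_cunshiftK (M : cplx A) : mof (cunshiftK M) *m mof (cshift2 M) = 1%:M.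
Proof. by rewrite -mof_comp -mof_id /mof; congr blk. Qed.

End KrullSchmidt.

(** * From AR morphisms to AR triangles *)

Section Triangles.
Variables (A : comNzRingType) (mb : {pred A}) (d : nat) (x : 'I_d -> A).
Let m : A -> Prop := fun a => a \in mb.
Hypotheses (nA : noeth A^o) (hm : localI m) (xreg : regular_system x).
Hypotheses (mE : m = powI x xpredT (fun=> 1%N)) (complete : adically_complete mb).

Let tors (X : cplx A) : indecomposable X -> torsion x (toG X).
Proof. by case=> kX _ _; apply: (in_Kf_torsion nA hm xreg mE X).1. Qed.

Let loc (X : cplx A) : indecomposable X -> localM (toG X).
Proof. exact: (indecomposable_local nA hm xreg mE complete). Qed.

Let Kf (X : cplx A) : indecomposable X -> in_Kf X. Proof. by case. Qed.

Lemma right_AR_triangle_of (N M : cplx A) (h : cmap M (cshift N)) :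
  indecomposable M -> indecomposable N -> ~ homotopic h (cmap_zero _ _) ->
  (forall (D : cplx A) (t : cmap D M), indecomposable D -> ~ is_iso t ->
     homotopic (cmap_comp h t) (cmap_zero _ _)) ->
  exists (E : cplx A) (f : cmap N E) (g : cmap E M), right_AR_triangle f g h.
Proof.
move=> iM iN nh hD; have [f [g fgh]] := right_triangle h.
exists (cone (unshift_map h)), f, g; split=> //.
apply: (in_Kf_cone nA hm xreg mE); last exact: Kf.
exact/(in_Kf_cshift nA hm mE)/Kf.
Qed.

Lemma left_AR_triangle_of (L M : cplx A) (w : cmap (cunshift L) M) :
  indecomposable M -> indecomposable L -> ~ homotopic w (cmap_zero _ _) ->
  (forall (D : cplx A) (t : cmap M D), indecomposable D -> ~ is_iso t ->
     homotopic (cmap_comp t w) (cmap_zero _ _)) ->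
  exists (E : cplx A) (f : cmap M E) (g : cmap E L), left_AR_triangle w f g.
Proof.
move=> iM iL nw wD; exists (cone w), (cone_in w), (cmap_comp (cshift2 L) (cone_out w)).
split=> //; last exact: left_triangle.
apply: (in_Kf_cone nA hm xreg mE); last exact: Kf.
exact/(in_Kf_cshift nA hm mE)/Kf.
Qed.

Lemma right_AR_exists (M : cplx A) : indecomposable M ->
  exists (N E : cplx A) (f : cmap N E) (g : cmap E M) (h : cmap M (cshift N)),
    right_AR_triangle f g h.
Proof.
move=> iM; suff [N [iN [h [nh hD]]]] : exists N, indecomposable N /\
    exists h : cmap M (cshift N), ~ homotopic h (cmap_zero _ _) /\
    forall (D : cplx A) (t : cmap D M), indecomposable D -> ~ is_iso t ->
      homotopic (cmap_comp h t) (cmap_zero _ _).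
  have [E [f [g fgh]]] := right_AR_triangle_of iM iN nh hD.
  by exists N, E, f, g, h.
have [u [cu nu hu]] := right_AR_morphism nA hm xreg mE (tors iM) (loc iM).
have ARu (D : cplx A) (t : cmap D M) : indecomposable D -> ~ is_iso t -> bdry (mof t *m u).
  move=> iD nt; apply: hu (tors iD) (loc iD) (mof_cyc t) _.
  by move/is_isoP.
(* For d odd, u is a map from M to M[1] and N = M. For d even it is an endomorphism of M, and N =
   M[-1], with N[1] identified with M. *)
case: (odd d) cu => cu.
  have [h hE] := cyc_oof cu; exists M; split=> //; exists h; split=> [/oof0P|D t iD nt].
    by rewrite hE.
  by apply/oof0P; rewrite oof_comp hE; apply: ARu.
have [k kE] := cyc_mof cu; exists (cunshift M).
split; first exact: (indecomposable_cshift nA hm mE).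
exists (cmap_comp (cunshiftK M) k); split=> [/homotopic0P|D t iD nt].
  rewrite mof_comp kE => b; apply: nu; rewrite -[u]mulmx1 -mof_cunshiftK mulmxA.
  exact: (cyc_bdryr (mof_cyc _)).
apply/homotopic0P; rewrite !mof_comp kE mulmxA.
by apply: (cyc_bdryr (mof_cyc _)); apply: ARu.
Qed.

Lemma left_AR_exists (M : cplx A) : indecomposable M ->
  exists (L E : cplx A) (w : cmap (cunshift L) M) (f : cmap M E) (g : cmap E L),
    left_AR_triangle w f g.
Proof.
move=> iM; suff [L [iL [w [nw wD]]]] : exists L, indecomposable L /\
    exists w : cmap (cunshift L) M, ~ homotopic w (cmap_zero _ _) /\
    forall (D : cplx A) (t : cmap M D), indecomposable D -> ~ is_iso t ->
      homotopic (cmap_comp t w) (cmap_zero _ _).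
  have [E [f [g fgh]]] := left_AR_triangle_of iM iL nw wD.
  by exists L, E, w, f, g.
have [u [cu nu hu]] := left_AR_morphism nA hm xreg mE (tors iM) (loc iM).
have ARu (D : cplx A) (t : cmap M D) : indecomposable D -> ~ is_iso t -> bdry (u *m mof t).
  move=> iD nt; apply: hu (tors iD) (loc iD) (mof_cyc t) _.
  by move/is_isoP.
(* For d odd, L = M. For d even, L = M[1], so that L[-1] is identified with M by [cshift2]. *)
case: (odd d) cu => cu.
  have [w wE] := cyc_oof' cu; exists M; split=> //; exists w; split=> [/oof'0P|D t iD nt].
    by rewrite wE.
  by apply/oof'0P; rewrite oof'_comp wE; apply: ARu.
have [k kE] := cyc_mof cu; exists (cshift M).
split; first exact: (indecomposable_cshift nA hm mE).
exists (cmap_comp k (cshift2 M)); split=> [/homotopic0P|D t iD nt].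
  rewrite mof_comp kE => b; apply: nu; rewrite -[u]mul1mx -mof_cunshiftK -mulmxA.
  exact: (cyc_bdryl (mof_cyc _)).
apply/homotopic0P; rewrite !mof_comp kE -mulmxA.
by apply: (cyc_bdryl (mof_cyc _)); apply: ARu.
Qed.

End Triangles.

Theorem theorem1p4 (A : comNzRingType) (m : {pred A})
    (A_regular : regular_local_ring m) (A_complete : adically_complete m) :
  has_AR_triangles A.
Proof.
have [d [x [nA hm xreg mE]]] := regular_local_system A_regular.
move=> M iM; split.
  exact: (right_AR_exists nA hm xreg mE A_complete iM).
exact: (left_AR_exists nA hm xreg mE A_complete iM).
Qed.
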